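(* Let $n\ge 1$ and let $M=A\circ X+B$ be an $n\times n$ structured random matrix with standard deviation profile $A=(a_{ij})$, mean profile $B$ and $\kappa_0$-spread atom variable $\xi$, where $\kappa_0\ge 1$. Assume that the thresholded matrix $A(\sigma_0)=(a_{ij}1_{a_{ij}\ge \sigma_0})$ is $(\delta,\nu)$-broadly connected for some $\sigma_0,\delta,\nu\in(0,1)$. Let $K\ge 1$. Then for any $t\ge 0$, \[ \mathbb{P}\Big( s_n(M)\le \frac{t}{\sqrt n},\ \|M\|\le K\sqrt n\Big)\ \le\ C\Big(t+\frac1{\sqrt n}\Big), \] where $C<\infty$ depends only on $K,\delta,\nu,\sigma_0,\kappa_0$.
   Context: Structured random matrix: $A=(a_{ij})$ and $B=(b_{ij})$ are deterministic $n\times n$ matrices with $a_{ij}\in[0,1]$ and $b_{ij}\in\mathbb{C}$; $X=(\xi_{ij})$ is an $n\times n$ matrix with independent entries, all distributed as a complex random variable $\xi$ (the atom variable) with $\mathbb{E}\xi=0$ and $\mathbb{E}|\xi|^2=1$; $M=A\circ X+B=(a_{ij}\xi_{ij}+b_{ij})$. A complex random variable $\xi$ is $\kappa$-spread ($\kappa\ge1$) if $\mathrm{Var}\big[\xi 1(|\xi-\mathbb{E}\xi|\le\kappa)\big]\ge 1/\kappa$. $s_1(M)\ge\dots\ge s_n(M)\ge 0$ are the singular values of $M$, and $\|M\|=s_1(M)$ is the $\ell_2\to\ell_2$ operator norm. For an $n\times m$ matrix $A=(a_{ij})$ with non-negative entries, $\mathcal{N}_A(i)=\{j\in[m]:a_{ij}>0\}$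 for $i\in[n]$, and $\mathcal{N}_{A^{T}}(j)=\{i\in[n]:a_{ij}>0\}$ for $j\in[m]$. For $J\subset[m]$ and $\delta\in(0,1)$, $\mathcal{N}^{(\delta)}_{A^{T}}(J)=\{i\in[n]:|\mathcal{N}_A(i)\cap J|\ge\delta|J|\}$. For $\delta,\nu\in(0,1)$, $A$ is $(\delta,\nu)$-broadly connected if: (1) $|\mathcal{N}_A(i)|\ge\delta m$ for all $i\in[n]$; (2) $|\mathcal{N}_{A^{T}}(j)|\ge\delta n$ for all $j\in[m]$; (3) $|\mathcal{N}^{(\delta)}_{A^{T}}(J)|\ge\min(n,(1+\nu)|J|)$ for all $J\subset[m]$. *)

(* Defs.v *)
From HB Require Import structures.
From mathcomp Require Import all_boot all_order all_algebra.
From mathcomp Require Import complex.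
From mathcomp Require Import all_classical all_reals all_analysis.

Set Implicit Arguments.
Unset Strict Implicit.
Unset Printing Implicit Defensive.

Import Order.TTheory GRing.Theory Num.Theory.
Import numFieldNormedType.Exports.

Local Open Scope classical_set_scope.
Local Open Scope ring_scope.
Local Open Scope sesquilinear_scope.

(* R[i] carries the Borel sigma-algebra of the plane: a set of complex numbers
   is measurable iff it is measurable in R * R under the identification
   x +i* y <-> (x, y). *)
Section complex_measurable.
Variable R : realType.

Definition complex_of_pair (p : R * R) : R[i] := Complex p.1 p.2.

Definition measurable_complex : set (set R[i]) :=
  [set S | measurable (complex_of_pair @^-1` S)].

Let measurable_complex0 : measurable_complex set0.
Proof. by rewrite /measurable_complex /= preimage_set0. Qed.

Let measurable_complexC S : measurable_complex S -> measurable_complex (~` S).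
Proof.
by move=> mS; rewrite /measurable_complex /= preimage_setC; exact: measurableC.
Qed.

Let measurable_complex_bigcup (F : (set R[i])^nat) :
  (forall k, measurable_complex (F k)) ->
  measurable_complex (\bigcup_k (F k)).
Proof.
move=> mF; rewrite /measurable_complex /= preimage_bigcup.
by apply: bigcupT_measurable => k; exact: mF.
Qed.

HB.instance Definition _ := isPointed.Build R[i] 0.
HB.instance Definition _ := isMeasurable.Build default_measure_display R[i]
  measurable_complex0 measurable_complexC measurable_complex_bigcup.

End complex_measurable.

Section complex_moments.
Context d (T : measurableType d) (R : realType) (P : probability T R).
Implicit Type X : T -> R[i].

(* Meaningful when X is integrable, which holds as soon as E|X|^2 < +oo. *)
Definition cexpectation X : R[i] :=
  Complex (fine 'E_P[fun w => complex.Re (X w)])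
          (fine 'E_P[fun w => complex.Im (X w)]).

Definition cmoment2 X : \bar R := 'E_P[fun w => Normc.normc (X w) ^+ 2].

Definition cvariance X : \bar R :=
  cmoment2 (fun w => X w - cexpectation X).

Definition truncation (kappa : R) X : T -> R[i] := fun w =>
  if Normc.normc (X w - cexpectation X) <= kappa then X w else 0.

Definition spread (kappa : R) X : Prop :=
  ((kappa^-1)%:E <= cvariance (truncation kappa X))%E.

End complex_moments.

Definition mutually_independent d d' (T : measurableType d)
    (T' : measurableType d') (R : realType) (P : probability T R)
    (I : finType) (X : I -> {RV P >-> T'}) : Prop :=
  forall (J : {set I}) (E : I -> set T'), (forall i, measurable (E i)) ->
    P (\bigcap_(i in [set` J]) (X i @^-1` E i)) =
    (\prod_(i in J) P (X i @^-1` E i))%E.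

Definition identically_distributed d1 d2 d' (T1 : measurableType d1)
    (T2 : measurableType d2) (T' : measurableType d') (R : realType)
    (P1 : probability T1 R) (P2 : probability T2 R)
    (X1 : {RV P1 >-> T'}) (X2 : {RV P2 >-> T'}) : Prop :=
  forall S : set T', measurable S -> distribution P1 X1 S = distribution P2 X2 S.

Arguments mutually_independent {d d' T T' R} P {I} X.
Arguments identically_distributed {d1 d2 d' T1 T2 T' R} P1 P2 X1 X2.

Section matrices.
Variable R : realType.

Definition structured_mx n (A : 'M[R]_n) (X B : 'M[R[i]]_n) : 'M[R[i]]_n :=
  \matrix_(i, j) ((A i j)%:C%C * X i j + B i j).

(* Singular values in decreasing order: the square roots of the eigenvalues,
   with multiplicity, of the positive semidefinite matrix M^* M. *)
Definition singular_values n (M : 'M[R[i]]_n) : seq R :=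
  sort >=%R [seq Num.sqrt (complex.Re (spectral_diag (M ^t* *m M) 0 i))
            | i <- enum 'I_n].

(* s_k(M), with k counted from 1. *)
Definition singular_value n (M : 'M[R[i]]_n) (k : nat) : R :=
  nth 0 (singular_values M) k.-1.

Definition l2norm n (x : 'cV[R[i]]_n) : R :=
  Num.sqrt (\sum_(i < n) Normc.normc (x i 0) ^+ 2).

Definition opnorm n (M : 'M[R[i]]_n) : R :=
  sup [set l2norm (M *m x) | x in [set x : 'cV[R[i]]_n | l2norm x <= 1]].

Definition threshold n m (sigma : R) (A : 'M[R]_(n, m)) : 'M[R]_(n, m) :=
  \matrix_(i, j) (if sigma <= A i j then A i j else 0).

Definition nbhd n m (A : 'M[R]_(n, m)) (i : 'I_n) : {set 'I_m} :=
  [set j | 0 < A i j]%SET.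

(* N^(delta)_{A^T}(J): note that A itself, not A^T, is the argument. *)
Definition dense_nbhd n m (delta : R) (A : 'M[R]_(n, m)) (J : {set 'I_m}) :
    {set 'I_n} :=
  [set i | delta * #|J|%:R <= #|nbhd A i :&: J|%:R]%SET.

Definition broadly_connected n m (delta nu : R) (A : 'M[R]_(n, m)) : Prop :=
  [/\ forall i : 'I_n, delta * m%:R <= #|nbhd A i|%:R,
      forall j : 'I_m, delta * n%:R <= #|nbhd A^T j|%:R
    & forall J : {set 'I_m},
        Num.min n%:R ((1 + nu) * #|J|%:R) <= #|dense_nbhd delta A J|%:R].

End matrices.

(* Main.v *)
Require Import Defs.
From HB Require Import structures.
From mathcomp Require Import all_boot all_order all_algebra.
From mathcomp Require Import complex.
From mathcomp Require Import all_classical all_reals all_analysis.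
From mathcomp Require Import measurable_realfun.
From mathcomp Require Import ring lra zify.

Import Order.TTheory GRing.Theory Num.Theory.
Import numFieldNormedType.Exports.

(** The entries are first rounded to a fine grid, so that the matrix is a function
    of finitely many independent choices and every probability is a finite sum
    ([prob_le_finite_model]). A spread variable with mean zero and second moment
    one gives mass at most [1 - p0] to any disc of radius [r], where [r] and [p0]
    depend only on [kappa0] ([spread_nondegenerate]), and rounding preserves this
    up to constants. It remains to treat matrices whose entries take finitely many
    values ([finite_model_bound]).

    Two estimates govern the sums [sum_j b_j xi_j]. If [k] of the weights have
    modulus at least [s], the sum lies in a given disc of radius [t] with
    probability at most [C (t / s + 1) / sqrt k]: this is the theorem of
    Littlewood, Offord and Erdos, obtained by conditioning to random signs and
    Sperner's theorem ([small_ball]). For arbitrary weights the sum is of the order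
    of its standard deviation with positive probability ([paley_zygmund]).

    The vectors [x] that are nearly annihilated by the matrix [M] are then shown to
    have many large coordinates, by increasing the excluded sparsity.

    For [theta] small, no vector with at most [theta n] nonzero coordinates is
    nearly annihilated: a fixed vector is rejected with exponentially small
    probability, and a net of such vectors has small cardinality
    ([very_sparse_bound]).

    Suppose that [M] is bounded below on vectors with [m] nonzero coordinates, and
    let [x] be a nearly annihilated vector with slightly more. Choose a set [J] of
    [m] coordinates in its support. Then [M] has a bounded left inverse on [J],
    and removing rows one at a time keeps it bounded until little more than [m]
    rows are left ([left_inverse_select]). These rows determine the coordinates of
    [x] in [J], up to [O(1 / q)], from its few other coordinates, so that [x] is
    confined to [C ^ n q ^ u] cells of size [O(1 / q)], with [u] a small multiple
    of [n] ([approx_kernel_net]); since the cells come from actual rows and not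
    from a net of a sphere, it does not matter that a complex coordinate has two
    real dimensions. By broad connectivity, at least [(1 + nu) m] rows meet a
    fixed proportion of the large coordinates of [x]. At least [4 u] of them have
    not been used to define the cells, and each of these accepts a given cell with
    probability [O(1 / q)]. Even if [u] of them fail, the factor [q ^ (- 3 u)]
    beats the number of cells once [q] is a large constant ([sparsity_step]).
    Finitely many such steps exclude all vectors with at most [(1 - delta / 2) n]
    nonzero coordinates ([compressible_bound]).

    Finally [M] and its transpose have the same smallest singular value. If it is
    at most [t / sqrt n], an almost null vector of the transpose has many
    coordinates of order [1 / sqrt n], and for each such [i] the [i]-th row is at
    distance [O(t)] from the span of the others. Conditionally on the others this
    is an estimate for a sum weighted by a unit vector normal to them. By the
    previous step and the lower bound on the row degrees this sum has a number of
    weights of order [1 / sqrt n] proportional to [n], so that [small_ball] gives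
    [O(t + 1 / sqrt n)] ([fpr_close_row]). *)

Set Implicit Arguments.
Unset Strict Implicit.
Unset Printing Implicit Defensive.

Local Open Scope ring_scope.

(** * Moduli of complex numbers *)

Local Notation nc := Normc.normc.

Section Modulus.
Variable R : realType.
Implicit Types z u : R[i].

Lemma nc_ge0 z : 0 <= nc z.
Proof. by case: z => a b; exact: sqrtr_ge0. Qed.

Lemma sqr_nc z : nc z ^+ 2 = complex.Re z ^+ 2 + complex.Im z ^+ 2.
Proof. by case: z => a b /=; rewrite sqr_sqrtr // addr_ge0 ?sqr_ge0. Qed.

Lemma nc_real (a : R) : nc (a%:C)%C = `|a|.
Proof. by rewrite /= expr0n addr0 sqrtr_sqr. Qed.

Lemma nc_normr z : (nc z)%:C%C = `|z|.
Proof. by case: z. Qed.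

Lemma nc0 : nc (0 : R[i]) = 0.
Proof. by rewrite /= expr0n addr0 sqrtr0. Qed.

Lemma nc_eq0 z : (nc z == 0) = (z == 0).
Proof.
by apply/eqP/eqP => [|->]; [exact: Normc.eq0_normc|exact: nc0].
Qed.

Lemma ncM z u : nc (z * u) = nc z * nc u.
Proof. exact: Normc.normcM. Qed.

Lemma ncD z u : nc (z + u) <= nc z + nc u.
Proof. exact: le_normcD. Qed.

Lemma ncN z : nc (- z) = nc z.
Proof. by rewrite -mulN1r ncM -[X in X * _](_ : 1 = _) ?mul1r //= oppr0 expr0n addr0 sqrrN expr1n sqrtr1. Qed.

Lemma ncB z u : nc (z - u) <= nc z + nc u.
Proof. by rewrite -(ncN u) ncD. Qed.

Lemma nc_distC z u : nc (z - u) = nc (u - z).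
Proof. by rewrite -ncN opprB. Qed.

Lemma normRe_le z : `|complex.Re z| <= nc z.
Proof.
rewrite -(ler_pXn2r (n := 2)) ?nnegrE ?nc_ge0 //.
by rewrite sqr_nc real_normK ?num_real // lerDl sqr_ge0.
Qed.

Lemma normIm_le z : `|complex.Im z| <= nc z.
Proof.
rewrite -(ler_pXn2r (n := 2)) ?nnegrE ?nc_ge0 //.
by rewrite sqr_nc real_normK ?num_real // lerDr sqr_ge0.
Qed.

Lemma nc_le_ReIm z : nc z <= `|complex.Re z| + `|complex.Im z|.
Proof.
rewrite -(ler_pXn2r (n := 2)) ?nnegrE ?nc_ge0 ?addr_ge0 //.
rewrite sqr_nc sqrrD !real_normK ?num_real // -addrA lerD2l lerDr.
by rewrite mulrn_wge0 // mulr_ge0.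
Qed.

Lemma ReD z u : complex.Re (z + u) = complex.Re z + complex.Re u.
Proof. by case: z; case: u. Qed.

Lemma ImD z u : complex.Im (z + u) = complex.Im z + complex.Im u.
Proof. by case: z; case: u. Qed.

Lemma ReB z u : complex.Re (z - u) = complex.Re z - complex.Re u.
Proof. by case: z; case: u. Qed.

Lemma ImB z u : complex.Im (z - u) = complex.Im z - complex.Im u.
Proof. by case: z; case: u. Qed.

Lemma Re_sum (I : Type) (s : seq I) (P : pred I) (F : I -> R[i]) :
  complex.Re (\sum_(i <- s | P i) F i) = \sum_(i <- s | P i) complex.Re (F i).
Proof. exact: (big_morph _ ReD). Qed.

Lemma Im_sum (I : Type) (s : seq I) (P : pred I) (F : I -> R[i]) :
  complex.Im (\sum_(i <- s | P i) F i) = \sum_(i <- s | P i) complex.Im (F i).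
Proof. exact: (big_morph _ ImD). Qed.

End Modulus.

(** * Finite probability spaces and finite products *)

Section FiniteProbability.
Variables (R : realType) (Om : finType) (w : Om -> R).

Definition is_prob := (forall o, 0 <= w o) /\ \sum_o w o = 1.

Definition fex (F : Om -> R) : R := \sum_o w o * F o.

Definition ind (P : Prop) : R := (`[< P >])%:R.

Definition fpr (E : Om -> Prop) : R := fex (fun o => ind (E o)).

Lemma ind_ge0 P : 0 <= ind P.
Proof. by rewrite /ind ler0n. Qed.

Lemma ind_le1 P : ind P <= 1.
Proof. by rewrite /ind lern1; case: asbool. Qed.

Lemma indT (P : Prop) : P -> ind P = 1.
Proof. by rewrite /ind => /asboolT ->. Qed.

Lemma indF (P : Prop) : ~ P -> ind P = 0.
Proof. by rewrite /ind => /asboolF ->. Qed.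

Lemma le_ind (P Q : Prop) : (P -> Q) -> ind P <= ind Q.
Proof.
move=> PQ; case: (pselect P) => HP.
  by rewrite !indT //; exact: PQ.
by rewrite (indF HP) ind_ge0.
Qed.

Lemma fexD F G : fex (fun o => F o + G o) = fex F + fex G.
Proof. by rewrite /fex -big_split /=; apply: eq_bigr => o _; rewrite mulrDr. Qed.

Lemma fexZ a F : fex (fun o => a * F o) = a * fex F.
Proof. by rewrite /fex mulr_sumr; apply: eq_bigr => o _; rewrite mulrCA. Qed.

Lemma fex_sum (K : finType) (P : pred K) (F : K -> Om -> R) :
  fex (fun o => \sum_(k | P k) F k o) = \sum_(k | P k) fex (F k).
Proof.
rewrite /fex exchange_big /=; apply: eq_bigr => o _.
by rewrite mulr_sumr.
Qed.

Hypothesis wp : is_prob.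

Lemma fex_cst a : fex (fun=> a) = a.
Proof. by rewrite /fex -mulr_suml wp.2 mul1r. Qed.

Lemma le_fex F G : (forall o, F o <= G o) -> fex F <= fex G.
Proof. by move=> FG; apply: ler_sum => o _; apply: ler_wpM2l (FG o); exact: wp.1. Qed.

Lemma fex_ge0 F : (forall o, 0 <= F o) -> 0 <= fex F.
Proof. by move=> F0; apply: sumr_ge0 => o _; rewrite mulr_ge0 // wp.1. Qed.

Lemma fpr_ge0 E : 0 <= fpr E.
Proof. by apply: fex_ge0 => o; exact: ind_ge0. Qed.

Lemma fpr_le1 E : fpr E <= 1.
Proof. by rewrite -[leRHS](fex_cst 1); apply: le_fex => o; exact: ind_le1. Qed.

Lemma le_fpr (E F : Om -> Prop) : (forall o, E o -> F o) -> fpr E <= fpr F.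
Proof. by move=> EF; apply: le_fex => o; exact/le_ind/EF. Qed.

Lemma fprC E : fpr (fun o => ~ E o) = 1 - fpr E.
Proof.
apply/eqP; rewrite eq_sym subr_eq -fexD; apply/eqP; rewrite -[LHS](fex_cst 1).
apply: eq_bigr => o _; congr (_ * _).
by case: (pselect (E o)) => h; [rewrite indF // indT // add0r|rewrite indT // indF // addr0].
Qed.

Lemma fprU E F : fpr (fun o => E o \/ F o) <= fpr E + fpr F.
Proof.
rewrite -fexD; apply: le_fex => o; case: (pselect (E o)) => Eo.
  by rewrite (indT Eo) indT ?lerDl ?ind_ge0 //; left.
by rewrite (indF Eo) add0r; apply: le_ind => -[].
Qed.

Lemma fpr_exists (K : finType) (G : pred K) (E : K -> Om -> Prop) :
  fpr (fun o => exists2 k, G k & E k o) <= \sum_(k | G k) fpr (E k).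
Proof.
rewrite -fex_sum; apply: le_fex => o.
case: (pselect (exists2 k, G k & E k o)) => [[k Gk Ek]|h].
  rewrite indT; last by exists k.
  by rewrite (bigD1 k) //= indT // lerDl sumr_ge0 // => *; exact: ind_ge0.
by rewrite indF // sumr_ge0 // => *; exact: ind_ge0.
Qed.

Lemma fpr_exists_le (K : finType) (G : pred K) (E : K -> Om -> Prop) b :
  (forall k, G k -> fpr (E k) <= b) ->
  fpr (fun o => exists2 k, G k & E k o) <= #|G|%:R * b.
Proof.
move=> h; apply: le_trans (fpr_exists _ _) _.
by rewrite mulr_natl -sumr_const; apply: ler_sum.
Qed.

Lemma fpr_markov F a : (forall o, 0 <= F o) ->
  a * fpr (fun o => a <= F o) <= fex F.
Proof.
move=> F0; rewrite -fexZ; apply: le_fex => o.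
case: (pselect (a <= F o)) => h; first by rewrite indT // mulr1.
by rewrite indF // mulr0.
Qed.

(** The values below [b] contribute at most [b] to the mean. *)
Lemma fpr_reverse_markov F b : (forall o, F o <= 1) -> 0 <= b ->
  2 * b <= fex F -> b <= fpr (fun o => b <= F o).
Proof.
move=> F1 b0 hb; have: fex F <= fex (fun o => b + ind (b <= F o)).
  apply: le_fex => o; case: (pselect (b <= F o)) => h.
    by rewrite indT // (le_trans (F1 o)) // lerDr.
  by rewrite indF // addr0 ltW // ltNge; apply/negP.
rewrite fexD fex_cst -/(fpr _); lra.
Qed.

End FiniteProbability.

Section Products.
Variables (R : realType) (I V : finType) (p : V -> R).

Definition prodw (f : {ffun I -> V}) : R := \prod_i p (f i).

Lemma fex_prodw_prod (F : I -> V -> R) :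
  fex prodw (fun f => \prod_i F i (f i)) = \prod_i fex p (F i).
Proof.
rewrite /fex bigA_distr_bigA /=; apply: eq_bigr => f _.
by rewrite /prodw -big_split.
Qed.

Definition mix (S : {set I}) (f g : {ffun I -> V}) : {ffun I -> V} :=
  [ffun i => if i \in S then f i else g i].

Hypothesis wp : is_prob p.

Lemma prodw_prob : is_prob prodw.
Proof.
split=> [f|]; first by apply: prodr_ge0 => i _; exact: wp.1.
have := fex_prodw_prod (fun _ _ => 1).
rewrite [RHS]big1; last by move=> i _; rewrite fex_cst.
move=> <-; apply: eq_bigr => f _; rewrite big1 ?mulr1 //.
Qed.

Lemma fpr_marginal (E : V -> Prop) (i : I) :
  fpr prodw (fun f => E (f i)) = fpr p E.
Proof.
have := fex_prodw_prod (fun j v => if j == i then ind R (E v) else 1).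
rewrite [X in _ = X -> _](bigD1 i) //= eqxx [X in _ = _ * X -> _]big1 ?mulr1; last first.
  by move=> j /negbTE ->; rewrite fex_cst.
move=> e; apply: (etrans _ e).
apply: eq_bigr => f _; congr (_ * _); rewrite (bigD1 i) //= eqxx big1 ?mulr1 //.
by move=> j /negbTE ->.
Qed.

(** Exchanging the coordinates outside [S] between two independent copies is a
    weight-preserving involution of pairs, so a mixture of two independent
    copies has again the product law. *)
Lemma fex_resample (S : {set I}) F :
  fex prodw (fun f => fex prodw (fun g => F (mix S f g))) = fex prodw F.
Proof.
rewrite /fex; under eq_bigr => f _ do rewrite mulr_sumr.
rewrite pair_big /=.
pose h (u : {ffun I -> V} * {ffun I -> V}) := (mix S u.1 u.2, mix S u.2 u.1).
have hK : involutive h.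
  case=> f g; rewrite /h /=; apply: f_equal2; apply/ffunP => i;
    by rewrite !ffunE; case: (i \in S).
rewrite (reindex_inj (inv_inj hK)) /=.
transitivity (\sum_f \sum_g prodw f * F f * prodw g); last first.
  apply: eq_bigr => f _; rewrite -mulr_sumr.
  by have [_ ->] := prodw_prob; rewrite mulr1.
rewrite pair_big /=; apply: eq_bigr => -[f g] _ /=.
have -> : mix S (mix S f g) (mix S g f) = f.
  by apply/ffunP => i; rewrite !ffunE; case: (i \in S).
suff h2 : prodw (mix S f g) * prodw (mix S g f) = prodw f * prodw g.
  by rewrite mulrA h2; ring.
rewrite /prodw -!big_split /=; apply: eq_bigr => i _; rewrite !ffunE.
by case: (i \in S) => //; rewrite mulrC.
Qed.

Lemma fpr_conditional (S : {set I}) E b :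
  (forall f, fpr prodw (fun g => E (mix S f g)) <= b) -> fpr prodw E <= b.
Proof.
move=> h; rewrite /fpr -(fex_resample S) -[leRHS](fex_cst prodw_prob).
by apply: (le_fex prodw_prob) => f; exact: h.
Qed.

(** Chernoff's bound: the generating function of the number of bad coordinates
    factors over the coordinates. *)
Lemma fpr_chernoff (bad : I -> V -> Prop) (J : {set I}) q lam h :
  1 <= lam -> (forall i, i \in J -> fpr p (bad i) <= q) ->
  fpr prodw (fun f => (h <= #|[set i in J | `[< bad i (f i) >]]|)%N) * lam ^+ h
  <= (1 + (lam - 1) * q) ^+ #|J|.
Proof.
move=> lam1 hq.
pose F i v : R := if i \in J then lam ^+ (`[< bad i v >]) else 1.
have lam0 : 0 <= lam by exact: le_trans lam1.
have F0 i v : 0 <= F i v by rewrite /F; case: ifP => // _; rewrite exprn_ge0.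
have FE f : \prod_i F i (f i) = lam ^+ #|[set i in J | `[< bad i (f i) >]]|.
  rewrite -sum1dep_card big_mkcondr /= (big_morph _ (exprD lam) (expr0 lam)).
  rewrite [RHS]big_mkcond /=; apply: eq_bigr => i _.
  by rewrite /F; case: (i \in J) => //=; case: asbool.
apply: (@le_trans _ _ (fex prodw (fun f => \prod_i F i (f i)))).
  rewrite mulrC /fpr -fexZ; apply: (le_fex prodw_prob) => f; rewrite FE.
  case: (pselect (is_true (h <= #|[set i in J | `[< bad i (f i) >]]|)%N)) => hh.
    by rewrite indT // mulr1; exact: ler_weXn2l.
  by rewrite indF // mulr0 exprn_ge0.
rewrite fex_prodw_prod -prodr_const [leRHS]big_mkcond /=.
apply: ler_prod => i _; rewrite fex_ge0 //=.
rewrite /F; case: ifPn => iJ; last by rewrite fex_cst.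
rewrite -[X in X + _](fex_cst wp 1).
apply: (@le_trans _ _ (fex p (fun v => 1 + (lam - 1) * ind R (bad i v)))).
  apply: le_fex => // v; rewrite /ind; case: asbool => /=.
    by rewrite expr1 mulr1 addrC subrK.
  by rewrite mulr0 addr0 expr0.
rewrite fexD fexZ lerD2l ler_wpM2l ?subr_ge0 //; exact: hq.
Qed.

End Products.

(** * Antichains and sums of random signs *)

Lemma leq_bin_half k a : ('C(k, a) <= 'C(k, k./2))%N.
Proof.
have up b : (b <= k./2 -> forall c, c <= b -> 'C(k, c) <= 'C(k, b))%N.
  elim: b => [_ c|b IH hb c]; first by rewrite leqn0 => /eqP ->.
  rewrite leq_eqVlt => /orP[/eqP -> //|]; rewrite ltnS => hc.
  apply: leq_trans (IH (ltnW hb) c hc) _.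
  have h := mul_bin_left k b.
  have hkb : (b.+1 <= k - b)%N by have := odd_double_half k; lia.
  rewrite -(leq_pmul2l (ltn0Sn b)) h leq_mul2r hkb; exact: orbT.
case: (leqP a (k./2)) => ha; first exact: up.
case: (leqP a k) => hak; last by rewrite bin_small.
rewrite -bin_sub //; case: (leqP (k - a) (k./2)) => h2; first exact: up.
by have := odd_double_half k; lia.
Qed.

(** The sharp induction step is [(2m+1)(2m+3) <= 4(m+1)^2]. *)
Lemma leq_bin_double m : ('C(m.*2, m) ^ 2 * m.*2.+1 <= 16 ^ m)%N.
Proof.
elim: m => [|m IH] //.
have h1 := mul_bin_left (m.*2.+1) m; have h2 := mul_bin_left (m.*2.+2) m.
have e1 : (m.+1 * 'C(m.*2.+1, m) = m.*2.+1 * 'C(m.*2, m))%N.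
  have := mul_bin_down (m.*2.+1) m; rewrite -addnn /=.
  by have -> : ((m + m).+1 - m = m.+1)%N by lia.
have e2 : ('C(m.+1.*2, m.+1) = 2 * 'C(m.*2.+1, m))%N.
  rewrite doubleS binS; have -> : 'C(m.*2.+1, m.+1) = 'C(m.*2.+1, m).
    by rewrite -bin_sub; [congr binomial|]; rewrite -addnn; lia.
  by rewrite mul2n addnn.
have e3 : (m.+1 ^ 2 * ('C(m.+1.*2, m.+1) ^ 2 * m.+1.*2.+1)
          = (4 * (m.*2.+1 * m.*2.+3)) * ('C(m.*2, m) ^ 2 * m.*2.+1))%N.
  rewrite e2 mulnA -expnMn mulnCA e1 doubleS; rewrite !expnMn; ring.
have : (m.+1 ^ 2 * ('C(m.+1.*2, m.+1) ^ 2 * m.+1.*2.+1)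
        <= m.+1 ^ 2 * 16 ^ m.+1)%N.
  rewrite e3 (expnS 16) (mulnA (m.+1 ^ 2)%N); apply: leq_mul IH.
  by rewrite (mulnC _ 16) -(mulnA 4 4) leq_mul2l /= -addnn; nia.
by rewrite leq_pmul2l // expn_gt0.
Qed.

Lemma leq_bin_half_sqr k : ('C(k, k./2) ^ 2 * k <= 4 ^ k)%N.
Proof.
have := odd_double_half k; set m := k./2; case: (odd k) => /= <-; last first.
  rewrite add0n; apply: leq_trans (_ : _ <= 16 ^ m)%N _.
    by apply: leq_trans (leq_bin_double m); rewrite leq_mul2l leqnSn orbT.
  by rewrite -mul2n expnM.
have h := leq_bin_double m.+1.
have e2 : ('C(m.+1.*2, m.+1) = 2 * 'C(m.*2.+1, m))%N.
  rewrite doubleS binS; have -> : 'C(m.*2.+1, m.+1) = 'C(m.*2.+1, m).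
    by rewrite -bin_sub; [congr binomial|]; rewrite -addnn; lia.
  by rewrite mul2n addnn.
move: h; rewrite e2 expnMn add1n => h.
have : (4 * ('C(m.*2.+1, m) ^ 2 * m.*2.+1) <= 4 * 4 ^ m.*2.+1)%N.
  apply: leq_trans (_ : _ <= 16 ^ m.+1)%N _.
    apply: leq_trans h; rewrite (_ : (2 ^ 2 = 4)%N) // -mulnA leq_mul2l /= leq_mul2l.
    by apply/orP; right; rewrite doubleS; lia.
  by rewrite -expnS (_ : (16 = 4 ^ 2)%N) // -expnM mul2n doubleS.
by rewrite leq_pmul2l.
Qed.

Section Sperner.
Import boot.fintype boot.finset.

(** The Lubell-Yamamoto-Meshalkin inequality. When the ground set [J] is not in
    the family, the weight of [A] is the mean over [x] in [J] of its weight as a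
    subset of [J] minus [x] (zero if [x] is in [A]), which reduces the claim to
    smaller ground sets. *)
Lemma lym (R : realType) (T : finType) (J : {set T}) (F : {set {set T}}) :
  (forall A, A \in F -> A \subset J) ->
  (forall A B, A \in F -> B \in F -> A \subset B -> A = B) ->
  \sum_(A in F) ('C(#|J|, #|A|)%:R : R)^-1 <= 1.
Proof.
move: {2}(#|J|) (erefl #|J|) => k; elim: k J F => [|k IH] J F kJ FJ anti.
  have J0 : J = set0 by apply/eqP; rewrite -cards_eq0 kJ.
  have F0 A : A \in F -> A = set0.
    by move=> /FJ; rewrite J0 subset0 => /eqP.
  apply: (@le_trans _ _ (\sum_(A in [set set0 : {set T}]) 1)); last first.
    by rewrite big_set1.
  rewrite [leLHS]big_mkcond [leRHS]big_mkcond /=; apply: ler_sum => A _.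
  rewrite inE; case: ifPn => AF; last by case: ifP.
  by rewrite (F0 _ AF) eqxx kJ cards0 bin0 invr1.
have [JF|JF] := boolP (J \in F).
  rewrite (eq_bigl (pred1 J)) ?big_pred1_eq ?binn ?invr1 // => A /=.
  apply/idP/eqP => [AF|-> //]; exact: anti (FJ _ AF).
have hx x : x \in J ->
    \sum_(A in F | x \notin A) ('C(k, #|A|)%:R : R)^-1 <= 1.
  move=> xJ; have kJx : #|J :\ x| = k by have := cardsD1 x J; rewrite xJ kJ; lia.
  have := IH (J :\ x) [set A in F | x \notin A] kJx.
  rewrite kJx (eq_bigl (fun A => (A \in F) && (x \notin A))) => [|A]; last by rewrite inE.
  apply=> [A|A B]; rewrite !inE.
    by move=> /andP[/FJ AJ xA]; rewrite subsetD1 AJ.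
  by move=> /andP[AF _] /andP[BF _]; exact: anti.
have wA A : A \in F -> ('C(#|J|, #|A|)%:R : R)^-1 =
    k.+1%:R^-1 * \sum_(x in J | x \notin A) ('C(k, #|A|)%:R : R)^-1.
  move=> AF; have AJ := FJ _ AF.
  have ltA : (#|A| < k.+1)%N.
    rewrite -kJ; apply: proper_card; rewrite properEneq AJ andbT.
    by apply: contraNneq JF => <-.
  rewrite sumr_const.
  have -> : #|(fun x => (x \in J) && (x \notin A))| = (k.+1 - #|A|)%N.
    rewrite -kJ -(cardsDS AJ); apply: eq_card => x.
    by rewrite !inE andbC.
  rewrite kJ -(mulr_natr _^-1).
  have := mul_bin_down k.+1 #|A|; rewrite /= => /(congr1 (fun u => u%:R : R)).
  rewrite !natrM => h.
  have c1 : ('C(k.+1, #|A|)%:R : R) != 0 by rewrite pnatr_eq0 -lt0n bin_gt0 ltnW.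
  have c2 : ('C(k, #|A|)%:R : R) != 0 by rewrite pnatr_eq0 -lt0n bin_gt0.
  have k1 : (k.+1%:R : R) != 0 by rewrite pnatr_eq0.
  have alg (a b q s : R) : a != 0 -> b != 0 -> s != 0 -> s * b = q * a ->
      a^-1 = s^-1 * (b^-1 * q).
    move=> a0 b0 s0 e; have -> : q = s * b / a by rewrite e mulfK.
    by field; rewrite a0 b0 s0.
  exact: alg.
rewrite (eq_bigr _ wA) -mulr_sumr (exchange_big_dep (fun x => x \in J)) /=; last first.
  by move=> A x _ /andP[].
rewrite mulrC ler_pdivrMr ?ltr0n // mul1r.
apply: (@le_trans _ _ (\sum_(x in J) 1)); last by rewrite sumr_const kJ.
apply: ler_sum => x xJ; apply: le_trans (hx x xJ).
by rewrite le_eqVlt; apply/orP; left; apply/eqP; apply: eq_bigl => A; rewrite xJ.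
Qed.

End Sperner.

Section Rademacher.
Import boot.fintype boot.finset.
Variables (R : realType) (T : finType).
Implicit Types (J S : {set T}) (F : {set {set T}}).

Lemma sum_cst_sets (a : R) : \sum_(S : {set T}) a = 2 ^+ #|T| * a.
Proof.
rewrite sumr_const -(mulr_natl a) -natrX -[in RHS]cardsT -card_powerset; congr (_%:R * _).
by apply: eq_card => S; rewrite powersetE subsetT.
Qed.

(** The sets with a prescribed trace outside [J] form an antichain of subsets of
    [J], so each of the [2 ^ (#|T| - #|J|)] fibres is at most a central binomial
    coefficient, of order [2 ^ #|J| / sqrt #|J|]. *)
Lemma card_antichain J F :
  (forall A B, A \in F -> B \in F -> A \subset B -> A :\: J = B :\: J -> A = B) ->
  #|F|%:R * Num.sqrt #|J|%:R <= 2 ^+ #|T| :> R.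
Proof.
move=> anti; set k := #|J|.
have fib U : (#|[set A in F | A :\: J == U]| <= 'C(k, k./2))%N.
  pose G := [set A :&: J | A in [set A in F | A :\: J == U]].
  have inj : {in [set A in F | A :\: J == U] &, injective (fun A => A :&: J)}.
    move=> A B; rewrite !inE => /andP[_ /eqP hA] /andP[_ /eqP hB] e.
    by rewrite -(setID A J) -(setID B J) hA hB e.
  rewrite -(card_in_imset inj) -/G.
  have : \sum_(A in G) ('C(#|J|, #|A|)%:R : R)^-1 <= 1.
    apply: lym => [A /imsetP[B _ ->]|A B]; first exact: subsetIr.
    move=> /imsetP[A' hA ->] /imsetP[B' hB ->] sAB; congr (_ :&: J).
    move: hA hB; rewrite !inE => /andP[AF /eqP hA] /andP[BF /eqP hB].
    apply: anti => //; last by rewrite hA hB.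
    by rewrite -(setID A' J) -(setID B' J) hA hB setSU.
  move=> h; rewrite -(ler_nat R).
  have c0 : (0 : R) < 'C(k, k./2)%:R.
    by rewrite ltr0n bin_gt0; have := odd_double_half k; lia.
  suff : \sum_(A in G) ('C(k, k./2)%:R : R)^-1 <= 1.
    by rewrite sumr_const -(mulr_natl _^-1) ler_pdivrMr // mul1r.
  apply: le_trans h; apply: ler_sum => A /imsetP[B _ ->].
  have hA : (#|B :&: J| <= #|J|)%N by rewrite subset_leq_card // subsetIr.
  rewrite lef_pV2 ?posrE // ?ltr0n ?bin_gt0 // ler_nat; exact: leq_bin_half.
have cF : (#|F| <= 2 ^ (#|T| - k) * 'C(k, k./2))%N.
  have -> : #|F| = (\sum_(U in powerset (~: J)) #|[set A in F | A :\: J == U]|)%N.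
    rewrite -sum1_card (partition_big (fun A => A :\: J) (mem (powerset (~: J)))) /=.
      apply: eq_bigr => U _; rewrite -sum1_card; apply: eq_bigl => A.
      by rewrite !inE.
    by move=> A _; rewrite inE setDE subsetIr.
  apply: (@leq_trans (\sum_(U in powerset (~: J)) 'C(k, k./2))%N).
    by apply: leq_sum => U _; exact: fib.
  rewrite sum_nat_const card_powerset leq_mul2r.
  by have := cardsC J; rewrite -/k => /eqP h; apply/orP; right; rewrite leq_exp2l //; lia.
have kT : (k <= #|T|)%N by exact: max_card.
have cb : 'C(k, k./2)%:R * Num.sqrt k%:R <= 2 ^+ k :> R.
  rewrite -(ler_pXn2r (n := 2)) ?nnegrE ?mulr_ge0 ?sqrtr_ge0 ?exprn_ge0 //.
  rewrite exprMn sqr_sqrtr // -exprM mulnC exprM -!natrX -natrM ler_nat.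
  exact: leq_bin_half_sqr.
apply: (@le_trans _ _ ((2 ^ (#|T| - k) * 'C(k, k./2))%:R * Num.sqrt k%:R)).
  by apply: ler_wpM2r; rewrite ?sqrtr_ge0 // ler_nat.
rewrite natrM -mulrA natrX -[in leRHS](subnK kT) exprD.
by apply: ler_wpM2l cb; rewrite exprn_ge0.
Qed.

Definition select_sum (g0 g1 : T -> R) S := \sum_j (if j \in S then g1 j else g0 j).

(** Erdos's argument: when the sums increase with [S] by steps of at least [s] on
    [J], two sets with sums in the same window of length [s] cannot be nested. *)
Lemma card_window_pos g0 g1 J s a : (forall j, j \in J -> g0 j + s <= g1 j) -> 0 < s ->
  #|[set S | a <= select_sum g0 g1 S < a + s]|%:R * Num.sqrt #|J|%:R <= 2 ^+ #|T| :> R.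
Proof.
move=> hs s0; apply: card_antichain => A B.
rewrite !inE => /andP[aA Aa] /andP[aB Ba] sAB eJ.
apply/eqP; rewrite eqEsubset sAB /=; apply/subsetP => j jB.
apply/negPn/negP => jA.
have jJ : j \in J.
  apply/negPn/negP => jJ; move/setP : eJ => /(_ j).
  by rewrite !inE jJ jB (negbTE jA).
suff : select_sum g0 g1 A + s <= select_sum g0 g1 B by lra.
rewrite /select_sum (bigD1 j) //= [leRHS](bigD1 j) //= jB (negbTE jA) addrAC.
apply: lerD; first exact: hs.
apply: ler_sum => i ij; case: ifP => iA; first by rewrite (subsetP sAB).
case: ifP => // iB; have iJ : i \in J.
  apply/negPn/negP => iJ; move/setP : eJ => /(_ i).
  by rewrite !inE iJ iB iA.
by have := hs i iJ; lra.
Qed.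

(** Exchanging [g0 j] and [g1 j] where [g1 j < g0 j] permutes the sets [S], so
    the sums may be assumed monotone in [S]. *)
Lemma card_window g0 g1 J s a : (forall j, j \in J -> s <= `|g1 j - g0 j|) -> 0 < s ->
  #|[set S | a <= select_sum g0 g1 S < a + s]|%:R * Num.sqrt #|J|%:R <= 2 ^+ #|T| :> R.
Proof.
move=> hs s0; pose sg j := g1 j < g0 j.
pose flip S := [set j | (j \in S) (+) sg j].
have flipK : involutive flip by move=> S; apply/setP => j; rewrite !inE addbK.
pose h0 j := if sg j then g1 j else g0 j.
pose h1 j := if sg j then g0 j else g1 j.
have rE S : select_sum h0 h1 S = select_sum g0 g1 (flip S).
  by apply: eq_bigr => j _; rewrite inE /h0 /h1; case: (j \in S); case: (sg j).
have -> : #|[set S | a <= select_sum g0 g1 S < a + s]| = #|[set S | a <= select_sum h0 h1 S < a + s]|.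
  rewrite -(card_imset _ (inv_inj flipK)); congr #|pred_of_set _|; apply/setP => S.
  rewrite inE rE; apply/imsetP/idP => [[S' + ->]|h]; first by rewrite inE flipK.
  by exists (flip S); rewrite ?flipK // inE.
apply: card_window_pos => // j /hs; rewrite /h0 /h1 /sg; case: ltP => h.
  by rewrite ltr0_norm ?subr_lt0 //; lra.
by rewrite ger0_norm ?subr_ge0 //; lra.
Qed.

Lemma card_interval g0 g1 J s z t :
  (forall j, j \in J -> s <= `|g1 j - g0 j|) -> 0 < s -> 0 <= t ->
  #|[set S | `|select_sum g0 g1 S - z| <= t]|%:R * Num.sqrt #|J|%:R
  <= (2 * t / s + 1) * 2 ^+ #|T| :> R.
Proof.
move=> hs s0 t0; pose N := (Num.truncn (2 * t / s)).+1.
have ts0 : 0 <= 2 * t / s by rewrite divr_ge0 ?mulr_ge0 // ltW.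
have cN : N%:R <= 2 * t / s + 1 by rewrite /N -natr1 lerD2r truncn_le.
apply: (@le_trans _ _ (N%:R * 2 ^+ #|T|)); last by rewrite ler_wpM2r ?exprn_ge0.
pose W (i : 'I_N) := [set S | z - t + i%:R * s <= select_sum g0 g1 S < z - t + i%:R * s + s].
have sub : [set S | `|select_sum g0 g1 S - z| <= t] \subset \bigcup_i W i.
  apply/subsetP => S; rewrite inE ler_norml => /andP[l1 l2].
  pose x := (select_sum g0 g1 S - (z - t)) / s.
  have x0 : 0 <= x by rewrite /x divr_ge0 ?(ltW s0) //; lra.
  have xle : x <= 2 * t / s by rewrite /x ler_pM2r ?invr_gt0 //; lra.
  have /andP[i1 i2] := truncn_itv x0.
  have iN : (Num.truncn x < N)%N by rewrite ltnS; apply: le_truncn.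
  apply/bigcupP; exists (Ordinal iN) => //; rewrite inE /=.
  have ex : select_sum g0 g1 S = z - t + x * s by rewrite /x divfK ?gt_eqF //; ring.
  have h1 : (Num.truncn x)%:R * s <= x * s by rewrite ler_pM2r.
  have h2 : x * s < (Num.truncn x).+1%:R * s by rewrite ltr_pM2r.
  rewrite -natr1 mulrDl mul1r in h2.
  by rewrite ex; apply/andP; split; lra.
apply: (@le_trans _ _ ((\sum_i #|W i|%:R) * Num.sqrt #|J|%:R)).
  apply: ler_wpM2r; rewrite ?sqrtr_ge0 // -natr_sum ler_nat.
  apply: leq_trans (subset_leq_card sub) _.
  by elim/big_ind2 : _ => [|A1 n1 A2 n2 h1 h2|i _]; rewrite ?cards0 //;
    apply: leq_trans (leq_card_setU _ _) _; exact: leq_add.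
have -> : N%:R * 2 ^+ #|T| = \sum_(i < N) 2 ^+ #|T| :> R.
  by rewrite sumr_const card_ord mulr_natl.
rewrite mulr_suml.
by apply: ler_sum => i _; exact: card_window.
Qed.

(** ** Moments *)

Let sgn S j : R := if j \in S then 1 else -1.

(** Adding or removing [k] is an involution of the sets that changes the sign. *)
Lemma sum_sgn (k : T) (G : {set T} -> R) :
  (forall S, G (k |: S) = G (S :\ k)) -> \sum_S G S * sgn S k = 0.
Proof.
move=> hG; pose fl S := if k \in S then S :\ k else k |: S.
have flK : involutive fl.
  move=> S; rewrite /fl; case: (boolP (k \in S)) => kS.
    by rewrite !inE eqxx /= setD1K.
  by rewrite !inE eqxx /= setU1K.
have GE S : G (fl S) = G S.
  rewrite /fl; case: ifPn => kS; first by rewrite -hG; congr G; apply/setUidPr; rewrite sub1set.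
  by rewrite hG; congr G; apply/setDidPl; rewrite disjoint_sym disjoints1.
apply/eqP; rewrite -[_ == 0](mulrn_eq0 _ 2) mulr2n {2}(reindex_inj (inv_inj flK)) /=.
rewrite -big_split big1 //= => S _; rewrite GE -mulrDr /sgn /fl.
by case: (boolP (k \in S)) => kS; rewrite !inE eqxx /= ?subrr ?addNr ?mulr0.
Qed.

Let Y (d : T -> R) x (s : seq T) S := x + \sum_(j <- s) sgn S j * d j.

Let Yinv d x s k S : k \notin s -> Y d x s (k |: S) = Y d x s (S :\ k).
Proof.
move=> ks; congr (_ + _); apply: eq_big_seq => j js.
have jk : j != k by apply: contraNneq ks => <-.
by rewrite /sgn !inE (negbTE jk).
Qed.

Let Ycons d x k s S : Y d x (k :: s) S = Y d x s S + sgn S k * d k.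
Proof. by rewrite /Y big_cons; ring. Qed.

Let sgn2 S k : sgn S k * sgn S k = 1.
Proof. by rewrite /sgn; case: ifP; rewrite ?mulrNN mulr1. Qed.

(* One sign at a time: only the terms of even degree in the new sign survive the
   summation over the sets. *)
Let moments d x s : uniq s ->
  let s2 := \sum_(j <- s) d j ^+ 2 in
  \sum_S Y d x s S ^+ 2 = 2 ^+ #|T| * (x ^+ 2 + s2) /\
  \sum_S Y d x s S ^+ 4 <=
    2 ^+ #|T| * (x ^+ 4 + 6 * x ^+ 2 * s2 + 3 * s2 ^+ 2).
Proof.
have cT : \sum_(S : {set T}) (1 : R) = 2 ^+ #|T|.
  by rewrite sum_cst_sets mulr1.
elim: s => [_|k s IH /= /andP[ks us]].
  rewrite /= !big_nil.
  have e S : Y d x [::] S = x by rewrite /Y big_nil addr0.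
  split; under eq_bigr => S _ do rewrite e; rewrite sum_cst_sets.
    by rewrite addr0.
  by rewrite mulr0 expr0n mulr0 !addr0.
have [IH2 IH4] := IH us; rewrite big_cons; set s2 := \sum_(j <- s) _ in IH2 IH4 *.
have hz (F : R -> R) : \sum_S F (Y d x s S) * sgn S k = 0.
  by apply: sum_sgn => S; rewrite Yinv.
split.
  have e S : Y d x (k :: s) S ^+ 2 =
      Y d x s S ^+ 2 + 1 * d k ^+ 2 + (2 * d k * Y d x s S) * sgn S k.
    by rewrite Ycons sqrrD exprMn [in sgn S k ^+ 2]expr2 sgn2; ring.
  rewrite (eq_bigr _ (fun S _ => e S)) !big_split /= (hz (fun y => 2 * d k * y)).
  by rewrite IH2 -mulr_suml cT; ring.
have e S : Y d x (k :: s) S ^+ 4 =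
    Y d x s S ^+ 4 + 6 * d k ^+ 2 * Y d x s S ^+ 2 + 1 * d k ^+ 4
    + (4 * d k * Y d x s S ^+ 3 + 4 * d k ^+ 3 * Y d x s S) * sgn S k.
  have -> : 6 * d k ^+ 2 * Y d x s S ^+ 2 = 6 * (sgn S k * sgn S k) * d k ^+ 2 * Y d x s S ^+ 2.
    by rewrite sgn2 mulr1.
  have -> : 1 * d k ^+ 4 = (sgn S k * sgn S k) * (sgn S k * sgn S k) * d k ^+ 4.
    by rewrite sgn2 !mul1r.
  have -> : (4 * d k * Y d x s S ^+ 3 + 4 * d k ^+ 3 * Y d x s S) * sgn S k =
   4 * d k * Y d x s S ^+ 3 * sgn S k +
     4 * d k ^+ 3 * Y d x s S * sgn S k * (sgn S k * sgn S k).
    by rewrite sgn2; ring.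
  rewrite Ycons; move: (Y d x s S) (sgn S k) (d k) => y q u; ring.
rewrite (eq_bigr _ (fun S _ => e S)) !big_split /=.
rewrite (hz (fun y => 4 * d k * y ^+ 3 + 4 * d k ^+ 3 * y)) addr0.
rewrite -mulr_suml cT -mulr_sumr IH2.
have P0 : (0 : R) <= 2 ^+ #|T| by rewrite exprn_ge0.
set P := (2 ^+ #|T| : R) in IH4 P0 *.
have d4 : 0 <= P * d k ^+ 4 by rewrite mulr_ge0 // exprn_even_ge0.
apply: le_trans (_ : P * (x ^+ 4 + 6 * x ^+ 2 * s2 + 3 * s2 ^+ 2) +
   6 * d k ^+ 2 * (P * (x ^+ 2 + s2)) + 3 * (P * d k ^+ 4) <= _).
  by apply: lerD; [rewrite lerD2r|lra].
by rewrite le_eqVlt; apply/orP; left; apply/eqP; ring.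
Qed.

(** The Paley-Zygmund inequality for random signs, from their second and fourth
    moments. *)
Lemma card_paley_zygmund g0 g1 z tau : let s2 := \sum_j (g1 j - g0 j) ^+ 2 in
  0 < s2 -> 0 <= tau <= s2 / 16 ->
  #|[set S | (select_sum g0 g1 S - z) ^+ 2 <= tau]|%:R <= 5 / 6 * 2 ^+ #|T| :> R.
Proof.
move=> s2 s20 /andP[tau0 htau].
pose d j := (g1 j - g0 j) / 2; pose x := \sum_j (g1 j + g0 j) / 2 - z.
have YE S : select_sum g0 g1 S - z = Y d x (enum T) S.
  rewrite /Y /x /select_sum big_enum /= addrAC -big_split /=; congr (_ - _).
  by apply: eq_bigr => j _; rewrite /sgn /d; case: ifP => _; field.
have [m2 m4] := moments d x (enum_uniq T).
move: m2 m4; rewrite big_enum /=; set sg := \sum_j d j ^+ 2.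
have sgE : sg = s2 / 4.
  by rewrite /sg mulr_suml; apply: eq_bigr => j _; rewrite /d; field.
set P := (2 ^+ #|T| : R) => m2 m4.
set A := [set S | _]; pose M : R := #|~: A|%:R.
have cP : #|A|%:R + M = P.
  by rewrite /M /P -natrD cardsC -[RHS]mulr1 -sum_cst_sets sumr_const.
have P0 : 0 < P by rewrite exprn_gt0.
set v := x ^+ 2 + sg in m2 *.
have v0 : 0 < v by rewrite /v ltr_wpDl ?sqr_ge0 // sgE divr_gt0.
have m4' : \sum_S Y d x (enum T) S ^+ 4 <= P * (3 * v ^+ 2).
  apply: le_trans m4 _; rewrite ler_pM2l // /v.
  have : 0 <= x ^+ 4 by rewrite exprn_even_ge0.
  have -> : 3 * (x ^+ 2 + sg) ^+ 2 = 3 * x ^+ 4 + 6 * x ^+ 2 * sg + 3 * sg ^+ 2 by ring.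
  lra.
(* On the complement of [A] the bound is the arithmetic-geometric inequality
   [y ^ 2 <= y ^ 4 / (6 v) + 3 v / 2]. *)
have key : P * v <= P * tau + (\sum_S Y d x (enum T) S ^+ 4) / (6 * v) + 3 / 2 * v * M.
  rewrite -m2.
  have -> : P * tau = \sum_(S : {set T}) tau.
    by rewrite sum_cst_sets.
  have -> : M = \sum_S (S \notin A)%:R.
    by rewrite /M -sum1_card natr_sum big_mkcond /=; apply: eq_bigr => S _; rewrite inE; case: (S \in A).
  rewrite mulr_suml mulr_sumr -!big_split /=; apply: ler_sum => S _.
  set y := Y _ _ _ S; have y4 : 0 <= y ^+ 4 by rewrite exprn_even_ge0.
  rewrite inE YE -/y; case: (boolP (y ^+ 2 <= tau)) => hy /=.
    by rewrite mulr0 addr0 (le_trans hy) // lerDl divr_ge0 // mulr_ge0 // ltW.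
  rewrite mulr1; apply: (@le_trans _ _ (y ^+ 4 / (6 * v) + 3 / 2 * v)); last first.
    by rewrite -addrA lerDr.
  have -> : y ^+ 4 / (6 * v) + 3 / 2 * v = y ^+ 2 + (y ^+ 2 - 3 * v) ^+ 2 / (6 * v).
    by field; rewrite gt_eqF.
  by rewrite lerDl divr_ge0 ?sqr_ge0 // mulr_ge0 // ltW.
have h6 : (\sum_S Y d x (enum T) S ^+ 4) / (6 * v) <= P * v / 2.
  rewrite ler_pdivrMr ?mulr_gt0 //; apply: le_trans m4' _.
  by rewrite le_eqVlt; apply/orP; left; apply/eqP; field.
have h7 : P * tau <= P * v / 4.
  rewrite -mulrA ler_pM2l //; apply: le_trans htau _.
  by rewrite /v sgE; have := sqr_ge0 x; lra.
have : P * v <= 6 * M * v by lra.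
by rewrite ler_pM2r //; lra.
Qed.

End Rademacher.

(** * Anticoncentration of weighted sums of independent atoms *)

Lemma expr_le_inv (R : realType) (q : R) h : 0 <= q <= 1 ->
  q ^+ h * (1 + h%:R * (1 - q)) <= 1.
Proof.
move=> /andP[q0 q1]; elim: h => [|h IH]; first by rewrite expr0 !mul1r mul0r addr0.
apply: le_trans IH; rewrite exprSr -mulrA; apply: ler_wpM2l; first exact: exprn_ge0.
rewrite -natr1; have : 0 <= h%:R * (1 - q) ^+ 2 by rewrite mulr_ge0 ?sqr_ge0.
have : 0 <= (1 - q) ^+ 2 by rewrite sqr_ge0.
by move: (h%:R : R) => x; nra.
Qed.

Lemma exists_expr_le (R : realType) (q e : R) : 0 <= q < 1 -> 0 < e ->
  exists h : nat, (0 < h)%N /\ q ^+ h <= e.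
Proof.
move=> /andP[q0 q1] e0; pose x := (e * (1 - q))^-1.
have x0 : 0 <= x by rewrite invr_ge0 mulr_ge0 ?subr_ge0 // ltW.
exists (Num.truncn x).+1; split => //.
have hx : x < (Num.truncn x).+1%:R by exact: truncnS_gt.
move: (Num.truncn x).+1 hx => h hx.
have := @expr_le_inv R q h; rewrite q0 ltW // => /(_ isT) hh.
have q1' : 0 < 1 - q by rewrite subr_gt0.
have h1 : 1 <= e * (h%:R * (1 - q)).
  rewrite mulrCA -ler_pdivrMr ?mulr_gt0 // mul1r; exact: ltW.
have p0 : 0 <= q ^+ h by exact: exprn_ge0.
by move: p0 hh h1; move: (q ^+ h) (h%:R * (1 - q)) => a b; nra.
Qed.

Section Atoms.
Variable R : realType.

(** Levy's concentration function at radius [r] is at most [1 - p0]. *)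
Definition nondegenerate (V : finType) (p : V -> R) (c : V -> R[i]) (r p0 : R) :=
  forall z, p0 <= fpr p (fun v => r <= nc (c v - z)).

Section Symmetrization.
Import boot.fintype boot.finset.
Variables (I V : finType) (p : V -> R).
Hypothesis wp : is_prob p.

(** Averaging the resampling identity over all [S] turns the law of [f] into
    that of a uniformly random choice, at each coordinate, between two
    independent copies; no probability is lost. *)
Lemma fpr_symmetrize (E : {ffun I -> V} -> Prop) :
  fpr (prodw p) E =
  fex (prodw p) (fun f => fex (prodw p) (fun g =>
    #|[set S | `[< E (mix S f g) >]]|%:R / 2 ^+ #|I|)).
Proof.
have P0 : (2 ^+ #|I| : R) != 0 by rewrite expf_neq0.
apply: (mulfI P0); rewrite -sum_cst_sets.
rewrite (eq_bigr _ (fun S _ => esym (fex_resample wp S _))) -!fex_sum.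
rewrite -fexZ; apply: eq_bigr => f _; congr (_ * _).
rewrite -fex_sum -fexZ; apply: eq_bigr => g _; congr (_ * _).
rewrite mulrCA divff // mulr1 -sum1_card natr_sum [RHS]big_mkcond /=.
by apply: eq_bigr => S _; rewrite inE /ind; case: asbool.
Qed.

Lemma sum_mix (b : I -> R[i]) (c : V -> R[i]) S f g :
  (complex.Re (\sum_j b j * c (mix S f g j)) =
   select_sum (fun j => complex.Re (b j * c (g j))) (fun j => complex.Re (b j * c (f j))) S) *
  (complex.Im (\sum_j b j * c (mix S f g j)) =
   select_sum (fun j => complex.Im (b j * c (g j))) (fun j => complex.Im (b j * c (f j))) S).
Proof.
by rewrite Re_sum Im_sum; split; apply: eq_bigr => j _; rewrite ffunE; case: ifP.
Qed.

(** Chernoff's bound makes it exponentially unlikely in [#|J|] that fewer than a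
    proportion [1 / h] of the coordinates are at distance [r] from the prescribed
    points; this is weakened to [h / #|J|]. *)
Lemma fpr_few_far (c : V -> R[i]) (J : {set I}) r p0 h (z : I -> R[i]) :
  nondegenerate p c r p0 -> 0 <= p0 <= 1 -> (0 < h)%N -> (1 - p0 / 2) ^+ h <= 1 / 4 ->
  fpr (prodw p) (fun f => (#|[set j in J | (r <= nc (c (f j) - z j))%R]| <= #|J| %/ h)%N)
  * #|J|%:R <= h%:R.
Proof.
move=> nd /andP[p00 p01] h0 hh; set k := #|J|; set e := (k %/ h)%N.
pose bad j v := ~ (r <= nc (c v - z j)).
have ek : (e <= k)%N by exact: leq_div.
have := @fpr_chernoff R I V p wp bad J (1 - p0) 2 (k - e).
have -> : (1 : R) <= 2 by rewrite ler1n.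
move=> /(_ isT).
have hq i : i \in J -> fpr p (bad i) <= 1 - p0.
  by move=> _; rewrite fprC // lerD2l lerN2; exact: nd.
move=> /(_ hq) hc.
set PP := fpr _ _; have PP0 : 0 <= PP by exact/fpr_ge0/prodw_prob.
have hPP : PP * 2 ^+ (k - e) <= (2 - p0) ^+ k.
  have e1 : 1 + (2 - 1) * (1 - p0) = 2 - p0 by ring.
  rewrite e1 in hc; apply: le_trans hc; apply: ler_wpM2r; first exact: exprn_ge0.
  apply: le_fpr; first exact: prodw_prob.
  move=> f; rewrite -/k => hf.
  have : (#|[set j in J | `[< bad j (f j) >]]| + #|[set j in J | (r <= nc (c (f j) - z j))%R]| = k)%N.
    rewrite /k -[in RHS](cardsID [set j | (r <= nc (c (f j) - z j))%R] J) addnC.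
    congr (_ + _)%N; apply: eq_card => j; rewrite !inE // andbC; congr (_ && _).
    rewrite /bad; case: (boolP (r <= nc (c (f j) - z j))) => hb /=.
      by apply/asboolPn; apply.
    by apply/asboolP.
  by move: hf; rewrite -/e; lia.
have q0 : 0 <= 1 - p0 / 2 <= 1 by lra.
have h2 : PP * 2 ^+ k <= 2 ^+ k * ((1 - p0 / 2) ^+ k * 2 ^+ e).
  have -> : 2 ^+ k * ((1 - p0 / 2) ^+ k * 2 ^+ e) = (2 - p0) ^+ k * 2 ^+ e.
    by rewrite mulrA -exprMn; congr (_ ^+ _ * _); field.
  by rewrite -{1}(subnK ek) exprD mulrA ler_wpM2r // exprn_ge0.
have P2 : (0 : R) < 2 ^+ k by rewrite exprn_gt0.
rewrite mulrC ler_pM2l // in h2.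
have h3 : (1 - p0 / 2) ^+ k <= (1 / 4) ^+ e.
  apply: (@le_trans _ _ ((1 - p0 / 2) ^+ (h * e))).
    case/andP: q0 => q0 q1; apply: ler_wiXn2l => //.
    by rewrite mulnC leq_divM.
  by rewrite exprM; apply: lerXn2r; rewrite ?nnegrE ?exprn_ge0 //; lra.
have h4 : PP * 2 ^+ e <= 1.
  apply: le_trans (_ : (1 / 4) ^+ e * 2 ^+ e * 2 ^+ e <= _).
    apply: ler_wpM2r; first exact: exprn_ge0.
    by apply: le_trans h2 _; rewrite ler_wpM2r ?exprn_ge0.
  by rewrite -!exprMn; apply: exprn_ile1; lra.
have h5 : (e.+1%:R : R) <= 2 ^+ e by rewrite -natrX ler_nat; exact: ltn_expl.
have h6 : (k%:R : R) <= e.+1%:R * h%:R.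
  by rewrite -natrM ler_nat ltnW // -ltn_divLR.
apply: le_trans (_ : PP * (e.+1%:R * h%:R) <= _); first exact: ler_wpM2l.
rewrite mulrA; apply: le_trans (_ : 1 * h%:R <= _); last by rewrite mul1r.
apply: ler_wpM2r => //; apply: le_trans h4; exact: ler_wpM2l.
Qed.

End Symmetrization.
End Atoms.

Section SmallBall.
Import boot.fintype boot.finset.
Variable R : realType.

Lemma Re_dist_pair (b x y : R[i]) :
  nc b * nc (x - y) <= `|complex.Re (b * x) - complex.Re (b * y)| +
                       `|complex.Im (b * x) - complex.Im (b * y)|.
Proof. by rewrite -ncM mulrBr -ReB -ImB; exact: nc_le_ReIm. Qed.

Definition small_ball_bound (V : finType) (p : V -> R) (c : V -> R[i]) (C : R) :=
  forall (I : finType) (b : I -> R[i]) (J : {set I}) s z t, 0 < s -> 0 <= t ->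
    (forall j, j \in J -> s <= nc (b j)) ->
  fpr (prodw p) (fun f => nc (\sum_j b j * c (f j) - z) <= t) * Num.sqrt #|J|%:R
  <= C * (t / s + 1).

(** A Littlewood-Offord bound with the optimal rate. After symmetrization the
    sum is a sum of random signs, and for a fixed proportion of the coordinates
    in [J] the two choices differ, in their real or in their imaginary part, by
    a multiple of [s]. *)
Lemma small_ball (r p0 : R) : 0 < r -> 0 < p0 <= 1 ->
  exists2 C, 0 < C & forall (V : finType) (p : V -> R) (c : V -> R[i]),
    is_prob p -> nondegenerate p c r p0 -> small_ball_bound p c C.
Proof.
move=> r0 /andP[p00 p01].
have [h [h0 hh]] : exists h : nat, (0 < h)%N /\ (1 - p0 / 2) ^+ h <= 1 / 4.
  by apply: exists_expr_le; lra.
pose H : R := Num.sqrt (2 * h%:R).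
have H0 : 0 <= H by exact: sqrtr_ge0.
have hR0 : (0 : R) < h%:R by rewrite ltr0n.
exists ((4 / r + 1) * H + h%:R).
  by rewrite ltr_wpDl // mulr_ge0 // addr_ge0 // divr_ge0 // ltW.
move=> V p c wp nd I b J s z t s0 t0 hb; set k := #|J|.
have wP := prodw_prob I wp.
have k0 : 0 <= Num.sqrt (k%:R : R) by exact: sqrtr_ge0.
have ts0 : 0 <= t / s by rewrite divr_ge0 // ltW.
set E := fun f => _; have [->|kpos] := posnP k.
  rewrite sqrtr0 mulr0 mulr_ge0 // ?addr_ge0 //.
  by rewrite mulr_ge0 // addr_ge0 // divr_ge0 // ltW.
have sk0 : 0 < Num.sqrt (k%:R : R) by rewrite sqrtr_gt0 ltr0n.
pose D := (4 * t / (s * r) + 1) * H / Num.sqrt k%:R.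
have sr0 : 0 < s * r / 2 by rewrite divr_gt0 // mulr_gt0.
have tsr0 : 0 <= 4 * t / (s * r) by rewrite divr_ge0 ?mulr_ge0 // ltW.
have D0 : 0 <= D by rewrite divr_ge0 // mulr_ge0 // addr_ge0.
pose Z (f g : {ffun I -> V}) := [set j in J | (r <= nc (c (g j) - c (f j)))%R].
have P0 : (0 : R) < 2 ^+ #|I| by rewrite exprn_gt0.
have cnt (f g : {ffun I -> V}) : #|[set S | `[< E (mix S f g) >]]|%:R / 2 ^+ #|I| <=
    ind R (#|Z f g| <= k %/ h)%N + D.
  rewrite ler_pdivrMr //.
  case: (pselect (is_true (#|Z f g| <= k %/ h)%N)) => [hz|/negP hz].
    rewrite indT // mulrDl mul1r; apply: le_trans (_ : 2 ^+ #|I| <= _).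
      by rewrite -[leRHS]mulr1 -sum_cst_sets sumr_const ler_nat max_card.
    by rewrite lerDl mulr_ge0 // ltW.
  rewrite indF ?add0r; last exact/negP.
  rewrite -ltnNge in hz.
  pose JR := [set j in J | (s * r / 2 <= `|complex.Re (b j * c (f j)) - complex.Re (b j * c (g j))|)%R].
  pose JI := [set j in J | (s * r / 2 <= `|complex.Im (b j * c (f j)) - complex.Im (b j * c (g j))|)%R].
  have ZU : Z f g \subset JR :|: JI.
    apply/subsetP => j; rewrite !inE => /andP[jJ hj]; rewrite jJ /=.
    have := Re_dist_pair (b j) (c (f j)) (c (g j)); rewrite nc_distC in hj.
    have : s * r <= nc (b j) * nc (c (f j) - c (g j)).
      by apply: ler_pM => //; [exact: ltW|exact: ltW|exact: hb].
    case: (leP (s * r / 2) `|complex.Re (b j * c (f j)) - complex.Re (b j * c (g j))|) => //= h1 h2 h3.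
    lra.
  have cZ : (#|Z f g| <= #|JR| + #|JI|)%N.
    exact: leq_trans (subset_leq_card ZU) (leq_card_setU _ _).
  have kh : (k < (k %/ h).+1 * h)%N by rewrite -ltn_divLR.
  have half (K : {set I}) : (#|Z f g| <= 2 * #|K|)%N ->
      Num.sqrt (k%:R : R) <= H * Num.sqrt #|K|%:R.
    move=> hK; rewrite -sqrtrM ?mulr_ge0 // ler_sqrt ?mulr_ge0 // -!natrM ler_nat.
    apply: leq_trans (ltnW kh) _; rewrite mulnAC.
    exact: leq_mul (leq_trans hz hK) (leqnn h).
  have fin (K : {set I}) (cS : R) : Num.sqrt (k%:R : R) <= H * Num.sqrt #|K|%:R -> 0 <= cS ->
      cS * Num.sqrt #|K|%:R <= (2 * t / (s * r / 2) + 1) * 2 ^+ #|I| -> cS <= D * 2 ^+ #|I|.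
    move=> h1 cS0 h2; rewrite /D mulrAC ler_pdivlMr //.
    have e1 : 2 * t / (s * r / 2) = 4 * t / (s * r).
      by field; rewrite !gt_eqF.
    rewrite e1 in h2.
    apply: le_trans (_ : cS * (H * Num.sqrt #|K|%:R) <= _); first exact: ler_wpM2l.
    by rewrite mulrCA [leRHS]mulrAC [leRHS]mulrC; apply: ler_wpM2l.
  have [hl|hl] := leqP #|JI| #|JR|.
    apply: (fin JR) => //.
      by apply/half/(leq_trans cZ); rewrite mul2n -addnn leq_add2l.
    apply: le_trans (@card_interval R I (fun j => complex.Re (b j * c (g j)))
      (fun j => complex.Re (b j * c (f j))) JR (s * r / 2) (complex.Re z) t _ sr0 t0).
      apply: ler_wpM2r; first exact: sqrtr_ge0.
      rewrite ler_nat; apply/subset_leq_card/subsetP => S; rewrite !inE => /asboolP hE.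
      rewrite -(sum_mix b c S f g).1 -ReB; exact: le_trans (normRe_le _) hE.
    by move=> j; rewrite inE => /andP[].
  apply: (fin JI) => //.
    by apply/half/(leq_trans cZ); rewrite mul2n -addnn leq_add2r ltnW.
  apply: le_trans (@card_interval R I (fun j => complex.Im (b j * c (g j)))
    (fun j => complex.Im (b j * c (f j))) JI (s * r / 2) (complex.Im z) t _ sr0 t0).
    apply: ler_wpM2r; first exact: sqrtr_ge0.
    rewrite ler_nat; apply/subset_leq_card/subsetP => S; rewrite !inE => /asboolP hE.
    rewrite -(sum_mix b c S f g).2 -ImB; exact: le_trans (normIm_le _) hE.
  by move=> j; rewrite inE => /andP[].
have kR : (0 : R) < k%:R by rewrite ltr0n.
have fE : fpr (prodw p) E <= h%:R / k%:R + D.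
  rewrite (fpr_symmetrize wp) -[leRHS](fex_cst wP); apply: (le_fex wP) => f.
  apply: le_trans (le_fex wP (cnt f)) _; rewrite fexD fex_cst // lerD2r.
  rewrite ler_pdivlMr //; apply: (@fpr_few_far R I V p wp c J r p0 h (fun j => c (f j))) => //.
  by rewrite (ltW p00).
apply: le_trans (ler_wpM2r k0 fE) _; rewrite mulrDl /D (divfK (lt0r_neq0 sk0)).
have : h%:R / k%:R * Num.sqrt k%:R <= h%:R :> R.
  rewrite mulrAC ler_pdivrMr //; apply: ler_wpM2l; first exact: ltW.
  have e2 := @sqr_sqrtr R k%:R (ler0n _ _).
  rewrite -[leRHS]e2 expr2 ler_peMr //.
  by rewrite -[leLHS]sqrtr1 ler_sqrt ?ler0n // ler1n.
have : (4 * t / (s * r) + 1) * H <= (4 / r + 1) * H * (t / s + 1).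
  rewrite [leRHS]mulrAC; apply: ler_wpM2r => //.
  have -> : 4 * t / (s * r) = 4 / r * (t / s) by field; rewrite !gt_eqF.
  have : 0 <= 4 / r by rewrite divr_ge0 // ltW.
  move: (4 / r) (t / s) ts0 => x y hx hy; nra.
have : 0 <= h%:R * (t / s) by rewrite mulr_ge0 // ltW.
move: (h%:R : R) (h%:R / k%:R * _) (_ * H) ((4 / r + 1) * H) (t / s) => a1 a2 a3 a4 a5.
lra.
Qed.

(** For two independent copies, the coordinates where they are far apart carry with
    positive probability a fixed proportion of [\sum_j nc (b j) ^+ 2]; the random
    signs that choose between the copies then have a large second moment, in the
    real or in the imaginary part. *)
Lemma paley_zygmund (r p0 : R) : 0 < r -> 0 < p0 <= 1 ->
  forall (I V : finType) (p : V -> R) (c : V -> R[i]),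
    is_prob p -> nondegenerate p c r p0 ->
  forall (b : I -> R[i]) z B, 0 < B -> B <= \sum_j nc (b j) ^+ 2 ->
  fpr (prodw p) (fun f => nc (\sum_j b j * c (f j) - z) ^+ 2 <= r ^+ 2 * p0 / 256 * B)
  <= 1 - p0 / 12.
Proof.
move=> r0 /andP[p00 p01] I V p c wp nd b z B B0 hB.
have wP := prodw_prob I wp.
set E := fun f => _; rewrite (fpr_symmetrize wp).
set B' := \sum_j _ in hB; have B'0 : 0 < B' by exact: lt_le_trans hB.
pose F (f g : {ffun I -> V}) :=
  \sum_j nc (b j) ^+ 2 / B' * ind R (r <= nc (c (g j) - c (f j))).
have P0 : (0 : R) < 2 ^+ #|I| by rewrite exprn_gt0.
have wj j : 0 <= nc (b j) ^+ 2 / B' by rewrite divr_ge0 ?sqr_ge0 // ltW.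
have sw : \sum_j nc (b j) ^+ 2 / B' = 1 by rewrite -mulr_suml divff // gt_eqF.
have hF f : p0 / 2 <= fpr (prodw p) (fun g => p0 / 2 <= F f g).
  apply: fpr_reverse_markov => //; first last.
  - rewrite mulrC divfK // /F fex_sum -[leLHS]mul1r -sw mulr_suml.
    apply: ler_sum => j _; rewrite fexZ; apply: ler_wpM2l => //.
    apply: le_trans (nd (c (f j))) _.
    by rewrite -(fpr_marginal wp (fun v => r <= nc (c v - c (f j))) j).
  - by lra.
  - move=> g; rewrite -sw; apply: ler_sum => j _.
    by rewrite -[leRHS]mulr1; apply: ler_wpM2l => //; exact: ind_le1.
suff cnt f g : #|[set S | `[< E (mix S f g) >]]|%:R / 2 ^+ #|I| <=
    1 - 1 / 6 * ind R (p0 / 2 <= F f g).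
  rewrite -[leRHS](fex_cst wP); apply: (le_fex wP) => f.
  apply: le_trans (le_fex wP (cnt f)) _.
  under [X in X <= _]eq_bigr => g _ do rewrite -mulNr.
  by rewrite -/(fex _ _) fexD fex_cst // fexZ; have := hF f; rewrite /fpr; lra.
rewrite ler_pdivrMr //.
case: (pselect (p0 / 2 <= F f g)) => hFf; last first.
  rewrite indF // mulr0 subr0 mul1r -[leRHS]mulr1 -sum_cst_sets sumr_const ler_nat.
  exact: max_card.
rewrite indT //.
pose d j := nc (b j) * nc (c (f j) - c (g j)).
have hD : r ^+ 2 * p0 / 2 * B <= \sum_j d j ^+ 2.
  apply: le_trans (_ : r ^+ 2 * B' * F f g <= _).
    have -> : r ^+ 2 * p0 / 2 * B = r ^+ 2 * B * (p0 / 2) by ring.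
    apply: ler_pM => //.
    - by rewrite mulr_ge0 ?sqr_ge0 // ltW.
    - by rewrite divr_ge0 // ltW.
    - by rewrite ler_wpM2l ?sqr_ge0.
  rewrite /F mulr_sumr; apply: ler_sum => j _; rewrite /d exprMn (nc_distC (c (f j))).
  case: (pselect (r <= nc (c (g j) - c (f j)))) => hr; last first.
    by rewrite indF // !mulr0 mulr_ge0 ?sqr_ge0.
  rewrite indT //.
  have -> : r ^+ 2 * B' * (nc (b j) ^+ 2 / B' * 1) = nc (b j) ^+ 2 * r ^+ 2.
    by field; rewrite gt_eqF.
  by rewrite ler_wpM2l ?sqr_ge0 // lerXn2r ?nnegrE ?nc_ge0 // ltW.
set DD := \sum_j _ in hD.
pose gR := fun (g : {ffun I -> V}) j => complex.Re (b j * c (g j)).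
pose gI := fun (g : {ffun I -> V}) j => complex.Im (b j * c (g j)).
have eD : DD = \sum_j (gR f j - gR g j) ^+ 2 + \sum_j (gI f j - gI g j) ^+ 2.
  rewrite -big_split; apply: eq_bigr => j _.
  by rewrite /d -ncM sqr_nc mulrBr ReB ImB.
pose tau := r ^+ 2 * p0 / 256 * B.
have tauE : r ^+ 2 * p0 / 2 * B = 128 * tau by rewrite /tau; field.
have tau0 : 0 < tau by rewrite !mulr_gt0 ?exprn_gt0 ?invr_gt0 ?ltr0n.
have fin (h : {ffun I -> V} -> I -> R) (zz : R) : DD / 2 <= \sum_j (h f j - h g j) ^+ 2 ->
  (forall S, E (mix S f g) -> (select_sum (h g) (h f) S - zz) ^+ 2 <= tau) ->
  #|[set S | `[< E (mix S f g) >]]|%:R <= (1 - 1 / 6 * 1) * 2 ^+ #|I| :> R.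
  move=> h1 h2; have -> : (1 - 1 / 6 * 1 = 5 / 6 :> R) by field.
  apply: le_trans (@card_paley_zygmund R I (h g) (h f) zz tau _ _); last 2 first.
  - by lra.
  - by rewrite (ltW tau0) /=; lra.
  rewrite ler_nat; apply/subset_leq_card/subsetP => S; rewrite !inE => /asboolP.
  exact: h2.
have sq (u : R[i]) : nc u ^+ 2 <= tau ->
    (complex.Re u ^+ 2 <= tau) * (complex.Im u ^+ 2 <= tau).
  rewrite sqr_nc; have := sqr_ge0 (complex.Re u); have := sqr_ge0 (complex.Im u).
  by move=> *; split; lra.
case: (leP (DD / 2) (\sum_j (gR f j - gR g j) ^+ 2)) => hh.
  apply: (fin gR (complex.Re z)) => // S hE; rewrite /gR -(sum_mix b c S f g).1 -ReB.
  exact: (sq _ hE).1.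
apply: (fin gI (complex.Im z)) => [|S hE]; first by lra.
by rewrite /gI -(sum_mix b c S f g).2 -ImB; exact: (sq _ hE).2.
Qed.

End SmallBall.

(** * Vectors, coordinate restrictions and norms *)

Section Vectors.
Import boot.fintype boot.finset.
Variable R : realType.
Local Notation C := R[i].

Lemma cauchy_schwarz (I : finType) (a b : I -> R) :
  \sum_i a i * b i <= Num.sqrt (\sum_i a i ^+ 2) * Num.sqrt (\sum_i b i ^+ 2).
Proof.
set A := \sum_i a i ^+ 2; set B := \sum_i b i ^+ 2.
have A0 : 0 <= A by apply: sumr_ge0 => i _; exact: sqr_ge0.
have B0 : 0 <= B by apply: sumr_ge0 => i _; exact: sqr_ge0.
have zero (u v : I -> R) : \sum_i u i ^+ 2 = 0 -> \sum_i u i * v i = 0.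
  move=> h; apply: big1 => i _; have /eqP := h.
  rewrite psumr_eq0 => [/allP /(_ i)|j _]; last exact: sqr_ge0.
  by rewrite mem_index_enum sqrf_eq0 => /(_ isT) /eqP ->; rewrite mul0r.
have [eA|nA] := eqVneq A 0; first by rewrite zero // mulr_ge0 ?sqrtr_ge0.
have [eB|nB] := eqVneq B 0.
  by under eq_bigr => i _ do rewrite mulrC; rewrite zero // mulr_ge0 ?sqrtr_ge0.
have sA : 0 < Num.sqrt A by rewrite sqrtr_gt0 lt0r nA.
have sB : 0 < Num.sqrt B by rewrite sqrtr_gt0 lt0r nB.
set x := Num.sqrt A in sA *; set y := Num.sqrt B in sB *.
have xA : x ^+ 2 = A by rewrite sqr_sqrtr.
have yB : y ^+ 2 = B by rewrite sqr_sqrtr.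
rewrite -[leRHS]mul1r -ler_pdivrMr ?mulr_gt0 // mulr_suml.
apply: le_trans (_ : \sum_i ((a i ^+ 2 / A + b i ^+ 2 / B) / 2) <= _).
  apply: ler_sum => i _; rewrite -xA -yB -subr_ge0.
  have -> : (a i ^+ 2 / x ^+ 2 + b i ^+ 2 / y ^+ 2) / 2 - a i * b i / (x * y)
     = (a i / x - b i / y) ^+ 2 / 2 by field; rewrite !gt_eqF.
  by rewrite divr_ge0 ?sqr_ge0.
rewrite -mulr_suml big_split /= -!mulr_suml !divff //; lra.
Qed.

Variable n : nat.
Implicit Types x y : 'cV[C]_n.

Definition nrm2 x : R := \sum_i nc (x i 0) ^+ 2.

Lemma nrm2_ge0 x : 0 <= nrm2 x.
Proof. by apply: sumr_ge0 => i _; exact: sqr_ge0. Qed.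

Lemma sqr_l2norm x : l2norm x ^+ 2 = nrm2 x.
Proof. by rewrite sqr_sqrtr // nrm2_ge0. Qed.

Lemma l2norm_ge0 x : 0 <= l2norm x.
Proof. exact: sqrtr_ge0. Qed.

Lemma le_l2norm x a : 0 <= a -> (l2norm x <= a) = (nrm2 x <= a ^+ 2).
Proof.
by move=> a0; rewrite -sqr_l2norm ler_pXn2r // nnegrE // l2norm_ge0.
Qed.

Lemma nc_le_l2norm x i : nc (x i 0) <= l2norm x.
Proof.
rewrite -(ler_pXn2r (n := 2)) ?nnegrE ?nc_ge0 ?l2norm_ge0 // sqr_l2norm.
by rewrite /nrm2 (bigD1 i) //= lerDl sumr_ge0 // => j _; rewrite sqr_ge0.
Qed.

Lemma l2norm0 : l2norm (0 : 'cV[C]_n) = 0.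
Proof.
by rewrite /l2norm big1 ?sqrtr0 // => i _; rewrite mxE nc0 expr0n.
Qed.

Lemma l2norm_eq0 x : (l2norm x == 0) = (x == 0).
Proof.
apply/eqP/eqP => [h|->]; last exact: l2norm0.
apply/colP => i; rewrite mxE; apply/eqP; rewrite -nc_eq0.
by apply/eqP/le_anti; rewrite nc_ge0 -h nc_le_l2norm.
Qed.

Lemma l2norm_gt0 x : (0 < l2norm x) = (x != 0).
Proof. by rewrite lt0r l2norm_eq0 l2norm_ge0 andbT. Qed.

Lemma nrm2Z a x : nrm2 (a *: x) = nc a ^+ 2 * nrm2 x.
Proof.
by rewrite /nrm2 mulr_sumr; apply: eq_bigr => i _; rewrite mxE ncM exprMn.
Qed.

Lemma l2normZ a x : l2norm (a *: x) = nc a * l2norm x.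
Proof.
rewrite /l2norm -/(nrm2 _) -/(nrm2 _) nrm2Z sqrtrM ?sqr_ge0 //.
by rewrite sqrtr_sqr ger0_norm // nc_ge0.
Qed.

Lemma nc_inv_l2norm x : nc (((l2norm x)^-1)%:C)%C = (l2norm x)^-1.
Proof. by rewrite nc_real ger0_norm // invr_ge0 l2norm_ge0. Qed.

Lemma l2normN x : l2norm (- x) = l2norm x.
Proof. by rewrite /l2norm; congr Num.sqrt; apply: eq_bigr => i _; rewrite mxE ncN. Qed.

Lemma l2normD x y : l2norm (x + y) <= l2norm x + l2norm y.
Proof.
rewrite le_l2norm ?addr_ge0 ?l2norm_ge0 // sqrrD !sqr_l2norm.
apply: le_trans (_ : \sum_i (nc (x i 0) + nc (y i 0)) ^+ 2 <= _).
  by apply: ler_sum => i _; rewrite mxE lerXn2r ?nnegrE ?addr_ge0 ?nc_ge0 // ncD.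
under eq_bigr => i _ do rewrite sqrrD.
rewrite !big_split /= lerD2r lerD2l mulr2n.
by apply: lerD; exact: cauchy_schwarz.
Qed.

Lemma l2normB x y : l2norm (x - y) <= l2norm x + l2norm y.
Proof. by rewrite -(l2normN y) l2normD. Qed.

Lemma nc_dot_le x y : nc (\sum_i x i 0 * y i 0) <= l2norm x * l2norm y.
Proof.
apply: le_trans (cauchy_schwarz (fun i => nc (x i 0)) (fun i => nc (y i 0))).
elim/big_ind2 : _ => [|u1 v1 u2 v2 h1 h2|i _]; rewrite ?nc0 ?ncM //.
by apply: le_trans (ncD _ _) _; exact: lerD.
Qed.

Definition mask (S : {set 'I_n}) x : 'cV[C]_n := \col_i (if i \in S then x i 0 else 0).

Lemma maskE S x i : mask S x i 0 = if i \in S then x i 0 else 0.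
Proof. by rewrite mxE. Qed.

Lemma maskD S x y : mask S (x + y) = mask S x + mask S y.
Proof. by apply/colP => i; rewrite !mxE; case: ifP => // _; rewrite addr0. Qed.

Lemma maskN S x : mask S (- x) = - mask S x.
Proof. by apply/colP => i; rewrite !mxE; case: ifP => // _; rewrite oppr0. Qed.

Lemma maskB S x y : mask S (x - y) = mask S x - mask S y.
Proof. by rewrite maskD maskN. Qed.

Lemma maskZ S a x : mask S (a *: x) = a *: mask S x.
Proof. by apply/colP => i; rewrite !mxE; case: ifP => // _; rewrite mulr0. Qed.

Lemma mask_id (S : {set 'I_n}) x : (forall i, i \notin S -> x i 0 = 0) -> mask S x = x.
Proof. by move=> h; apply/colP => i; rewrite mxE; case: ifPn => // /h. Qed.

Lemma nrm2_mask (S : {set 'I_n}) x : nrm2 (mask S x) = \sum_(i in S) nc (x i 0) ^+ 2.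
Proof.
rewrite [RHS]big_mkcond; apply: eq_bigr => i _; rewrite maskE.
by case: ifP => // _; rewrite nc0 expr0n.
Qed.

Lemma l2norm_mask_le (S : {set 'I_n}) x : l2norm (mask S x) <= l2norm x.
Proof.
rewrite le_l2norm ?l2norm_ge0 // sqr_l2norm nrm2_mask [leLHS]big_mkcond.
by apply: ler_sum => i _; case: ifP => // _; exact: sqr_ge0.
Qed.

Lemma l2norm_mask_sub (S S' : {set 'I_n}) x :
  S \subset S' -> l2norm (mask S x) <= l2norm (mask S' x).
Proof.
move=> sub; suff -> : mask S x = mask S (mask S' x) by exact: l2norm_mask_le.
by apply/colP => i; rewrite !maskE; case: ifP => // iS; rewrite (subsetP sub).
Qed.

Definition supp x := [set i | x i 0 != 0].

Lemma suppPn x i : i \notin supp x -> x i 0 = 0.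
Proof. by rewrite inE negbK => /eqP. Qed.

Lemma supp_mask (S : {set 'I_n}) x : supp (mask S x) \subset S.
Proof. by apply/subsetP => i; rewrite inE maskE; case: ifP => //; rewrite eqxx. Qed.

Definition opbound (M : 'M[C]_n) (b : R) := forall x, l2norm (M *m x) <= b * l2norm x.

Definition spread_set (rho : R) x := [set j | rho / Num.sqrt n%:R <= nc (x j 0)].

(** If [M] is bounded below by [c sqrt n] on the vectors with at most [k]
    nonzero coordinates, then an approximate null vector has more than [k]
    coordinates of order [1 / sqrt n]: otherwise the restriction to these
    coordinates would be an approximate null vector too. *)
Lemma spread_of_lower_bound (M : 'M[C]_n) (Q : {set 'I_n}) x k K c rho eps :
  (0 < n)%N -> opbound M (K * Num.sqrt n%:R) -> 0 <= K -> 0 <= rho < 1 ->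
  (forall y, (#|supp y| <= k)%N -> y != 0 ->
     c * Num.sqrt n%:R * l2norm y < l2norm (mask Q (M *m y))) ->
  l2norm x = 1 -> l2norm (mask Q (M *m x)) <= eps * Num.sqrt n%:R ->
  0 < c -> eps + K * rho <= c * (1 - rho) ->
  (k < #|spread_set rho x|)%N.
Proof.
move=> n0 MK K0 /andP[rho0 rho1] lb x1 hx c0 heps.
have sn : 0 < Num.sqrt (n%:R : R) by rewrite sqrtr_gt0 ltr0n.
rewrite ltnNge; apply/negP => hk; set S := spread_set rho x in hk.
pose y := mask S x; pose u := x - y.
have u_le : l2norm u <= rho.
  rewrite le_l2norm // /nrm2; apply: le_trans (_ : \sum_(i < n) rho ^+ 2 / n%:R <= _).
    apply: ler_sum => i _; rewrite /u mxE mxE maskE inE.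
    case: (leP (rho / Num.sqrt n%:R) (nc (x i 0))) => h.
      by rewrite subrr nc0 expr0n /= divr_ge0 ?sqr_ge0.
    rewrite subr0; apply: le_trans (_ : (rho / Num.sqrt n%:R) ^+ 2 <= _).
      by rewrite lerXn2r ?nnegrE ?nc_ge0 ?divr_ge0 ?sqrtr_ge0 // ltW.
    by rewrite expr_div_n sqr_sqrtr.
  by rewrite sumr_const card_ord -(mulr_natr (_ / _)) divfK // pnatr_eq0 -lt0n.
have yx : y = x - u by rewrite /u opprB addrC subrK.
have y_ge : 1 - rho <= l2norm y.
  have : l2norm x <= l2norm y + l2norm u by rewrite -{1}(subrK y x) addrC l2normD.
  by rewrite x1; lra.
have y0 : y != 0 by rewrite -l2norm_gt0; lra.
have := lb y (leq_trans (subset_leq_card (supp_mask S x)) hk) y0.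
have : l2norm (mask Q (M *m y)) <= (eps + K * rho) * Num.sqrt n%:R.
  rewrite {1}yx mulmxBr maskB; apply: le_trans (l2normB _ _) _.
  rewrite mulrDl; apply: lerD => //; apply: le_trans (l2norm_mask_le _ _) _.
  apply: le_trans (MK u) _; rewrite mulrAC; apply: ler_wpM2r; first exact: ltW.
  exact: ler_wpM2l.
have : (eps + K * rho) * Num.sqrt n%:R <= c * Num.sqrt n%:R * l2norm y.
  rewrite mulrAC; apply: ler_wpM2r; first exact: ltW.
  by apply: le_trans heps _; rewrite ler_pM2l.
by move=> h1 h2 h3; have := lt_le_trans h3 (le_trans h2 h1); rewrite ltxx.
Qed.

End Vectors.

(** * Row selection with a controlled left inverse *)

Section LeftInverse.
Import boot.fintype boot.finset.
Local Open Scope sesquilinear_scope.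
Variable R : realType.
Local Notation C := R[i].
Variable n : nat.
Implicit Types (S J : {set 'I_n}) (M L N Q : 'M[C]_n).

Lemma adjM m1 m2 m3 (A : 'M[C]_(m1, m2)) (B : 'M[C]_(m2, m3)) :
  (A *m B) ^t* = B ^t* *m A ^t*.
Proof. by rewrite trmx_mul map_mxM. Qed.

Lemma adjD m1 m2 (A B : 'M[C]_(m1, m2)) : (A + B) ^t* = A ^t* + B ^t*.
Proof. by rewrite linearD map_mxD. Qed.

Lemma adjB m1 m2 (A B : 'M[C]_(m1, m2)) : (A - B) ^t* = A ^t* - B ^t*.
Proof. by rewrite linearB map_mxB. Qed.

Lemma adjZ m1 m2 (a : R) (A : 'M[C]_(m1, m2)) : ((a%:C)%C *: A) ^t* = (a%:C)%C *: A ^t*.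
Proof. by apply/matrixP => i j; rewrite !mxE rmorphM /=; congr (_ * _); rewrite /Num.conj /= oppr0. Qed.

Definition fro2 m1 m2 (A : 'M[C]_(m1, m2)) : R := \sum_i \sum_j nc (A i j) ^+ 2.

Lemma fro2_ge0 m1 m2 (A : 'M[C]_(m1, m2)) : 0 <= fro2 A.
Proof. by apply: sumr_ge0 => i _; apply: sumr_ge0 => j _; exact: sqr_ge0. Qed.

Lemma mul_conj (z : C) : z * z^* = ((nc z ^+ 2)%:C)%C.
Proof. by rewrite -normCK -nc_normr rmorphXn. Qed.

Lemma adj_mulE m1 m2 (A : 'M[C]_(m1, m2)) i :
  (A *m A ^t*) i i = ((\sum_j nc (A i j) ^+ 2)%:C)%C.
Proof.
by rewrite mxE rmorph_sum; apply: eq_bigr => j _; rewrite !mxE mul_conj.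
Qed.

Lemma tr_fro2 m1 m2 (A : 'M[C]_(m1, m2)) : \tr (A *m A ^t*) = ((fro2 A)%:C)%C.
Proof. by rewrite /mxtrace rmorph_sum; apply: eq_bigr => i _; rewrite adj_mulE. Qed.

Lemma nc_conj (z : C) : nc (z^*) = nc z.
Proof. by apply: complexI; rewrite !nc_normr norm_conjC. Qed.

Lemma adj_col_mulE m (w : 'cV[C]_m) : (w ^t* *m w) 0 0 = ((nrm2 w)%:C)%C.
Proof.
by rewrite mxE rmorph_sum; apply: eq_bigr => j _; rewrite !mxE mulrC mul_conj.
Qed.

Definition selmx S : 'M[C]_n := diag_mx (\row_i (i \in S)%:R).

Lemma mul_selmx S m (A : 'M[C]_(n, m)) i j : (selmx S *m A) i j = (i \in S)%:R * A i j.
Proof. by rewrite mul_diag_mx !mxE. Qed.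

Lemma selmx_mask S (x : 'cV[C]_n) : selmx S *m x = mask S x.
Proof.
apply/colP => i; rewrite mul_selmx mxE; case: (i \in S); first by rewrite mul1r.
by rewrite mul0r.
Qed.

Lemma selmx_idem S : selmx S *m selmx S = selmx S.
Proof. by apply/matrixP => i j; rewrite mul_selmx !mxE; case: (i \in S); rewrite ?mul1r // mul0r mul0rn. Qed.

Lemma selmx_adj S : (selmx S) ^t* = selmx S.
Proof.
rewrite /selmx tr_diag_mx map_diag_mx; congr diag_mx.
by apply/rowP => i; rewrite !mxE; case: (i \in S); rewrite ?rmorph1 ?rmorph0.
Qed.

Lemma tr_selmx S : \tr (selmx S) = #|S|%:R.
Proof.
rewrite mxtrace_diag -sum1_card natr_sum [RHS]big_mkcond /=.
by apply: eq_bigr => i _; rewrite mxE; case: (i \in S).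
Qed.

Lemma selmx_setD1 S i : i \in S -> selmx (S :\ i) = selmx S - delta_mx i i.
Proof.
move=> iS; apply/matrixP => a b; rewrite !mxE in_setD1.
have [->|ai] := eqVneq a i; rewrite /=.
  by rewrite ?eqxx iS ?eqxx /= (eq_sym b i); case: (i == b); rewrite ?mulr0n ?mulr1n ?subrr ?subr0.
by rewrite subr0.
Qed.

(** [L] is a left inverse of [N] on the coordinates in [J], reads only the rows
    in [S], and is the minimal such inverse: the idempotent [selmx S *m N *m L] is
    an orthogonal projection. *)
Definition minimal_left_inverse S J N L :=
  [/\ L *m N = selmx J, L *m selmx S = L, selmx J *m L = L &
      (selmx S *m N *m L) ^t* = selmx S *m N *m L].

(** With [Q] the projection onto the complement, within the rows in [S], of the
    range of [N], the new inverse is [L - L E Q / Q_ii], [E] being the projection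
    onto the [i]-th coordinate. The square of its norm grows by [l_i / q_i],
    where [l_i] is the squared norm of the [i]-th column of [L] and
    [q_i = Q_ii]. The [l_i] sum to the squared norm of [L] and the [q_i] to
    [#|S| - #|J|], so some row makes the ratio at most the quotient of the sums. *)
Lemma left_inverse_remove_row S J N L : N *m selmx J = N ->
  minimal_left_inverse S J N L -> (#|J| < #|S|)%N ->
  exists i L', [/\ i \in S, minimal_left_inverse (S :\ i) J N L' &
    fro2 L' * (#|S| - #|J|)%:R <= fro2 L * (#|S| - #|J|).+1%:R].
Proof.
move=> NJ [LN LS JL Ph] hJS; set P := selmx S *m N *m L in Ph.
have LP : L *m P = L by rewrite /P !mulmxA LS LN JL.
have SP : selmx S *m P = P by rewrite /P !mulmxA selmx_idem.
have PS : P *m selmx S = P by rewrite /P -!mulmxA LS.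
have PP : P *m P = P by rewrite {1}/P -mulmxA LP.
pose Q := selmx S - P.
have Qh : Q ^t* = Q by rewrite /Q adjB selmx_adj Ph.
have QQ : Q *m Q = Q by rewrite /Q mulmxBl !mulmxBr selmx_idem SP PS PP subrr subr0.
have LQ : L *m Q = 0 by rewrite /Q mulmxBr LS LP subrr.
have QN : Q *m N = 0 by rewrite /Q mulmxBl /P -!mulmxA LN NJ subrr.
have QS : Q *m selmx S = Q by rewrite /Q mulmxBl selmx_idem PS.
have SQ : selmx S *m Q = Q by rewrite /Q mulmxBr selmx_idem SP.
pose q i := \sum_j nc (Q i j) ^+ 2; pose l i := \sum_a nc (L a i) ^+ 2.
have qE i : Q i i = ((q i)%:C)%C by rewrite -{1}QQ -{2}Qh adj_mulE.
have q0 i : 0 <= q i by apply: sumr_ge0 => j _; exact: sqr_ge0.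
have l0 i : 0 <= l i by apply: sumr_ge0 => j _; exact: sqr_ge0.
have trQ : \sum_i q i = (#|S| - #|J|)%:R.
  apply: complexI; rewrite rmorph_sum /= -(eq_bigr _ (fun i _ => qE i)).
  have trP : \tr P = #|J|%:R.
    by rewrite /P mxtrace_mulC mulmxA LS LN tr_selmx.
  rewrite -/(\tr Q) /Q raddfB /= tr_selmx trP.
  by rewrite natrB ?(ltnW hJS) // rmorphB !rmorph_nat.
have suml : \sum_i l i = fro2 L by rewrite /l exchange_big.
have qS i : i \notin S -> q i = 0.
  move=> iS; rewrite /q big1 // => j _; rewrite -SQ mul_selmx (negbTE iS) mul0r nc0.
  by rewrite expr0n.
set k := (#|S| - #|J|)%N in trQ *; have k0 : (0 : R) < k%:R by rewrite ltr0n subn_gt0.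
have [i [iS qi0 hi]] : exists i, [/\ i \in S, 0 < q i & l i * k%:R <= fro2 L * q i].
  apply: contrapT => hno.
  have hlt i : 0 < q i -> fro2 L * q i < l i * k%:R.
    move=> qi; rewrite ltNge; apply/negP => hle; apply: hno; exists i; split => //.
    by apply/negPn/negP => /qS e; rewrite e ltxx in qi.
  have hle i : fro2 L * q i <= l i * k%:R.
    have [qi|qi] := ltP 0 (q i); first exact/ltW/hlt.
    have -> : q i = 0 by apply/le_anti; rewrite qi q0.
    by rewrite mulr0 mulr_ge0 // ltW.
  have [i0 qi0] : exists i, 0 < q i.
    apply: contrapT => hn; move: k0; rewrite -trQ big1 ?ltxx // => i _.
    by apply/le_anti; rewrite q0 andbT leNgt; apply/negP => h; apply: hn; exists i.
  suff : fro2 L * k%:R < fro2 L * k%:R by rewrite ltxx.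
  rewrite -{1}trQ -{2}suml mulr_sumr mulr_suml (bigD1 i0) //= [ltRHS](bigD1 i0) //=.
  by apply: ltr_leD; [exact: hlt|apply: ler_sum].
have qC : (((q i)^-1)%:C)%C * Q i i = 1 :> C.
  by rewrite qE -rmorphM /= mulVf ?gt_eqF.
have PE : P = selmx S - Q by rewrite /Q opprB addrC subrK.
have PN : selmx S *m N *m L = P by [].
clearbody P Q.
pose a := (((q i)^-1)%:C)%C; set E : 'M[C]_n := delta_mx i i.
have EE : E *m E = E by rewrite mul_delta_mx.
have EQE : a *: (E *m Q *m E) = E.
  have -> : E *m Q *m E = Q i i *: E.
    have Eu : E = (delta_mx i 0 : 'cV_n) *m (delta_mx 0 i : 'rV_n) by rewrite mul_delta_mx.
    rewrite {1}Eu -!mulmxA {1}Eu (mulmxA Q) (mulmxA (delta_mx 0 i)) (mulmxA _ Q).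
    rewrite -rowE -colE [col _ _]mx11_scalar !mxE.
    by rewrite mul_scalar_mx -scalemxAr -Eu.
  by rewrite scalerA /a qC scale1r.
have ES : E *m selmx S = E.
  apply/matrixP => u v; rewrite mul_mx_diag !mxE.
  by have [->|] := eqVneq v i; rewrite ?iS ?mulr1 // andbF mul0r.
have SE : selmx S *m E = E.
  apply/matrixP => u v; rewrite mul_selmx !mxE.
  by have [->|] := eqVneq u i; rewrite ?iS ?mul1r // mulr0.
have Eh : E ^t* = E.
  by apply/matrixP => u v; rewrite !mxE andbC; case: (_ && _); rewrite ?rmorph1 ?rmorph0.
pose L' := L - a *: (L *m E *m Q).
have L'S : L' *m selmx S = L' by rewrite /L' mulmxBl LS -scalemxAl -(mulmxA (L *m E)) QS.
have L'E : L' *m E = 0.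
  by rewrite /L' mulmxBl -scalemxAl -!mulmxA scalemxAr mulmxA EQE subrr.
exists i, L'; split => //.
- split.
  + by rewrite /L' mulmxBl LN -scalemxAl -(mulmxA (L *m E)) QN mulmx0 scaler0 subr0.
  + by rewrite selmx_setD1 // mulmxBr L'S L'E subr0.
  + by rewrite /L' mulmxBr JL -scalemxAr !mulmxA JL.
  + have -> : selmx (S :\ i) *m N *m L' = P - E + a *: (Q *m E *m Q).
      rewrite selmx_setD1 //.
      have EN : E *m N *m L = E *m P by rewrite -PN !mulmxA ES.
      have EP : E *m P = E - E *m Q by rewrite PE mulmxBr ES.
      have h1 : (selmx S - E) *m N *m L = P - (E - E *m Q).
        by rewrite !mulmxBl PN EN EP.
      have -> : (selmx S - E) *m N *m L' =
          P - (E - E *m Q) - a *: ((P - (E - E *m Q)) *m (E *m Q)).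
        by rewrite /L' mulmxBr h1 -scalemxAr -[L *m E *m Q]mulmxA [_ *m (L *m (E *m Q))]mulmxA h1.
      have -> : (P - (E - E *m Q)) *m (E *m Q) = E *m Q *m E *m Q - Q *m E *m Q.
        rewrite mulmxA.
        have -> : (P - (E - E *m Q)) *m E = E *m Q *m E - Q *m E.
          by rewrite PE !mulmxBl SE EE opprB addrC addrA subrK.
        exact: mulmxBl.
      rewrite scalerBr (scalemxAl a (E *m Q *m E)) EQE.
      by rewrite !opprB (addrC (E *m Q)) (addrA P) (addrC (a *: _)) addrA addrK.
    rewrite adjD adjB adjZ !adjM Ph Eh Qh; congr (_ + _ *: _).
    by rewrite mulmxA.
have fE : fro2 (L *m E) = l i.
  rewrite /fro2 /l; apply: eq_bigr => u _; rewrite (bigD1 i) //= big1 ?addr0 => [|v vi].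
    rewrite mxE (bigD1 i) //= big1 ?addr0 => [|w wi]; first by rewrite mxE !eqxx mulr1.
    by rewrite mxE (negbTE wi) mulr0.
  rewrite mxE big1 ?nc0 ?expr0n // => w _.
  by rewrite mxE (negbTE vi) andbF mulr0.
have fL' : fro2 L' = fro2 L + (q i)^-1 * l i.
  apply: complexI; rewrite -tr_fro2 /L' rmorphD rmorphM /= -fE -!tr_fro2 -/a.
  have QL : Q *m L ^t* = 0.
    by rewrite -Qh -adjM LQ; apply/matrixP => u v; rewrite !mxE rmorph0.
  have LQ' : L *m Q = 0 by [].
  rewrite adjB adjZ mulmxBl !mulmxBr.
  have -> : a *: (L *m E *m Q) *m L ^t* = 0.
    by rewrite -scalemxAl -(mulmxA (L *m E)) QL mulmx0 scaler0.
  have -> : L *m (a *: (L *m E *m Q) ^t*) = 0.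
    by rewrite -scalemxAr adjM Qh mulmxA LQ mul0mx scaler0.
  rewrite subr0 sub0r opprK mxtraceD; congr (_ + _).
  rewrite -mxtraceZ; congr (\tr _).
  have X1 : (L *m E *m Q) *m (L *m E *m Q) ^t* = L *m (E *m Q *m E) *m L ^t*.
    by rewrite !adjM Qh Eh !mulmxA -(mulmxA _ Q Q) QQ.
  have X2 : (L *m E) *m (L *m E) ^t* = L *m E *m L ^t*.
    by rewrite adjM Eh !mulmxA -(mulmxA L E E) EE.
  by rewrite -scalemxAl -scalemxAr X1 X2 (scalemxAl a _ (L ^t*)) (scalemxAr a L) EQE.
rewrite fL' -/k -natr1 mulrDr mulr1 mulrDl lerD2l.
by rewrite -mulrA ler_pdivrMl // (mulrC (q i)).
Qed.

(** The Moore-Penrose inverse [G^-1 N^* selmx S], where [N^* selmx S N] is made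
    invertible by adding the projection onto the coordinates outside [J]. *)
Lemma left_inverse_full S J M c : 0 < c ->
  (forall y, c * l2norm (mask J y) <= l2norm (mask S (M *m mask J y))) ->
  exists2 L, minimal_left_inverse S J (M *m selmx J) L & fro2 L <= #|J|%:R / c ^+ 2.
Proof.
move=> c0 lb; set N := M *m selmx J.
have NJ : N *m selmx J = N by rewrite /N -mulmxA selmx_idem.
have lbN y : c * l2norm (selmx J *m y) <= l2norm (selmx S *m (N *m y)).
  by rewrite !selmx_mask /N -mulmxA selmx_mask; exact: lb.
clearbody N.
have JNh : selmx J *m N ^t* = N ^t* by rewrite -[in RHS]NJ adjM selmx_adj.
pose T := 1%:M - selmx J; pose G := N ^t* *m selmx S *m N + T.
have TJ : T *m selmx J = 0 by rewrite mulmxBl mul1mx selmx_idem subrr.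
have JT : selmx J *m T = 0 by rewrite mulmxBr mulmx1 selmx_idem subrr.
have NT : N *m T = 0 by rewrite mulmxBr mulmx1 NJ subrr.
have TT : T *m T = T by rewrite {1}/T mulmxBl mul1mx JT subr0.
have Th : T ^t* = T.
  by rewrite adjB selmx_adj; congr (_ - _); rewrite trmx1 map_mx1.
have TN : T *m N ^t* = 0.
  by rewrite -Th -adjM NT; apply/matrixP => u v; rewrite !mxE rmorph0.
have GT : G *m T = T by rewrite mulmxDl -mulmxA NT mulmx0 add0r TT.
have Gh : G ^t* = G by rewrite adjD Th !adjM selmx_adj trmxCK mulmxA.
(* a vector killed by [G] is killed by its positive part, hence vanishes on [J] *)
have ker (y : 'cV[C]_n) : G *m y = 0 -> y = 0.
  move=> Gy; have yT : T *m y = 0.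
    have : T *m (G *m y) = 0 by rewrite Gy mulmx0.
    by rewrite mulmxA mulmxDr !mulmxA TN !mul0mx add0r TT.
  pose w := selmx S *m (N *m y).
  have : w ^t* *m w = y ^t* *m (G *m y).
    rewrite mulmxDl yT addr0 /w !adjM selmx_adj !mulmxA.
    by rewrite -(mulmxA _ (selmx S) (selmx S)) selmx_idem.
  rewrite Gy mulmx0 => /matrixP /(_ 0 0); rewrite adj_col_mulE mxE => /complexI w2.
  have w0 : l2norm w = 0 by rewrite /l2norm -/(nrm2 w) w2 sqrtr0.
  have Jy : selmx J *m y = 0.
    have := lbN y; rewrite -/w w0 => h; apply/eqP; rewrite -l2norm_eq0.
    by apply/eqP/le_anti; rewrite l2norm_ge0 andbT -(pmulr_rle0 _ c0).
  by rewrite -[y]mul1mx -[1%:M](subrK (selmx J)) mulmxDl -/T yT Jy addr0.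
have Gu : G \in unitmx.
  rewrite -row_free_unit -kermx_eq0; apply/rowV0P => v /sub_kermxP vG.
  apply: (can_inj (@trmxCK _ _ _)); rewrite (ker (v ^t*)).
    by apply/matrixP => i j; rewrite !mxE rmorph0.
  by rewrite -Gh -adjM vG; apply/matrixP => i j; rewrite !mxE rmorph0.
have Gih : (invmx G) ^t* = invmx G by rewrite trmx_inv map_invmx Gh.
have GiT : invmx G *m T = T by rewrite -{1}GT mulKmx.
have TGi : T *m invmx G = T by rewrite -{1}Th -Gih -adjM GiT.
have TJ1 : 1%:M - T = selmx J by rewrite /T opprB addrC subrK.
clearbody T; pose L := invmx G *m N ^t* *m selmx S.
have LE : L = invmx G *m N ^t* *m selmx S by [].
have LN : L *m N = selmx J.
  rewrite -TJ1 -(mulVmx Gu) -[X in _ - X]GiT -mulmxBr /L -!mulmxA; congr (_ *m _).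
  by rewrite /G addrK mulmxA.
have LS : L *m selmx S = L by rewrite /L -mulmxA selmx_idem.
have JL : selmx J *m L = L.
  by rewrite -TJ1 mulmxBl mul1mx LE !mulmxA TGi TN mul0mx subr0.
have adjL : L ^t* = selmx S *m N *m invmx G by rewrite !adjM trmxCK selmx_adj Gih mulmxA.
clearbody L; exists L.
  by split => //; rewrite (adjM _ L) adjL adjM selmx_adj LE !mulmxA.
rewrite /fro2 -sum1_card natr_sum mulr_suml [leRHS]big_mkcond /=.
apply: ler_sum => k _; case: ifPn => kJ; last first.
  rewrite big1 // => j _; rewrite -JL mul_selmx (negbTE kJ) mul0r nc0 expr0n //.
pose e : 'cV[C]_n := delta_mx k 0; pose w := L ^t* *m e.
have wk : nrm2 w = \sum_j nc (L k j) ^+ 2.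
  rewrite /nrm2; apply: eq_bigr => j _; congr (_ ^+ 2).
  by rewrite /w -colE !mxE nc_conj.
rewrite -wk; pose y := invmx G *m e.
have wy : w = selmx S *m (N *m y) by rewrite /w adjL /y !mulmxA.
have w2 : (nrm2 w)%:C%C = (selmx J *m y) k 0.
  have wL : w ^t* = e ^t* *m L by rewrite /w adjM trmxCK.
  rewrite -adj_col_mulE wL wy -mulmxA (mulmxA L) LS (mulmxA L) LN.
  have -> : e ^t* = delta_mx 0 k.
    by apply/matrixP => i j; rewrite !mxE andbC; case: (_ && _); rewrite ?rmorph1 ?rmorph0.
  by rewrite -rowE mxE.
have h1 : nrm2 w <= l2norm (selmx J *m y).
  apply: le_trans (nc_le_l2norm (selmx J *m y) k); rewrite -w2 nc_real.
  exact: ler_norm.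
have h2 := lbN y; rewrite -wy in h2; rewrite -sqr_l2norm in h1 *.
have := l2norm_ge0 w; move: (l2norm w) (l2norm (selmx J *m y)) h1 h2 => s u h1 h2 s0.
have h3 : c * s ^+ 2 <= s by apply: le_trans h2; rewrite ler_pM2l.
rewrite ler_pdivlMr ?exprn_gt0 //.
have [s1|s1] := leP s 0; first by nra.
have : c * s <= 1 by rewrite -(ler_pM2r s1) mul1r -mulrA -expr2.
have : 0 <= c * s by rewrite mulr_ge0 // ltW.
rewrite -exprMn (mulrC s); move: (c * s) => x; nra.
Qed.

(** Removing rows one at a time down to [s] of them: the factors
    [(k + 1) / k] telescope, so a fixed proportion of surplus rows costs only a
    constant factor. *)
Lemma left_inverse_select S0 J M c s : 0 < c ->
  (forall y, c * l2norm (mask J y) <= l2norm (mask S0 (M *m mask J y))) ->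
  (#|J| < s <= #|S0|)%N ->
  exists S L, [/\ S \subset S0, #|S| = s,
    forall y, L *m mask S (M *m mask J y) = mask J y &
    fro2 L <= (#|S0| - #|J|).+1%:R / (s - #|J|)%:R * (#|J|%:R / c ^+ 2)].
Proof.
move=> c0 lb /andP[Js sS]; set N := M *m selmx J.
have NJ : N *m selmx J = N by rewrite /N -mulmxA selmx_idem.
suff [S [L [SS0 cS mi fl]]] : exists S L, [/\ S \subset S0, #|S| = s,
    minimal_left_inverse S J N L &
    fro2 L * (s - #|J|).+1%:R <= (#|S0| - #|J|).+1%:R * (#|J|%:R / c ^+ 2)].
  have [LN LS _ _] := mi; exists S, L; split => //.
    by move=> y; rewrite -!selmx_mask !mulmxA LS -(mulmxA L) LN.
  rewrite mulrAC ler_pdivlMr; last by rewrite ltr0n subn_gt0.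
  by apply: le_trans fl; rewrite ler_wpM2l ?fro2_ge0 // ler_nat.
have [k hk] : exists k, (s + k = #|S0|)%N by exists (#|S0| - s)%N; lia.
elim: k s hk Js sS => [|k IH] s hk Js sS.
  have [L mi fl] := left_inverse_full c0 lb.
  exists S0, L; split => //; first by rewrite -hk addn0.
  by rewrite mulrC -hk addn0 ler_wpM2l // ler0n.
have [||| S [L [SS0 cS mi fl]]] := IH s.+1; try lia.
have [|i [L' [iS mi' fl']]] := left_inverse_remove_row NJ mi; first by rewrite cS ltnW.
exists (S :\ i), L'; split => //.
- by apply: subset_trans SS0; rewrite subD1set.
- by have := cardsD1 i S; rewrite iS cS; lia.
rewrite cS subSn ?(ltnW Js) // in fl fl'; exact: le_trans fl' fl.
Qed.

End LeftInverse.

(** * Rounding and counting integer vectors *)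

Section Rounding.
Import boot.fintype boot.finset.
Variable R : realType.
Local Notation C := R[i].

Lemma sum_pair_bool (V : nmodType) (I : finType) (F : I * bool -> V) :
  \sum_k F k = \sum_i (F (i, false) + F (i, true)).
Proof.
transitivity (\sum_i \sum_b F (i, b)); first by rewrite pair_bigA; apply: eq_bigr => -[].
by apply: eq_bigr => i _; rewrite big_bool addrC.
Qed.

Lemma nrm2_addZ n (V u : 'cV[C]_n) (th : R) :
  nrm2 (V + (th%:C)%C *: u) = nrm2 V
    + 2 * th * \sum_i (complex.Re (V i 0) * complex.Re (u i 0) +
                       complex.Im (V i 0) * complex.Im (u i 0))
    + th ^+ 2 * nrm2 u.
Proof.
rewrite /nrm2 !mulr_sumr -!big_split /=; apply: eq_bigr => i _; rewrite !mxE !sqr_nc.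
by case: (V i 0) => a b; case: (u i 0) => c d /=; ring.
Qed.

(** Rounding up or down so that each step has non-positive inner product with
    the error already made keeps the total error Pythagorean; rounding to the
    nearest integers could lose a factor equal to the dimension. *)
Lemma signed_rounding (n : nat) (K : finType) (al : K -> R) (u : K -> 'cV[C]_n) :
  exists a : K -> int, (forall k, `|al k - (a k)%:~R| <= 1) /\
  nrm2 (\sum_k ((al k - (a k)%:~R)%:C)%C *: u k) <= \sum_k nrm2 (u k).
Proof.
have : uniq (index_enum K) by exact: index_enum_uniq.
elim: (index_enum K) => [_|k s IH /= /andP[ks us]].
  exists (fun k => Num.floor (al k)); split.
    by move=> k; have := floor_itv (al k); rewrite ler_norml => /andP[]; rewrite intrD; lra.
  by rewrite !big_nil /nrm2 big1 // => i _; rewrite mxE nc0 expr0n.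
have [a [a1 ha]] := IH us.
set V := \sum_(j <- s) _ in ha.
set ip := \sum_i (complex.Re (V i 0) * complex.Re (u k i 0) +
                  complex.Im (V i 0) * complex.Im (u k i 0)).
have [b [b1 hb]] : exists b : int, `|al k - b%:~R| <= 1 /\ (al k - b%:~R) * ip <= 0.
  have := floor_itv (al k) ; rewrite intrD => /andP[f1 f2].
  case: (leP ip 0) => hip.
    exists (Num.floor (al k)); split; first by rewrite ler_norml; lra.
    by rewrite mulr_ge0_le0 // subr_ge0.
  exists (Num.floor (al k) + 1); rewrite intrD; split; first by rewrite ler_norml; lra.
  by rewrite mulr_le0_ge0 ?(ltW hip) // subr_le0 ltW.
exists (fun j => if j == k then b else a j); split.
  by move=> j; case: eqP => [->|_].
rewrite !big_cons eqxx addrC.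
have -> : \sum_(j <- s) ((al j - (if j == k then b else a j)%:~R)%:C)%C *: u j = V.
  apply: eq_big_seq => j js; have /negbTE -> // : j != k.
  by apply: contraNneq ks => <-.
rewrite nrm2_addZ -/ip.
have : (al k - b%:~R) ^+ 2 <= 1 by rewrite -real_normK ?num_real // expr_le1.
have := nrm2_ge0 (u k); move: ((al k - b%:~R) ^+ 2) (nrm2 (u k)) => x y hy hx.
have hxy : x * y <= y by rewrite ler_piMl.
rewrite -mulrA; lra.
Qed.

Definition grid n (h : R) (a : 'I_n * bool -> int) : 'cV[C]_n :=
  \col_k Complex (h * (a (k, false))%:~R) (h * (a (k, true))%:~R).

Definition coord n (z : 'cV[C]_n) (k : 'I_n * bool) : R :=
  if k.2 then complex.Im (z k.1 0) else complex.Re (z k.1 0).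

Lemma sum_sqr_coord n (z : 'cV[C]_n) : \sum_k coord z k ^+ 2 = nrm2 z.
Proof.
by rewrite sum_pair_bool; apply: eq_bigr => i _; rewrite sqr_nc.
Qed.

(** Rounding [z] so that the error is small after [L]: each of the [2 n] real
    coordinates contributes at most [h] times a column of [L]. *)
Lemma left_inverse_rounding n (L : 'M[C]_n) (z : 'cV[C]_n) (h : R) : 0 < h ->
  exists a : 'I_n * bool -> int,
    (forall k, `|(a k)%:~R| <= `|coord z k| / h + 1) /\
    nrm2 (L *m (z - grid h a)) <= 2 * h ^+ 2 * fro2 L.
Proof.
move=> h0; pose u (k : 'I_n * bool) : 'cV[C]_n :=
  (if k.2 then Complex 0 h else Complex h 0) *: col k.1 L.
have [a [a1 ha]] := signed_rounding (fun k => coord z k / h) u.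
exists a; split=> [k|].
  have := a1 k; have -> : `|coord z k| / h = `|coord z k / h| by rewrite normrM (gtr0_norm (x := h^-1)) // invr_gt0.
  move: (coord z k / h) ((a k)%:~R : R) => x y hxy.
  by rewrite -(subrK x y) addrC; apply: le_trans (ler_normD _ _) _; rewrite lerD2l distrC.
have -> : L *m (z - grid h a) = \sum_k ((coord z k / h - (a k)%:~R)%:C)%C *: u k.
  rewrite sum_pair_bool.
  apply/colP => i; rewrite mxE summxE; apply: eq_bigr => j _.
  rewrite !mxE /coord /u /=; case: (z j 0) => x y; case: (L i j) => p q /=.
  by apply/eqP; rewrite eq_complex /=; apply/andP; split; apply/eqP; field; rewrite gt_eqF.
apply: le_trans ha _.
rewrite sum_pair_bool.
have -> : fro2 L = \sum_j nrm2 (col j L).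
  rewrite /fro2 exchange_big; apply: eq_bigr => j _.
  by apply: eq_bigr => i _; rewrite mxE.
rewrite mulr_sumr; apply: ler_sum => j _.
have e1 : nc (Complex h 0) ^+ 2 = h ^+ 2 by rewrite sqr_nc /= expr0n addr0.
have e2 : nc (Complex 0 h) ^+ 2 = h ^+ 2 by rewrite sqr_nc /= expr0n add0r.
by rewrite /u /= !nrm2Z e1 e2; lra.
Qed.

(** Generating-function count of the integer points of a cross-polytope. With
    [lam] near 0 the base is near 1; with [lam = 1 - 1 / (2 q)] the bound is
    of order [q ^ #|K|] for radius of order [q]. *)
Lemma count_int_vectors (K : finType) (N : nat) (lam : R) : 0 < lam < 1 ->
  exists m (l : 'I_m -> K -> int),
    m%:R * lam ^+ N <= ((1 + lam) / (1 - lam)) ^+ #|K| /\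
    forall a : K -> int, (\sum_k `|a k| <= N)%N -> exists i, forall k, l i k = a k.
Proof.
move=> /andP[l0 l1]; pose Sy := (bool * 'I_N.+1)%type.
pose G := [set f : {ffun K -> Sy} | (\sum_k (f k).2 <= N)%N &
   [forall k, f k != (true, ord0)]].
pose de (s : Sy) : int := if s.1 then - (s.2 : nat)%:Z else (s.2 : nat)%:Z.
exists #|G|, (fun i k => de ((enum_val i : {ffun K -> Sy}) k)); split.
  pose wt (s : Sy) : R := if s == (true, ord0) then 0 else lam ^+ (s.2 : nat).
  have wt0 s : 0 <= wt s by rewrite /wt; case: ifP => // _; rewrite exprn_ge0 // ltW.
  have wtle s : wt s <= lam ^+ (s.2 : nat).
    by rewrite /wt; case: ifP => // _; rewrite exprn_ge0 // ltW.
  apply: (@le_trans _ _ (\sum_(f : {ffun K -> Sy}) \prod_k wt (f k))).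
    rewrite mulr_natl -sumr_const big_mkcond /=; apply: ler_sum => f _.
    case: ifPn => [|_]; last exact: prodr_ge0.
    rewrite inE => /andP[h1 /forallP h2].
    have -> : \prod_k wt (f k) = lam ^+ (\sum_k (f k).2).
      rewrite (big_morph _ (exprD lam) (expr0 lam)); apply: eq_bigr => k _.
      by rewrite /wt (negbTE (h2 k)).
    by apply: ler_wiXn2l => //; exact: ltW.
  rewrite -(bigA_distr_bigA (fun _ => wt)) /= -prodr_const.
  apply: ler_prod => k _; apply/andP; split; first by apply: sumr_ge0.
  rewrite (_ : \sum_s wt s = \sum_b \sum_j wt (b, j)); last first.
    by rewrite pair_bigA; apply: eq_bigr => -[].
  rewrite big_bool [leLHS]addrC /=.
  have geo M : \sum_(j < M) lam ^+ j <= (1 - lam)^-1.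
    have l1' : 0 < 1 - lam by rewrite subr_gt0.
    rewrite -(ler_pM2l l1') divff ?gt_eqF // -opprB mulNr -subrX1 opprB.
    by rewrite lerBlDr lerDl exprn_ge0 // ltW.
  have -> : (1 + lam) / (1 - lam) = (1 - lam)^-1 + lam * (1 - lam)^-1.
    by rewrite mulrDl mul1r.
  apply: lerD.
    by apply: le_trans (geo N.+1); apply: ler_sum => j _; rewrite /wt.
  rewrite big_ord_recl {1}/wt eqxx add0r.
  apply: le_trans (ler_wpM2l (ltW l0) (geo N)); rewrite mulr_sumr; apply: ler_sum => j _.
  by apply: le_trans (wtle _) _; rewrite /= /bump /= exprS.
move=> a ha; have aN k : (`|a k| < N.+1)%N.
  by rewrite ltnS; apply: leq_trans ha; rewrite (bigD1 k) //= leq_addr.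
pose f : {ffun K -> Sy} := [ffun k => (a k < 0, Ordinal (aN k))].
have fG : f \in G.
  rewrite inE; apply/andP; split.
    by rewrite (eq_bigr (fun k => `|a k|)%N) // => k _; rewrite ffunE.
  apply/forallP => k; rewrite ffunE; apply/eqP => -[h /eqP].
  by rewrite absz_eq0 => /eqP e; rewrite e ltxx in h.
exists (enum_rank_in fG f) => k; rewrite enum_rankK_in // /de ffunE /=.
by case: ifP; lia.
Qed.

End Rounding.

(** * The finite model *)

Section Model.
Import boot.fintype boot.finset.
Variable R : realType.
Local Notation C := R[i].
Variables (n : nat) (V : finType) (p : V -> R) (c : V -> C).
Variables (A : 'M[R]_n) (B : 'M[C]_n).

Definition outcome := {ffun 'I_n -> {ffun 'I_n -> V}}.

Definition model_mx (o : outcome) : 'M[C]_n :=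
  structured_mx A (\matrix_(i, j) c (o i j)) B.

Definition iidw : outcome -> R := prodw (prodw p).

Definition rowval (x : 'cV[C]_n) (i : 'I_n) (v : {ffun 'I_n -> V}) : C :=
  \sum_j ((A i j)%:C%C * x j 0) * c (v j) + (B *m x) i 0.

Lemma rowvalE o x i : (model_mx o *m x) i 0 = rowval x i (o i).
Proof.
rewrite /rowval !mxE -big_split /=; apply: eq_bigr => j _; rewrite !mxE.
by rewrite mulrDl mulrAC.
Qed.

Hypothesis wp : is_prob p.

Lemma iidw_prob : is_prob iidw.
Proof. exact/prodw_prob/prodw_prob. Qed.

(** At most [g] of the terms of the sum exceed [tau ^ 2], so at least [#|I| - g]
    rows are small and Chernoff's bound applies. *)
Lemma fpr_few_large_rows (x : 'cV[C]_n) (tau q lam : R) (I : {set 'I_n}) (g : nat) :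
  0 < tau -> 1 <= lam ->
  (forall i, i \in I -> fpr (prodw p) (fun v => nc (rowval x i v) <= tau) <= q) ->
  fpr iidw (fun o => \sum_(i in I) nc (rowval x i (o i)) ^+ 2 <= g%:R * tau ^+ 2) * lam ^+ (#|I| - g)
  <= (1 + (lam - 1) * q) ^+ #|I|.
Proof.
move=> tau0 lam1 hq.
apply: le_trans (fpr_chernoff (prodw_prob _ wp) (#|I| - g) lam1 hq).
apply: ler_wpM2r; first by rewrite exprn_ge0 // (le_trans _ lam1).
apply: (le_fpr iidw_prob) => o ho; rewrite leq_subLR.
set Bd := [set i in I | _].
have cI : #|I| = (#|I :\: Bd| + #|Bd|)%N.
  rewrite addnC -(cardsID Bd I); congr (_ + _)%N; apply: eq_card => i.
  by rewrite !inE; case: (i \in I).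
rewrite cI leq_add2r -(ler_nat R).
have t2 : 0 < tau ^+ 2 by rewrite exprn_gt0.
rewrite -(ler_pM2r t2); apply: le_trans ho.
rewrite mulr_natl -sumr_const [leRHS](big_setID (I :\: Bd)) /= ler_wpDr //.
  by apply: sumr_ge0 => i _; exact: sqr_ge0.
rewrite (setIidPr (subsetDl _ _)); apply: ler_sum => i; rewrite !inE => /andP[+ iI].
rewrite iI /= => /asboolPn /negP; rewrite -ltNge => h.
by rewrite lerXn2r ?nnegrE ?nc_ge0 // ltW.
Qed.

Lemma row_small_ball (C1 sigma rho tau : R) (x : 'cV[C]_n) (i : 'I_n) :
  small_ball_bound p c C1 -> (0 < n)%N -> 0 < sigma -> 0 < rho -> 0 <= tau ->
  fpr (prodw p) (fun v => nc (rowval x i v) <= tau) *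
    Num.sqrt #|[set j in spread_set rho x | sigma <= A i j]|%:R
  <= C1 * (tau / (sigma * rho / Num.sqrt n%:R) + 1).
Proof.
move=> SB n0 sg0 rho0 tau0; set N := [set j in _ | _].
have s0 : 0 < sigma * rho / Num.sqrt n%:R by rewrite divr_gt0 ?mulr_gt0 // sqrtr_gt0 ltr0n.
have hN j : j \in N -> sigma * rho / Num.sqrt n%:R <= nc ((A i j)%:C%C * x j 0).
  rewrite !inE => /andP[h1 h2]; rewrite ncM nc_real -mulrA.
  apply: ler_pM => //; [exact: ltW|by rewrite divr_ge0 ?sqrtr_ge0 // ltW|].
  by apply: le_trans h2 _; exact: ler_norm.
have e : fpr (prodw p) (fun v => nc (rowval x i v) <= tau) =
   fpr (prodw p) (fun v => nc (\sum_j ((A i j)%:C%C * x j 0) * c (v j) - - (B *m x) i 0) <= tau).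
  by rewrite opprK.
by rewrite e; exact: SB.
Qed.

(** Given the rows in [S], the others keep their law. *)
Lemma rowval_mix (S : {set 'I_n}) (f g : outcome) x i : i \notin S ->
  (model_mx (mix S f g) *m x) i 0 = rowval x i (g i).
Proof. by move=> iS; rewrite rowvalE ffunE (negbTE iS). Qed.

End Model.

Arguments model_mx {R n V} c A B o.
Arguments rowval {R n V} c A B x i v.
Arguments iidw {R n V} p o.

Lemma bernoulli (R : realType) (x : R) m : 0 <= x <= 1 -> 1 - m%:R * x <= (1 - x) ^+ m.
Proof.
move=> /andP[x0 x1]; elim: m => [|m IH]; first by rewrite expr0 mul0r subr0.
rewrite exprS; apply: le_trans (_ : (1 - x) * (1 - m%:R * x) <= _); last first.
  by rewrite ler_wpM2l // subr_ge0.
rewrite -natr1; have : 0 <= (m%:R * x) * x by rewrite !mulr_ge0.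
by move: (m%:R : R) => y; lra.
Qed.

Lemma expr_quot_le2 (R : realType) (D : nat) (lam : R) : (0 < D)%N ->
  lam = (16 * D%:R)^-1 -> 0 < lam < 1 /\ ((1 + lam) / (1 - lam)) ^+ (2 * D) <= 2.
Proof.
move=> D0 lamE; have DR : 1 <= D%:R :> R by rewrite ler1n.
have lD : lam * D%:R = 1 / 16 by rewrite lamE; field; rewrite gt_eqF // (lt_le_trans _ DR).
have l0 : 0 < lam by rewrite lamE invr_gt0 mulr_gt0 // (lt_le_trans _ DR).
have l1 : lam <= 1 / 16 by nra.
split; first lra.
pose x := 4 * lam; have x01 : 0 <= x <= 1 by rewrite /x; lra.
have hb := @bernoulli R x (2 * D) x01.
have h1 : (1 + lam) / (1 - lam) <= (1 - x)^-1.
  rewrite ler_pdivrMr; last lra.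
  rewrite mulrC ler_pdivlMr; last by rewrite /x; lra.
  by rewrite /x; nra.
apply: le_trans (_ : ((1 - x)^-1) ^+ (2 * D) <= _).
  rewrite lerXn2r ?nnegrE ?invr_ge0 //; first by rewrite divr_ge0; lra.
  by rewrite /x; lra.
rewrite exprVn -[leRHS]invrK lef_pV2 ?posrE ?invr_gt0 ?exprn_gt0 //; last by rewrite /x; lra.
apply: le_trans hb; rewrite natrM /x; lra.
Qed.

Lemma exists_nat_ge (R : realType) (x : R) : exists2 m : nat, (0 < m)%N & x <= m%:R.
Proof.
by exists (Num.truncn x).+1 => //; apply/ltW; exact: truncnS_gt.
Qed.

Lemma sqrt_natr_le (R : realType) n : (0 < n)%N -> Num.sqrt (n%:R : R) <= n%:R.
Proof.
move=> n0; have nR : (0 : R) <= n%:R by rewrite ler0n.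
rewrite -[leRHS](sqr_sqrtr nR) expr2 ler_peMr ?sqrtr_ge0 //.
by rewrite -[leLHS]sqrtr1 ler_sqrt // ler1n.
Qed.

(** * Very sparse vectors *)

Section VerySparse.
Import boot.fintype boot.finset.
Variable R : realType.
Local Notation C := R[i].

(** The norm bound belongs to the event because passing to a net uses it. *)
Definition sparse_null n (M : 'M[C]_n) (Q : {set 'I_n}) (K theta c : R) :=
  opbound M (K * Num.sqrt n%:R) /\
  exists x, [/\ l2norm x = 1, #|supp x|%:R <= theta * n%:R &
    l2norm (mask Q (M *m x)) <= c * Num.sqrt n%:R].

Lemma sparse_null_scale n (M : 'M[C]_n) Q K theta c x :
  opbound M (K * Num.sqrt n%:R) -> x != 0 -> #|supp x|%:R <= theta * n%:R ->
  l2norm (mask Q (M *m x)) <= c * Num.sqrt n%:R * l2norm x ->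
  sparse_null M Q K theta c.
Proof.
move=> MK x0 sx hx; split=> //; have l0 : 0 < l2norm x by rewrite l2norm_gt0.
pose a := (((l2norm x)^-1)%:C)%C : C; exists (a *: x).
have na : nc a = (l2norm x)^-1 := nc_inv_l2norm x.
split.
- by rewrite l2normZ na mulVf // gt_eqF.
- apply: le_trans sx; rewrite ler_nat; apply/subset_leq_card/subsetP => i.
  by rewrite !inE mxE; apply: contraNneq => ->; rewrite mulr0.
- by rewrite -scalemxAr maskZ l2normZ na ler_pdivrMl // mulrC.
Qed.

Lemma trunc_toward_zero (t : R) : exists a : int, `|a%:~R| <= `|t| /\ `|t - a%:~R| <= 1.
Proof.
have fl (u : R) : 0 <= u -> exists a : int, `|a%:~R| <= `|u| /\ `|u - a%:~R| <= 1.
  move=> u0; exists (Num.floor u); have := floor_itv u; rewrite intrD => /andP[f1 f2].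
  have f0 : 0 <= (Num.floor u)%:~R :> R by rewrite ler0z floor_ge0.
  by rewrite !ger0_norm // ?subr_ge0 //; split; lra.
case: (leP 0 t) => t0; first exact: fl.
have [|a [a1 a2]] := fl (- t); first by rewrite oppr_ge0 ltW.
exists (- a); rewrite rmorphN normrN; split; first by rewrite normrN in a1.
by rewrite opprK -normrN opprD; exact: a2.
Qed.

Lemma coordB n (x y : 'cV[C]_n) k : coord (x - y) k = coord x k - coord y k.
Proof. by rewrite /coord !mxE; case: k.2; rewrite ?ImB ?ReB. Qed.

Lemma coord_grid n (h : R) a k : coord (grid h a : 'cV[C]_n) k = h * (a k)%:~R.
Proof. by case: k => i [] /=; rewrite /coord /= mxE. Qed.

Lemma exists_grid_coord n (x : 'cV[C]_n) h : 0 < h ->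
  exists a : 'I_n * bool -> int, forall k, `|h * (a k)%:~R| <= `|coord x k| /\
    `|coord x k - h * (a k)%:~R| <= h.
Proof.
move=> h0; have [a ha] := choice (fun k => trunc_toward_zero (coord x k / h)).
exists a => k; have [ak ak'] := ha k; split.
  rewrite normrM (gtr0_norm h0) mulrC -ler_pdivlMr //; apply: le_trans ak _.
  by rewrite normrM (gtr0_norm (x := h^-1)) ?invr_gt0.
have -> : coord x k - h * (a k)%:~R = h * (coord x k / h - (a k)%:~R).
  by rewrite mulrBr mulrCA divff ?gt_eqF // mulr1.
by rewrite normrM gtr0_norm // -[leRHS]mulr1 ler_pM2l.
Qed.

(** Rounding toward zero preserves the support and does not increase the norm.
    As [`|a| <= a ^ 2] for integers, the rounded vector lies in a cross-polytope
    of radius [nrm2 x / h ^ 2], far fewer than all grid points. *)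
Lemma exists_grid_toward_zero n (x : 'cV[C]_n) h : 0 < h ->
  exists a : 'I_n * bool -> int, let y : 'cV[C]_n := grid h a in
   [/\ nrm2 y <= nrm2 x, nrm2 (x - y) <= 2 * #|supp x|%:R * h ^+ 2 &
    (\sum_k `|a k|%N)%:R <= nrm2 x / h ^+ 2].
Proof.
move=> h0; have [a ha] := exists_grid_coord x h0.
exists a => y; have yE k : coord y k = h * (a k)%:~R by exact: coord_grid.
have h1 k : `|coord y k| <= `|coord x k| by rewrite yE; exact: (ha k).1.
have h2 k : `|coord x k - coord y k| <= h by rewrite yE; exact: (ha k).2.
have sq (u v : R) : `|u| <= `|v| -> u ^+ 2 <= v ^+ 2.
  by move=> uv; rewrite -(real_normK (num_real u)) -(real_normK (num_real v)) lerXn2r ?nnegrE.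
split.
- by rewrite -!sum_sqr_coord; apply: ler_sum => k _; exact/sq/h1.
- rewrite -sum_sqr_coord sum_pair_bool -mulrA mulrCA -sum1_card natr_sum mulr_suml.
  rewrite [leRHS]big_mkcond; apply: ler_sum => i _; rewrite !coordB.
  have hh k : (coord x k - coord y k) ^+ 2 <= h ^+ 2.
    by apply: sq; rewrite (gtr0_norm h0).
  case: ifPn => [_|/suppPn xi]; first by rewrite mul1r; have := hh (i, false); have := hh (i, true); lra.
  have z b : coord x (i, b) = 0 by rewrite /coord /= xi; case: b.
  have zy b : coord y (i, b) = 0.
    by apply/eqP; rewrite -normr_le0; apply: le_trans (h1 _) _; rewrite z normr0.
  by rewrite !z !zy subrr expr0n addr0.
- rewrite ler_pdivlMr ?exprn_gt0 // natr_sum mulr_suml -sum_sqr_coord.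
  apply: ler_sum => k _; apply: le_trans (sq _ _ (h1 k)); rewrite yE exprMn mulrC.
  apply: ler_wpM2l; first exact: sqr_ge0.
  rewrite -(real_normK (num_real (a k)%:~R)) -intr_norm -natr_absz -natrX ler_nat.
  by case: `|a k|%N => // u; rewrite leq_pmulr.
Qed.

(** For a fixed unit vector the column degrees give a positive proportion of rows
    whose sum has weights with squares adding up to at least [b0]; each of these
    rows exceeds [tau] with probability at least [p0 / 12], so that they are
    almost all small only with exponentially small probability. For [theta] small
    the net of sparse vectors, counted with [lam] and [D], is small compared with
    this exponent. *)
Lemma very_sparse_bound (K delta sigma r p0 : R) : 0 < K -> 0 < delta -> 0 < sigma ->
  0 < r -> 0 < p0 <= 1 ->
  exists theta c C0, [/\ 0 < theta, 0 < c, 0 < C0 &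
  forall n (V : finType) (p : V -> R) (cc : V -> C) (A : 'M[R]_n) B (Q : {set 'I_n}),
  (0 < n)%N -> is_prob p -> nondegenerate p cc r p0 ->
  (forall i j, 0 <= A i j <= 1) ->
  (forall j, delta * n%:R <= #|[set i | sigma <= A i j]|%:R) ->
  (#|~: Q| <= 1)%N ->
  fpr (iidw p) (fun o => sparse_null (model_mx cc A B o) Q K theta c) <= C0 / Num.sqrt n%:R].
Proof.
move=> K0 d0 sg0 r0 p01.
have quarter (u : R) : 1 / 2 <= u -> 1 / 4 <= u ^+ 2 by move=> ?; nra.
have half_le (u v w : R) : 1 <= u + v -> v <= w -> w <= 1 / 2 -> 1 / 2 <= u by lra.
have /andP[p00 p01'] := p01.
pose b0 := sigma ^+ 2 * delta / 16; pose tau := Num.sqrt (r ^+ 2 * p0 / 256 * b0).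
have b00 : 0 < b0 by rewrite divr_gt0 // mulr_gt0 // exprn_gt0.
have t2 : 0 < r ^+ 2 * p0 / 256 * b0 by rewrite !mulr_gt0 ?invr_gt0 ?exprn_gt0 ?ltr0n.
have tau0 : 0 < tau by rewrite sqrtr_gt0.
have tauE : tau ^+ 2 = r ^+ 2 * p0 / 256 * b0 by exact: sqr_sqrtr (ltW t2).
pose y := p0 / 24; have y0 : 0 < y by rewrite divr_gt0.
have y1 : y <= 1 / 24 by rewrite /y; lra.
have [h1 [h10 hh1]] : exists h, (0 < h)%N /\ (1 - y) ^+ h <= 1 / 16.
  by apply: exists_expr_le; lra.
have [D D0 hD] := exists_nat_ge (h1%:R / b0).
have DR : (0 : R) < D%:R by rewrite ltr0n.
pose lam : R := (16 * D%:R)^-1.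
have [lam01 hlam] := expr_quot_le2 D0 (erefl lam).
have [l0 l1] := andP lam01.
have [Lam Lam0 hLam] : exists2 Lam : nat, (0 < Lam)%N & lam^-1 <= 2 ^+ Lam.
  have [m m0 hm] := exists_nat_ge (lam^-1); exists m => //; apply: le_trans hm _.
  by rewrite -natrX ler_nat ltnW // ltn_expl.
pose c1 := tau / Num.sqrt D%:R; have sD : 0 < Num.sqrt (D%:R : R) by rewrite sqrtr_gt0.
have c10 : 0 < c1 by rewrite divr_gt0.
have c1E : c1 ^+ 2 * D%:R = tau ^+ 2.
  by rewrite /c1 expr_div_n (sqr_sqrtr (ltW DR)) divfK // gt_eqF.
pose eps := Num.min (1 / 2) (c1 / (2 * K)).
have eps0 : 0 < eps by rewrite lt_min divr_gt0 //= divr_gt0 // mulr_gt0.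
have eps1 : eps <= 1 / 2 by rewrite ge_min lexx.
have epsK : K * eps <= c1 / 2.
  have : eps <= c1 / (2 * K) by rewrite ge_min lexx orbT.
  by rewrite ler_pdivlMr ?mulr_gt0 //; lra.
have LR : (0 : R) < Lam%:R by rewrite ltr0n.
pose theta := eps ^+ 2 / (2 * Lam%:R * D%:R).
have theta0 : 0 < theta by rewrite divr_gt0 ?exprn_gt0 // !mulr_gt0.
have c20 : 0 < c1 / 2 by rewrite divr_gt0.
have C00 : 0 < 8 * D%:R + 2 / delta by rewrite addr_gt0 ?mulr_gt0 ?invr_gt0.
have thetaE : theta * (2 * Lam%:R * D%:R) = eps ^+ 2.
  by rewrite /theta divfK // gt_eqF // !mulr_gt0.
have yE : 1 - p0 / 12 = 1 - 2 * y by rewrite /y; field.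
have b0E : sigma ^+ 2 * delta = 16 * b0 by rewrite /b0; field.
clearbody theta eps c1 lam tau y b0.
exists theta, (c1 / 2), (8 * D%:R + 2 / delta); split => //.
move=> n V p cc A B Q n0 wp nd A01 hdeg cQ.
have nR : (0 : R) < n%:R by rewrite ltr0n.
have nR1 : (1 : R) <= n%:R by rewrite ler1n.
have sn : 0 < Num.sqrt (n%:R : R) by rewrite sqrtr_gt0.
have wP := iidw_prob n wp.
have snn : Num.sqrt (n%:R : R) <= n%:R.
  exact: sqrt_natr_le.
have [dn|dn] := ltP (delta * n%:R) 2.
  apply: le_trans (fpr_le1 wP _) _; rewrite ler_pdivlMr // mul1r.
  apply: le_trans snn _; apply: le_trans (_ : 2 / delta <= _); last by rewrite lerDr mulr_ge0.
  by rewrite ler_pdivlMr // mulrC ltW.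
set b := (n %/ D)%N.
have nb : (n < D * b.+1)%N by rewrite mulnC -ltn_divLR.
have bn : (D * b <= n)%N by rewrite mulnC leq_divM.
have nbR : n%:R <= D%:R * b.+1%:R :> R by rewrite -natrM ler_nat ltnW.
pose h := eps / Num.sqrt (2 * theta * n%:R).
have th2 : 0 < 2 * theta * n%:R by rewrite !mulr_gt0.
have h0 : 0 < h by rewrite divr_gt0 // sqrtr_gt0.
have h2 : h ^+ 2 = eps ^+ 2 / (2 * theta * n%:R).
  by rewrite /h expr_div_n sqr_sqrtr // ltW.
pose N := Num.truncn (1 / h ^+ 2).
have [m [l [ml hl]]] := @count_int_vectors R ('I_n * bool)%type N lam lam01.
pose yv (i : 'I_m) : 'cV[C]_n := grid h (l i).
pose G : pred 'I_m := fun i => (1 / 4 <= nrm2 (yv i) <= 1).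
pose E (i : 'I_m) o := l2norm (mask Q (model_mx cc A B o *m yv i)) <= c1 * Num.sqrt n%:R.
apply: (@le_trans _ _ (fpr (iidw p) (fun o => exists2 i, G i & E i o))).
  apply: (le_fpr wP) => o [MK [x [x1 sx hx]]].
  have x2 : nrm2 x = 1 by rewrite -sqr_l2norm x1 expr1n.
  have [a /=] := exists_grid_toward_zero x h0; set z := grid h a; move=> [a1 a2 a3].
  have [i hi] : exists i, forall k, l i k = a k.
    by apply: hl; rewrite x2 in a3; rewrite truncn_ge_nat // divr_ge0 ?sqr_ge0.
  have zE : yv i = z by apply/colP => k; rewrite !mxE !hi.
  have xz : l2norm (x - z) <= eps.
    rewrite le_l2norm ?(ltW eps0) //; apply: le_trans a2 _; rewrite h2 mulrA ler_pdivrMr //.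
    rewrite mulrC; apply: ler_wpM2l; first exact: sqr_ge0.
    by rewrite -mulrA ler_pM2l.
  exists i.
    rewrite /G zE; apply/andP; split; last by rewrite -x2.
    have : l2norm x <= l2norm z + l2norm (x - z) by rewrite -{1}(subrK z x) addrC l2normD.
    rewrite x1 -sqr_l2norm => hz; apply: quarter.
    exact: half_le hz xz eps1.
  rewrite /E zE; have -> : z = x - (x - z) by rewrite opprB addrC subrK.
  rewrite mulmxBr maskB; apply: le_trans (l2normB _ _) _.
  have : l2norm (mask Q (model_mx cc A B o *m (x - z))) <= c1 / 2 * Num.sqrt n%:R.
    apply: le_trans (l2norm_mask_le _ _) _; apply: le_trans (MK _) _.
    rewrite mulrAC; apply: ler_wpM2r; first exact: ltW.
    by apply: le_trans epsK; rewrite ler_wpM2l // ltW.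
  by move: hx; clear; move: (l2norm _) (l2norm _) => u v; lra.
have EP i : G i -> fpr (iidw p) (E i) <= 2 ^+ b.+1 * (1 / 16) ^+ b.
  move=> /andP[z1 z2]; set z := yv i in z1 z2 *.
  pose mass (k : 'I_n) := \sum_j nc ((A k j)%:C%C * z j 0) ^+ 2.
  pose I := [set k in Q | b0 <= mass k].
  (* By the column degrees the total mass is at least [2 b0 n], and no row has mass
     more than one. *)
  have cI : b0 * n%:R <= #|I|%:R.
    have m1 k : mass k <= 1.
      apply: le_trans z2; apply: ler_sum => j _; have /andP[A0 A1] := A01 k j.
      rewrite ncM exprMn nc_real ger0_norm // ler_piMl ?sqr_ge0 //.
      by rewrite expr_le1.
    have up : \sum_(k in Q) mass k <= #|I|%:R + b0 * n%:R.
      apply: (@le_trans _ _ (\sum_(k in Q) ((k \in I)%:R + b0))).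
        apply: ler_sum => k kQ; rewrite inE kQ /=; case: (leP b0 (mass k)) => hk.
          by apply: le_trans (m1 k) _; rewrite lerDl ltW.
        by rewrite add0r ltW.
      rewrite big_split /=; apply: lerD.
        rewrite -sum1_card natr_sum [leRHS]big_mkcond [leLHS]big_mkcond /=.
        by apply: ler_sum => k _; case: (k \in Q); case: (k \in I).
      rewrite sumr_const -(mulr_natr b0) ler_pM2l // ler_nat.
      by apply: leq_trans (max_card _) _; rewrite card_ord.
    have low : 2 * b0 * n%:R <= \sum_(k in Q) mass k.
      rewrite exchange_big /=.
      apply: (@le_trans _ _ (\sum_j (8 * b0 * n%:R) * nc (z j 0) ^+ 2)).
        rewrite -mulr_sumr -/(nrm2 z).
        have : 0 <= b0 * n%:R * (nrm2 z - 1 / 4).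
          by rewrite !mulr_ge0 // ?(ltW b00) // subr_ge0.
        by rewrite -(mulrA 2 b0) -(mulrA 8 b0); clear; move: (nrm2 z) (b0 * n%:R) => u v; lra.
      apply: ler_sum => j _.
      apply: (@le_trans _ _ (\sum_(k in Q | sigma <= A k j) sigma ^+ 2 * nc (z j 0) ^+ 2)); last first.
        rewrite [leRHS](bigID (fun k => sigma <= A k j)) /= ler_wpDr //.
          by apply: sumr_ge0 => k _; exact: sqr_ge0.
        apply: ler_sum => k /andP[_ hk]; rewrite ncM exprMn nc_real.
        apply: ler_wpM2r; first exact: sqr_ge0.
        rewrite lerXn2r ?nnegrE ?(ltW sg0) //.
        by apply: le_trans hk _; exact: ler_norm.
      rewrite sumr_const -mulrnAl; apply: ler_wpM2r; first exact: sqr_ge0.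
      have cdeg : delta * n%:R - 1 <= #|[pred k in Q | sigma <= A k j]|%:R.
        rewrite lerBlDr; apply: le_trans (hdeg j) _.
        rewrite natr1 ler_nat -(cardsID Q) -addn1; apply: leq_add.
          by apply/subset_leq_card/subsetP => k; rewrite !inE andbC.
        apply: leq_trans cQ; apply/subset_leq_card/subsetP => k.
        by rewrite !inE => /andP[].
      set u := #|_| in cdeg *; rewrite -(mulr_natr (sigma ^+ 2)).
      apply: (@le_trans _ _ (sigma ^+ 2 * (delta * n%:R / 2))).
        by have -> : sigma ^+ 2 * (delta * n%:R / 2) = 8 * b0 * n%:R by
          rewrite mulrA mulrA b0E; field.
      apply: ler_wpM2l; first exact: sqr_ge0.
      by apply: le_trans cdeg; move: dn; clear; move: (delta * n%:R) => v; lra.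
    rewrite -(mulrA 2 b0) in low; move: up low; clear.
    by move: (\sum_(k in Q) _) (b0 * n%:R) (#|I|%:R : R) => u v w; lra.
  have PZ k : k \in I ->
      fpr (prodw p) (fun v => nc (rowval cc A B z k v) <= tau) <= 1 - p0 / 12.
    rewrite inE => /andP[kQ hk].
    have := @paley_zygmund R r p0 r0 p01 _ V p cc wp nd
      (fun j => (A k j)%:C%C * z j 0) (- (B *m z) k 0) b0 b00 hk.
    apply: le_trans; apply: (le_fpr (prodw_prob _ wp)) => v.
    by rewrite /rowval opprK -tauE => hv; rewrite lerXn2r ?nnegrE ?nc_ge0 ?(ltW tau0).
  have lam2 : (1 : R) <= 2 by rewrite ler1n.
  have := fpr_few_large_rows wp b.+1 tau0 lam2 PZ.
  set PP := fpr _ _ => hPP.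
  have PP0 : 0 <= PP by exact: fpr_ge0.
  have hE : fpr (iidw p) (E i) <= PP.
    apply: (le_fpr wP) => o; rewrite /E -/z le_l2norm; last first.
      by rewrite mulr_ge0 ?sqrtr_ge0 // ltW.
    rewrite nrm2_mask exprMn (sqr_sqrtr (ltW nR)) => ho.
    apply: (@le_trans _ _ (\sum_(k in Q) nc (rowval cc A B z k (o k)) ^+ 2)).
      rewrite [leLHS]big_mkcond [leRHS]big_mkcond; apply: ler_sum => k _.
      by rewrite inE; case: (k \in Q) => //=; case: ifP => // _; exact: sqr_ge0.
    apply: (@le_trans _ _ (c1 ^+ 2 * n%:R)).
      apply: le_trans ho; rewrite le_eqVlt; apply/orP; left; apply/eqP.
      by apply: eq_bigr => k _; rewrite rowvalE.
    rewrite -c1E mulrCA; apply: ler_wpM2l; first exact: sqr_ge0.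
    by rewrite mulrC.
  apply: le_trans hE _.
  have q1 : 1 + (2 - 1) * (1 - p0 / 12) = 2 * (1 - y) by rewrite yE; ring.
  rewrite q1 exprMn in hPP.
  have y01 : 0 <= 1 - y <= 1 by move: y0 y1; clear; lra.
  have [y00 y11] := andP y01.
  have P2 : (0 : R) < 2 ^+ (#|I| - b.+1) by rewrite exprn_gt0.
  rewrite -ler_pdivlMr // in hPP; apply: le_trans hPP _; rewrite ler_pdivrMr //.
  rewrite mulrAC; apply: ler_pM; rewrite ?exprn_ge0 //.
    by rewrite -exprD; apply: ler_weXn2l; rewrite ?ler1n // -leq_subLR.
  apply: (@le_trans _ _ ((1 - y) ^+ (h1 * b))); last first.
    by rewrite exprM; apply: lerXn2r; rewrite ?nnegrE ?exprn_ge0 // divr_ge0.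
  apply: ler_wiXn2l => //; rewrite -(ler_nat R); apply: le_trans cI.
  rewrite natrM; apply: (@le_trans _ _ (b0 * D%:R * b%:R)).
    by apply: ler_wpM2r => //; rewrite mulrC -ler_pdivrMr.
  by rewrite -mulrA ler_pM2l // -natrM ler_nat.
apply: le_trans (fpr_exists_le wP EP) _.
have mle : m%:R <= 2 ^+ b.+1 * 2 ^+ b.+1 :> R.
  have lN : 0 < lam ^+ N by rewrite exprn_gt0.
  rewrite -ler_pdivlMr // in ml; apply: le_trans ml _.
  have base1 : 1 <= (1 + lam) / (1 - lam).
    by rewrite ler_pdivlMr ?subr_gt0 // mul1r; move: l0; clear; lra.
  apply: ler_pM; rewrite ?invr_ge0 ?exprn_ge0 ?(ltW l0) //.
  - by apply: le_trans base1.
  - rewrite card_prod card_ord card_bool.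
    apply: le_trans (_ : ((1 + lam) / (1 - lam)) ^+ (2 * D * b.+1) <= _).
      by apply: ler_weXn2l => //; move: nb; clear; lia.
    rewrite exprM; apply: lerXn2r; rewrite ?nnegrE ?exprn_ge0 //.
    by apply: le_trans base1.
  - rewrite -exprVn; apply: le_trans (_ : (2 ^+ Lam) ^+ N <= _).
      by rewrite lerXn2r ?nnegrE ?invr_ge0 ?exprn_ge0 ?(ltW l0).
    rewrite -exprM; apply: ler_weXn2l => //; first by rewrite ler1n.
    rewrite -(ler_nat R) natrM.
    apply: (@le_trans _ _ (Lam%:R * (1 / h ^+ 2))).
      by rewrite ler_pM2l // truncn_le divr_ge0 // sqr_ge0.
    have hE : 1 / h ^+ 2 = n%:R / (Lam%:R * D%:R).
      rewrite h2 div1r invf_div -thetaE.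
      by field; rewrite !gt_eqF.
    have -> : Lam%:R * (1 / h ^+ 2) = n%:R / D%:R by rewrite hE; field; rewrite !gt_eqF.
    by rewrite ler_pdivrMr // mulrC.
have b1 : (b.+1%:R : R) <= 2 ^+ b by rewrite -natrX ler_nat ltn_expl.
have P2 : (0 : R) < 2 ^+ b by rewrite exprn_gt0.
have b1R : (0 : R) < b.+1%:R by rewrite ltr0n.
apply: (@le_trans _ _ (8 / 2 ^+ b)).
  have cG : (#|G|%:R : R) <= 2 ^+ b.+1 * 2 ^+ b.+1.
    by apply: le_trans mle; rewrite ler_nat -[leqRHS]card_ord max_card.
  apply: (@le_trans _ _ (2 ^+ b.+1 * 2 ^+ b.+1 * (2 ^+ b.+1 * (1 / 16) ^+ b))).
    by apply: ler_wpM2r cG; rewrite mulr_ge0 ?exprn_ge0 // divr_ge0.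
  have -> : (1 / 16 : R) ^+ b = (2 ^+ b) ^- 4.
    by rewrite div1r exprVn -exprM mulnC exprM; congr ((_ ^+ _)^-1); ring.
  rewrite !exprS le_eqVlt; apply/orP; left; apply/eqP; field.
  by rewrite gt_eqF.
apply: (@le_trans _ _ (8 * D%:R / n%:R)).
  rewrite ler_pdivrMr // mulrAC ler_pdivlMr // -mulrA ler_pM2l //.
  by apply: le_trans nbR _; rewrite ler_pM2l.
rewrite ler_pdivrMr // mulrAC ler_pdivlMr //.
apply: ler_pM => //; rewrite ?mulr_ge0 ?(ltW DR) ?(ltW sn) //.
by rewrite lerDl divr_ge0 // ltW.
Qed.

End VerySparse.

(** * Increasing the sparsity *)

Section Net.
Import boot.fintype boot.finset.
Variable R : realType.
Local Notation C := R[i].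

(** The approximate kernel of the rows in [S] is covered by few cells. The
    coordinates outside [J] are rounded to a fine grid, whose cardinality is the
    only part of the count that depends on [q]. The coordinates in [J] are then
    the image by [L] of a vector of norm [O(sqrt n / q)], which is rounded to
    mesh [1 / q] at the cost of a constant to the power [n]. *)
Lemma approx_kernel_net n (M L : 'M[C]_n) (S J D : {set 'I_n}) (q kap : nat) (K F : R) :
  (0 < n)%N -> (0 < q)%N -> 0 <= K -> 0 <= F -> (1 + 2 * K) ^+ 2 + 4 <= kap%:R ->
  (forall y, L *m mask S (M *m mask J y) = mask J y) -> fro2 L <= F ->
  exists (Cell : finType) (cell : Cell -> 'cV[C]_n -> Prop),
   [/\ #|Cell|%:R <= 4 ^+ n * (4 * q%:R) ^+ (2 * #|D|) * (2 ^+ kap * 9) ^+ n :> R,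
    forall x, l2norm x = 1 -> supp x \subset J :|: D -> [disjoint J & D] ->
      (forall y, l2norm (mask S (M *m y)) <= K * Num.sqrt n%:R * l2norm y) ->
      l2norm (mask S (M *m x)) <= Num.sqrt n%:R / q%:R -> exists k, cell k x &
    forall k x x', cell k x -> cell k x' ->
      l2norm (x - x') <= (4 + 2 * Num.sqrt (2 * F)) / q%:R].
Proof.
move=> n0 q0 K0 F0 hkap LM FL.
have nR : (0 : R) < n%:R by rewrite ltr0n.
have qR : (0 : R) < q%:R by rewrite ltr0n.
have qR1 : (1 : R) <= q%:R by rewrite ler1n.
have sn : 0 < Num.sqrt (n%:R : R) by rewrite sqrtr_gt0.
have sn2 : Num.sqrt (n%:R : R) ^+ 2 = n%:R by rewrite sqr_sqrtr // ltW.
pose DD := setX D [set: bool]; pose K' := {k | k \in DD}.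
have cK' : #|{: K'}| = (2 * #|D|)%N.
  by rewrite card_sig cardsX cardsT card_bool mulnC.
pose lam1 : R := 1 - 1 / (2 * q%:R).
have lam1E : 1 / (2 * q%:R) = 1 - lam1 by rewrite /lam1; ring.
have q2 : (0 : R) < 2 * q%:R by rewrite mulr_gt0.
have ql1 : 0 < 1 / (2 * q%:R) :> R by rewrite divr_gt0.
have ql2 : 1 / (2 * q%:R) <= 1 / 2 :> R.
  by rewrite ler_pdivrMr //; move: qR1; lra.
have lam101 : 0 < lam1 < 1 by move: ql1 ql2; rewrite lam1E; lra.
have [m1 [l1 [hm1 hl1]]] := @count_int_vectors R K' (2 * q * n) lam1 lam101.
pose hf : R := 1 / 2.
have lam2 : 0 < hf < 1 by apply/andP; split; rewrite /hf; clear; lra.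
have [m2 [l2 [hm2 hl2]]] := @count_int_vectors R ('I_n * bool)%type (kap * n) hf lam2.
pose ext (a : K' -> int) (k : 'I_n * bool) : int := oapp a 0 (insub k).
pose h1 : R := (q%:R * Num.sqrt n%:R)^-1; pose h2 : R := q%:R^-1.
have h10 : 0 < h1 by rewrite invr_gt0 mulr_gt0.
have h20 : 0 < h2 by rewrite invr_gt0.
(* [wh] approximates the coordinates in [D], and [zz] is what the rows in [S]
   then see of the coordinates in [J], up to a term common to the whole cell. *)
pose wh (i : 'I_m1) : 'cV[C]_n := grid h1 (ext (l1 i)).
pose zz (i : 'I_m1) (x : 'cV[C]_n) := mask S (M *m x) - mask S (M *m (mask D x - wh i)).
pose cell (k : 'I_m1 * 'I_m2) (x : 'cV[C]_n) := [/\ x = mask J x + mask D x,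
  nrm2 (mask D x - wh k.1) <= (2 / q%:R) ^+ 2 &
  nrm2 (L *m (zz k.1 x - grid h2 (l2 k.2))) <= 2 * h2 ^+ 2 * F].
exists ('I_m1 * 'I_m2)%type, cell; split.
- rewrite card_prod !card_ord natrM; have [lp lq] := andP lam101.
  have base0 : 0 <= (1 + lam1) / (1 - lam1).
    by rewrite divr_ge0 // ?subr_ge0 ?(ltW lq) // addr_ge0 // ltW.
  apply: ler_pM => //.
    have lN : 0 < lam1 ^+ (2 * q * n) by rewrite exprn_gt0.
    rewrite -ler_pdivlMr // in hm1; apply: le_trans hm1 _.
    rewrite cK' mulrC; apply: ler_pM; rewrite ?invr_ge0 ?exprn_ge0 ?(ltW lp) ?base0 //.
    + have hb : 1 / 2 <= lam1 ^+ q.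
        apply: le_trans (bernoulli q _); last by rewrite (ltW ql1) /=; move: ql2; clear; lra.
        have -> : q%:R * (1 / (2 * q%:R)) = 1 / 2 :> R by field; rewrite gt_eqF.
        clear; lra.
      rewrite exprM (mulnC 2) exprM -exprVn; apply: lerXn2r; rewrite ?nnegrE ?invr_ge0 ?exprn_ge0 ?(ltW lp) //.
      rewrite -[leRHS]invrK lef_pV2 ?posrE ?invr_gt0 ?exprn_gt0 //.
      by move: hb; move: (lam1 ^+ q) => v; clear; nra.
    + apply: lerXn2r; rewrite ?nnegrE ?base0 //.
      rewrite -lam1E invf_div divr1 mulrC.
      have -> : 4 * q%:R = 2 * q%:R * 2 :> R by ring.
      by rewrite ler_pM2l ?mulr_gt0 //; move: lq; clear; lra.
  have e3 : (1 + hf) / (1 - hf) = 3 :> R by rewrite /hf; field.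
  rewrite e3 card_prod card_ord card_bool (mulnC n) in hm2.
  have e9 : (2 ^+ kap * 9) ^+ n = 3 ^+ (2 * n) * 2 ^+ (kap * n) :> R.
    by rewrite exprMn -exprM mulrC (exprM 3 2); congr (_ ^+ _ * _); ring.
  rewrite e9 -ler_pdivrMr ?exprn_gt0 //; apply: le_trans hm2.
  by rewrite /hf div1r exprVn.
- move=> x x1 sx dJD Mb hx.
  have xE : x = mask J x + mask D x.
    apply/colP => i; rewrite mxE !maskE.
    have [iJ|iJ] := boolP (i \in J); first by rewrite (disjointFr dJD iJ) addr0.
    have [iD|iD] := boolP (i \in D); first by rewrite add0r.
    by rewrite addr0; apply: suppPn; apply: contraNN iD => /(subsetP sx); rewrite !inE (negbTE iJ).
  have wn : nrm2 (mask D x) <= 1.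
    by rewrite -sqr_l2norm expr_le1 ?l2norm_ge0 // -x1 l2norm_mask_le.
  have [a ha] := exists_grid_coord (mask D x) h10.
  have aD k : k.1 \notin D -> a k = 0.
    move=> kD; have [+ _] := ha k; have -> : coord (mask D x) k = 0.
      by rewrite /coord !maskE (negbTE kD); case: k.2.
    by rewrite normr0 normr_le0 mulf_eq0 gt_eqF //= intr_eq0 => /eqP.
  have [i1 hi1] : exists i, forall k, l1 i k = a (val k).
    apply: (hl1 (fun k => a (val k))); rewrite -(big_sub DD (fun k => `|a k|%N)) -(ler_nat R) natr_sum.
    apply: (@le_trans _ _ (\sum_k q%:R / 2 * (n%:R * coord (mask D x) k ^+ 2 + 1))).
      rewrite [leLHS]big_mkcond /=; apply: ler_sum => k _.
      have pos : 0 <= q%:R / 2 * (n%:R * coord (mask D x) k ^+ 2 + 1).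
        apply: mulr_ge0; first by rewrite divr_ge0 // ltW.
        by rewrite addr_ge0 // mulr_ge0 ?sqr_ge0 // ltW.
      case: ifP => // _; rewrite natr_absz intr_norm.
      have [+ _] := ha k; rewrite normrM (gtr0_norm h10) /h1 ler_pdivrMl ?mulr_gt0 // => h.
      apply: le_trans h _; rewrite -[leLHS]mulrA -[leRHS]mulrA; apply: ler_wpM2l; first exact: ltW.
      have -> : n%:R * coord (mask D x) k ^+ 2 = (Num.sqrt n%:R * `|coord (mask D x) k|) ^+ 2.
        by rewrite exprMn sn2 real_normK ?num_real.
      by move: (Num.sqrt _ * _) => v; have := sqr_ge0 (v - 1); clear; lra.
    rewrite -mulr_sumr big_split /= -mulr_sumr sum_sqr_coord sumr_const card_prod card_ord card_bool.
    have -> : (1 *+ (n * 2) : R) = 2 * n%:R by rewrite natrM; ring.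
    rewrite !natrM; have -> : 2 * q%:R * n%:R = q%:R / 2 * (4 * n%:R) :> R by field.
    apply: ler_wpM2l; first by rewrite divr_ge0 // ltW.
    have : n%:R * nrm2 (mask D x) <= n%:R * 1 by rewrite ler_wpM2l // ltW.
    by move: nR; clear; move: (nrm2 _) (n%:R : R) => *; lra.
  have whE : wh i1 = grid h1 a.
    rewrite /wh; apply/colP => j; rewrite !mxE.
    have e b : ext (l1 i1) (j, b) = a (j, b).
      rewrite /ext; case: insubP => [u _ hu|jD]; first by rewrite /oapp hi1 hu.
      by rewrite aD //; move: jD; rewrite !inE andbT.
    by rewrite !e.
  have wle : nrm2 (mask D x - wh i1) <= (2 / q%:R) ^+ 2.
    rewrite whE -sum_sqr_coord; apply: (@le_trans _ _ (\sum_(k : 'I_n * bool) h1 ^+ 2)).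
      apply: ler_sum => k _; rewrite coordB coord_grid -(real_normK (num_real (_ - _))).
      by rewrite lerXn2r ?nnegrE ?(ltW h10) //; exact: (ha k).2.
    rewrite sumr_const card_prod card_ord card_bool -(mulr_natr (h1 ^+ 2)) natrM.
    rewrite /h1 exprVn exprMn sn2.
    have -> : (q%:R ^+ 2 * n%:R)^-1 * (n%:R * 2) = 2 / q%:R ^+ 2 :> R.
      by field; rewrite !gt_eqF.
    rewrite expr_div_n; apply: ler_wpM2r; first by rewrite invr_ge0 exprn_ge0 // ltW.
    by rewrite -natrX ler_nat.
  have zle : l2norm (zz i1 x) <= (1 + 2 * K) * Num.sqrt n%:R / q%:R.
    apply: le_trans (l2normB _ _) _; rewrite [leRHS]mulrAC mulrDl mul1r mulrDl.
    apply: lerD; first by rewrite mulrC.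
    apply: le_trans (Mb _) _.
    have -> : 2 * K / q%:R * Num.sqrt n%:R = K * Num.sqrt n%:R * (2 / q%:R) by ring.
    apply: ler_wpM2l; first by rewrite mulr_ge0 // ltW.
    by rewrite le_l2norm // divr_ge0 // ltW.
  have [b [hb1 hb2]] := left_inverse_rounding L (zz i1 x) h20.
  have [i2 hi2] : exists i, forall k, l2 i k = b k.
    apply: hl2; rewrite -(ler_nat R) natr_sum.
    apply: (@le_trans _ _ (\sum_k (q%:R ^+ 2 * coord (zz i1 x) k ^+ 2 + 2))).
      apply: ler_sum => k _; rewrite natr_absz intr_norm; apply: le_trans (hb1 k) _.
      have -> : q%:R ^+ 2 * coord (zz i1 x) k ^+ 2 = (`|coord (zz i1 x) k| * q%:R) ^+ 2.
        by rewrite exprMn real_normK ?num_real // mulrC.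
      rewrite /h2 invrK; move: (_ * q%:R) => v.
      by have := sqr_ge0 (v - 1); clear; nra.
    rewrite big_split /= -mulr_sumr sum_sqr_coord sumr_const card_prod card_ord card_bool.
    have -> : (2 *+ (n * 2) : R) = 4 * n%:R by rewrite -(mulr_natr 2) natrM; ring.
    rewrite natrM; apply: le_trans (ler_wpM2r (ltW nR) hkap); rewrite [leRHS]mulrDl lerD2r.
    rewrite -sqr_l2norm -exprMn.
    have -> : (1 + 2 * K) ^+ 2 * n%:R = ((1 + 2 * K) * Num.sqrt n%:R) ^+ 2 by rewrite exprMn sn2.
    have hh : 0 <= (1 + 2 * K) * Num.sqrt n%:R.
      by rewrite mulr_ge0 ?(ltW sn) // addr_ge0 // mulr_ge0.
    apply: lerXn2r; rewrite ?nnegrE; [|exact: hh|by rewrite mulrC -ler_pdivlMr].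
    by rewrite mulr_ge0 ?l2norm_ge0 // ltW.
  exists (i1, i2); split => //=.
  have -> : grid h2 (l2 i2) = grid h2 b :> 'cV[C]_n by apply/colP => j; rewrite !mxE !hi2.
  apply: le_trans hb2 _; apply: ler_wpM2l => //.
  by rewrite mulr_ge0 ?sqr_ge0.
- move=> [i1 i2] x x' [/= xE wx zx] [xE' wx' zx'].
  have wle y : nrm2 (mask D y - wh i1) <= (2 / q%:R) ^+ 2 -> l2norm (mask D y - wh i1) <= 2 / q%:R.
    by rewrite le_l2norm // divr_ge0 // ltW.
  have zle y : nrm2 (L *m (zz i1 y - grid h2 (l2 i2))) <= 2 * h2 ^+ 2 * F ->
      l2norm (L *m (zz i1 y - grid h2 (l2 i2))) <= Num.sqrt (2 * F) / q%:R.
    rewrite le_l2norm; last by rewrite divr_ge0 ?sqrtr_ge0 // ltW.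
    by move=> h; apply: le_trans h _; rewrite expr_div_n sqr_sqrtr ?mulr_ge0 // /h2 exprVn mulrAC.
  have JE y : y = mask J y + mask D y -> mask J y = L *m (zz i1 y - mask S (M *m wh i1)).
    move=> yE; rewrite -{1}(LM y); congr (L *m _).
    rewrite /zz -!maskB -!mulmxBr {2}yE.
    move: (mask J y) (mask D y) (wh i1) => u v w; congr (mask S (M *m _)).
    by apply/colP => i; rewrite !mxE; ring.
  have -> : x - x' = (mask D x - wh i1) - (mask D x' - wh i1) +
     (L *m (zz i1 x - grid h2 (l2 i2)) - L *m (zz i1 x' - grid h2 (l2 i2))).
    have -> : x - x' = (mask J x + mask D x) - (mask J x' + mask D x') by rewrite -xE -xE'.
    rewrite (JE x xE) (JE x' xE').
    move: (zz i1 x) (zz i1 x') (mask S (M *m wh i1)) (mask D x) (mask D x').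
    move: (grid _ _) (wh i1) => v1 v2 v3 v4 v5 v6 v7; rewrite !mulmxBr.
    move: (L *m v1) (L *m v3) (L *m v4) (L *m v5) => u1 u3 u4 u5.
    by apply/colP => i; rewrite !mxE; ring.
  apply: le_trans (l2normD _ _) _.
  have -> : (4 + 2 * Num.sqrt (2 * F)) / q%:R =
      (2 / q%:R + 2 / q%:R) + (Num.sqrt (2 * F) / q%:R + Num.sqrt (2 * F) / q%:R) by ring.
  apply: lerD; apply: le_trans (l2normB _ _) _; apply: lerD; [exact: wle|exact: wle|exact: zle|exact: zle].
Qed.

End Net.

Section Step.
Import boot.fintype boot.finset.
Variable R : realType.
Local Notation C := R[i].

Lemma exists_subset_card (T : finType) (A : {set T}) k : (k <= #|A|)%N ->
  exists2 B : {set T}, B \subset A & #|B| = k.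
Proof.
elim: k => [_|k IH hk]; first by exists set0; rewrite ?sub0set ?cards0.
have [B BA cB] := IH (ltnW hk).
have /subsetPn[x xA xB] : ~~ (A \subset B).
  by apply: contraL hk => /subset_leq_card; rewrite cB -leqNgt.
exists (x |: B); first by rewrite subUset sub1set xA.
by rewrite cardsU1 xB cB.
Qed.

Definition dense_rows n (A : 'M[R]_n) (sigma delta : R) (J : {set 'I_n}) : {set 'I_n} :=
  [set i | delta * #|J|%:R <= #|[set j in J | sigma <= A i j]|%:R].

(** Deterministic part of the step: an approximate null vector that is sparse,
    but not as sparse as the lower bound allows, lies in the approximate kernel
    of a set [S] of few rows on which the matrix has a bounded left inverse. *)
Definition kernel_witness n (M : 'M[C]_n) (Q S J D : {set 'I_n}) (K rho F : R) (q m : nat) :=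
  opbound M (K * Num.sqrt n%:R) /\ exists x, [/\ l2norm x = 1, supp x \subset J :|: D,
    (m < #|spread_set rho x|)%N, l2norm (mask Q (M *m x)) <= Num.sqrt n%:R / q%:R &
    exists2 L, (forall y, L *m mask S (M *m mask J y) = mask J y) & fro2 L <= F].

Lemma exists_kernel_witness n (M : 'M[C]_n) (Q : {set 'I_n}) (K theta nu c rho : R) (q : nat) :
  let m := Num.truncn (theta * n%:R) in let u := Num.truncn (nu * theta * n%:R / 8) in
  (0 < n)%N -> (0 < q)%N -> 0 < K -> 0 < theta -> 0 < nu <= 1 -> (1 + nu) * theta <= 1 ->
  48 <= nu * theta * n%:R -> 0 < c -> 0 < rho <= 1 / 2 -> K * rho <= c / 4 -> 4 / c <= q%:R ->
  (#|~: Q| <= 1)%N ->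
  ~ sparse_null M Q K theta c -> sparse_null M Q K ((1 + nu / 32) * theta) (q%:R^-1) ->
  exists S J D : {set 'I_n},
    [/\ [disjoint J & D], #|J| = m, #|S| = (m + 2 * u)%N, S \subset Q & (2 * #|D| <= u)%N] /\
    kernel_witness M Q S J D K rho (8 / (nu * c ^+ 2)) q m.
Proof.
move=> m u n0 q0 K0 th0 /andP[nu0 nu1] thnu big c0 /andP[rho0 rho1] Krho cq cQ hno [MK [x [x1 sx hx]]].
have nR : (0 : R) < n%:R by rewrite ltr0n.
have sn : 0 < Num.sqrt (n%:R : R) by rewrite sqrtr_gt0.
have qR : (0 : R) < q%:R by rewrite ltr0n.
pose t := theta * n%:R; have t0 : 0 < t by rewrite mulr_gt0.
have nt : nu * theta * n%:R = nu * t by rewrite /t mulrA.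
rewrite nt in big.
have nut : nu * t <= t by rewrite ler_piMl // ltW.
have /andP[m1 m2] : m%:R <= t < m.+1%:R by exact: truncn_itv (ltW t0).
have /andP[u1 u2] : u%:R <= nu * t / 8 < u.+1%:R.
  by rewrite -nt; apply: truncn_itv; rewrite nt divr_ge0 // mulr_ge0 // ltW.
rewrite -natr1 in m2 u2.
have tn : (1 + nu) * t <= n%:R by rewrite /t mulrA ler_piMl // ltW.
have lb y : (#|supp y| <= m)%N -> y != 0 ->
    c * Num.sqrt n%:R * l2norm y < l2norm (mask Q (M *m y)).
  move=> sy y0; rewrite ltNge; apply/negP => hy; apply: hno.
  apply: (sparse_null_scale MK y0) hy; apply: le_trans m1.
  by rewrite ler_nat.
have hq : q%:R^-1 <= c / 4.
  by rewrite -[leRHS]invf_div lef_pV2 ?posrE ?divr_gt0.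
have spr : (m < #|spread_set rho x|)%N.
  apply: (spread_of_lower_bound (Q := Q) n0 MK (ltW K0) _ lb x1 hx c0).
  - by rewrite (ltW rho0) /=; move: rho1; clear; lra.
  - have : c * rho <= c * (1 / 2) by rewrite ler_pM2l.
    by move: hq Krho; rewrite mulrBr; clear; lra.
have sprL : spread_set rho x \subset supp x.
  apply/subsetP => j; rewrite !inE => h; apply/negP => /eqP e; move: h.
  by rewrite e nc0 leNgt divr_gt0.
have [J JL cJ] := exists_subset_card (ltnW (leq_trans spr (subset_leq_card sprL))).
have cL : (#|supp x|%:R : R) <= t + nu * t / 32.
  by apply: le_trans sx _; rewrite -mulrA -/t mulrDl mul1r mulrAC.
have lbJ y : c * Num.sqrt n%:R * l2norm (mask J y) <= l2norm (mask Q (M *m mask J y)).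
  have [->|y0] := eqVneq (mask J y) 0; first by rewrite l2norm0 mulr0 l2norm_ge0.
  by apply/ltW/lb => //; rewrite -cJ subset_leq_card // supp_mask.
have cn0 : 0 < c * Num.sqrt n%:R by rewrite mulr_gt0.
have Qn : (n <= #|Q| + 1)%N.
  by rewrite -[leqLHS](card_ord n) -(cardsC Q) leq_add2l.
have u0 : (0 < u)%N by rewrite -(ltr_nat R); move: u2 big; clear; lra.
have m0 : (0 < m)%N by rewrite -(ltr_nat R); move: m2 big nut; clear; lra.
have QR : (n%:R : R) <= #|Q|%:R + 1 by rewrite natr1 ler_nat -addn1.
have sQ : (m + 2 * u <= #|Q|)%N.
  rewrite -(ler_nat R) natrD natrM.
  by move: QR tn m1 u1 big; rewrite mulrDl mul1r; clear; lra.
have sJ : (#|J| < m + 2 * u <= #|Q|)%N by rewrite cJ sQ andbT; move: u0; clear; lia.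
have [S [L [SQ cS LM fL]]] := left_inverse_select cn0 lbJ sJ.
exists S, J, (supp x :\: J); split.
  split => //.
    by rewrite disjoint_sym disjoints_subset; apply/subsetP => i; rewrite !inE => /andP[].
  rewrite -(ler_nat R) natrM cardsDS // cJ natrB ?(ltnW (leq_trans spr (subset_leq_card sprL))) //.
  by move: cL m2 u2 big; clear; lra.
split=> //; exists x; split => //.
- by apply/subsetP => i; rewrite !inE; case: (i \in J).
- by rewrite mulrC.
exists L => //; apply: le_trans fL _; rewrite cJ.
have -> : (m + 2 * u - m = 2 * u)%N by rewrite addKn.
have Qn' : ((#|Q| - m).+1 <= n)%N.
  have Qn2 : (#|Q| <= n)%N by rewrite -[leqRHS]card_ord max_card.
  apply: leq_trans Qn2; rewrite ltn_subrL m0 /=; apply: leq_trans sQ.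
  by rewrite addn_gt0 m0.
rewrite exprMn (sqr_sqrtr (ltW nR)) natrM.
have uR : (0 : R) < u%:R by rewrite ltr0n.
apply: (@le_trans _ _ (n%:R / (2 * u%:R) * (t / (c ^+ 2 * n%:R)))).
  have c2n : 0 < c ^+ 2 * n%:R by rewrite mulr_gt0 // exprn_gt0.
  have u2R : (0 : R) < 2 * u%:R by rewrite mulr_gt0.
  apply: ler_pM.
  - by rewrite divr_ge0 // ltW.
  - by rewrite divr_ge0 // ltW.
  - by rewrite ler_pM2r ?invr_gt0 // ler_nat.
  - by rewrite ler_pM2r ?invr_gt0.
have -> : n%:R / (2 * u%:R) * (t / (c ^+ 2 * n%:R)) = t / (2 * u%:R * c ^+ 2).
  by field; rewrite !gt_eqF.
rewrite ler_pdivrMr; last by rewrite !mulr_gt0 // exprn_gt0.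
have -> : 8 / (nu * c ^+ 2) * (2 * u%:R * c ^+ 2) = 16 * u%:R / nu.
  by field; rewrite !gt_eqF.
rewrite ler_pdivlMr // mulrC.
by move: u2 big; clear; lra.
Qed.

(** The random part of the step, for fixed [S], [J], [D]: the net of the
    approximate kernel of the rows in [S] is determined by these rows, and each
    of its points is rejected by the independent remaining rows. *)
Lemma fpr_kernel_witness (K rho F C1 nu theta sigma delta : R) (q kap n : nat)
    (V : finType) (p : V -> R) (cc : V -> C) (A : 'M[R]_n) B (Q S J D : {set 'I_n}) :
  let m := Num.truncn (theta * n%:R) in let u := Num.truncn (nu * theta * n%:R / 8) in
  let C3 := 4 + 2 * Num.sqrt (2 * F) in let C4 := 1 + K * C3 in
  let C5 := 4 * C4 / Num.sqrt (nu * theta) in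
  let C6 := 2 * C1 / (sigma * rho * Num.sqrt (delta * theta)) * C5 in
  (0 < n)%N -> (0 < q)%N -> 0 < K -> 0 <= F -> (1 + 2 * K) ^+ 2 + 4 <= kap%:R ->
  0 < theta -> 0 < nu <= 1 -> (1 + nu) * theta <= 1 -> 48 <= nu * theta * n%:R ->
  0 < rho -> 0 < sigma -> 0 < delta -> 0 < C1 -> C6 <= q%:R ->
  sigma * rho / Num.sqrt n%:R <= C5 / q%:R ->
  is_prob p ->
  small_ball_bound p cc C1 ->
  (#|~: Q| <= 1)%N ->
  (forall N : {set 'I_n}, Num.min n%:R ((1 + nu) * #|N|%:R) <= #|dense_rows A sigma delta N|%:R) ->
  [disjoint J & D] -> #|S| = (m + 2 * u)%N -> S \subset Q -> (2 * #|D| <= u)%N ->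
  fpr (iidw p) (fun o => kernel_witness (model_mx cc A B o) Q S J D K rho F q m) <=
  4 ^+ n * (4 * q%:R) ^+ u * (2 ^+ kap * 9) ^+ n * (2 ^+ n * (C6 / q%:R) ^+ (3 * u)).
Proof.
move=> m u C3 C4 C5 C6 n0 q0 K0 F0 hkap th0 /andP[nu0 nu1] thnu big rho0 sg0 d0 C10 C6q hs wp SB cQ hexp dJD cS SQ cD.
have nR : (0 : R) < n%:R by rewrite ltr0n.
have sn : 0 < Num.sqrt (n%:R : R) by rewrite sqrtr_gt0.
have qR : (0 : R) < q%:R by rewrite ltr0n.
have qR1 : (1 : R) <= q%:R by rewrite ler1n.
have wP := iidw_prob n wp.
have C30 : 0 < C3 by rewrite /C3 ltr_wpDr // mulr_ge0 // sqrtr_ge0.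
have C40 : 0 < C4 by rewrite /C4 addr_gt0 // mulr_gt0.
have nth0 : 0 < nu * theta by rewrite mulr_gt0.
have C50 : 0 < C5 by rewrite /C5 divr_gt0 ?sqrtr_gt0 // mulr_gt0.
have dth0 : 0 < delta * theta by rewrite mulr_gt0.
have srd0 : 0 < sigma * rho * Num.sqrt (delta * theta) by rewrite !mulr_gt0 // sqrtr_gt0.
have C60 : 0 < C6 by rewrite /C6 mulr_gt0 // divr_gt0 // mulr_gt0.
have C5E : C5 ^+ 2 * (nu * theta) = 16 * C4 ^+ 2.
  rewrite /C5 expr_div_n (sqr_sqrtr (ltW nth0)) divfK ?gt_eqF //; ring.
have C6E : C6 = 2 * C1 / (sigma * rho * Num.sqrt (delta * theta)) * C5 by [].
have C4E : C4 = 1 + K * C3 by [].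
clearbody C6 C5 C4.
pose bd : R := 4 ^+ n * (4 * q%:R) ^+ u * (2 ^+ kap * 9) ^+ n * (2 ^+ n * (C6 / q%:R) ^+ (3 * u)).
have bd0 : 0 <= bd.
  rewrite /bd !mulr_ge0 ?exprn_ge0 ?divr_ge0 ?mulr_ge0 ?exprn_ge0 ?(ltW qR) ?(ltW C60) //.
rewrite -/bd; apply: (fpr_conditional (prodw_prob _ wp) (S := S)) => f.
have Sf g y : mask S (model_mx cc A B (mix S f g) *m y) = mask S (model_mx cc A B f *m y).
  apply/colP => i; rewrite !maskE; case: ifP => // iS.
  by rewrite !rowvalE ffunE iS.
(* The left inverse, and with it the net, depends only on the rows in [S]. *)
case: (pselect (exists2 L, (forall y, L *m mask S (model_mx cc A B f *m mask J y) = mask J y) & fro2 L <= F)); last first.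
  move=> hno; apply: le_trans bd0; rewrite -[leRHS](fex_cst wP); apply: (le_fex wP) => g.
  rewrite indF // => -[_ [x [_ _ _ _ [L hL fL]]]]; apply: hno; exists L => // y.
  by rewrite -(Sf g); exact: hL.
move=> [L hL fL].
have [Cell [cell [cC hin hcell]]] := approx_kernel_net D n0 q0 (ltW K0) F0 hkap hL fL.
pose good k x := cell k x /\ (m < #|spread_set rho x|)%N.
pose G : pred Cell := fun k => `[< exists x, good k x >].
have [rep hrep] : exists rep : Cell -> 'cV[C]_n, forall k, G k -> good k (rep k).
  have h k : exists x, G k -> good k x.
    case: (pselect (exists x, good k x)) => [[x hx]|hn]; first by exists x.
    by exists 0 => /asboolP.
  by have [rep hr] := choice h; exists rep.
pose E k (g : outcome n V) := l2norm (mask Q (model_mx cc A B (mix S f g) *m rep k)) <= C4 / q%:R * Num.sqrt n%:R.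
apply: (@le_trans _ _ (fpr (iidw p) (fun g => exists2 k, G k & E k g))).
  apply: (le_fpr wP) => g [MK [x [x1 sx spx hx _]]].
  have [k ck] : exists k, cell k x.
    have hb y : l2norm (mask S (model_mx cc A B f *m y)) <= K * Num.sqrt n%:R * l2norm y.
      rewrite -(Sf g y); apply: le_trans (l2norm_mask_le S _) _; exact: MK.
    apply: (hin x x1 sx dJD hb).
    rewrite -(Sf g x); apply: le_trans (l2norm_mask_sub _ SQ) _; exact: hx.
  have Gk : G k by apply/asboolP; exists x.
  exists k => //; rewrite /E.
  have [ck' _] := hrep k Gk; have dist := hcell k _ _ ck' ck.
  rewrite -(subrK x (rep k)) mulmxDr maskD; apply: le_trans (l2normD _ _) _.
  apply: (@le_trans _ _ (K * Num.sqrt n%:R * (C3 / q%:R) + Num.sqrt n%:R / q%:R)).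
    apply: lerD => //; apply: le_trans (l2norm_mask_le _ _) _.
    apply: le_trans (MK _) _; apply: ler_wpM2l dist.
    by rewrite mulr_ge0 // ltW.
  rewrite le_eqVlt; apply/orP; left; apply/eqP; rewrite C4E; ring.
apply: le_trans (fpr_exists_le wP (b := 2 ^+ n * (C6 / q%:R) ^+ (3 * u)) _) _; last first.
  apply: ler_wpM2r.
    by rewrite mulr_ge0 ?exprn_ge0 ?divr_ge0 // ltW.
  apply: (@le_trans _ _ (#|Cell|%:R)); first by rewrite ler_nat max_card.
  apply: le_trans cC _; apply: ler_wpM2r; first by rewrite exprn_ge0 // mulr_ge0 // exprn_ge0.
  apply: ler_wpM2l; first by rewrite exprn_ge0.
  by apply: ler_weXn2l => //; move: qR1; clear; lra.
move=> k /hrep[_ spk]; set x := rep k in spk *.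
set Jx := spread_set rho x in spk.
pose tau := C5 / q%:R; have tau0 : 0 < tau by rewrite divr_gt0.
pose I := (dense_rows A sigma delta Jx :&: Q) :\: S.
have t0 : 0 < theta * n%:R by rewrite mulr_gt0.
have /andP[m1 m2] : m%:R <= theta * n%:R < m.+1%:R by exact: truncn_itv (ltW t0).
have /andP[u1 u2] : u%:R <= nu * theta * n%:R / 8 < u.+1%:R.
  by apply: truncn_itv; rewrite divr_ge0 // mulr_ge0 // ltW.
have Jx1 : theta * n%:R <= #|Jx|%:R.
  by apply/ltW/(lt_le_trans m2); rewrite ler_nat.
have cI : (4 * u <= #|I|)%N.
  have sub : dense_rows A sigma delta Jx \subset I :|: ~: Q :|: S.
    apply/subsetP => i hi; rewrite /I in_setU in_setU in_setD in_setI in_setC hi.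
    by case: (i \in S); case: (i \in Q).
  have h1 : (#|dense_rows A sigma delta Jx| <= #|I| + 1 + (m + 2 * u))%N.
    apply: leq_trans (subset_leq_card sub) _; apply: leq_trans (leq_card_setU _ _) _.
    rewrite cS leq_add2r; apply: leq_trans (leq_card_setU _ _) _.
    by rewrite leq_add2l.
  have h2 : (1 + nu) * (theta * n%:R) <= Num.min n%:R ((1 + nu) * #|Jx|%:R).
    rewrite le_min; apply/andP; split; first by rewrite mulrA ler_piMl // ltW.
    by rewrite ler_pM2l // addr_gt0.
  have h1R : (#|dense_rows A sigma delta Jx|%:R : R) <= #|I|%:R + 1 + (m%:R + 2 * u%:R).
    by rewrite addn1 in h1; rewrite -natrM -natrD natr1 -natrD ler_nat.
  have h4 := le_trans (le_trans h2 (hexp Jx)) h1R.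
  rewrite -(ler_nat R) natrM; move: u2; rewrite -natr1 => u2.
  move: h4 m1 u1 u2 big; rewrite mulrDl mul1r -(mulrA nu); clear.
  by move: (theta * _) (nu * _) => *; lra.
have rowp i : i \in I -> fpr (prodw p) (fun v => nc (rowval cc A B x i v) <= tau) <= C6 / q%:R.
  rewrite /I in_setD in_setI inE => /andP[_ /andP[hi _]].
  have h := row_small_ball A B x i SB n0 sg0 rho0 (ltW tau0).
  set N := [set j in _ | _] in hi h.
  have s00 : 0 < sigma * rho / Num.sqrt n%:R by rewrite divr_gt0 // mulr_gt0.
  set PP := fpr _ _ in h *.
  have PP0 : 0 <= PP by apply: (fpr_ge0 (prodw_prob _ wp)).
  have sN : Num.sqrt (delta * theta) * Num.sqrt n%:R <= Num.sqrt (#|N|%:R : R).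
    rewrite -sqrtrM; last exact: ltW.
    rewrite ler_sqrt ?ler0n //; apply: le_trans hi; rewrite -mulrA.
    by rewrite ler_pM2l.
  have ts : 1 <= tau / (sigma * rho / Num.sqrt n%:R) by rewrite ler_pdivlMr // mul1r.
  have h5 : PP * (Num.sqrt (delta * theta) * Num.sqrt n%:R) <=
      C1 * (2 * (tau / (sigma * rho / Num.sqrt n%:R))).
    apply: le_trans (ler_wpM2l PP0 sN) _; apply: le_trans h _.
    by rewrite ler_pM2l //; move: ts; clear; lra.
  have sdn : 0 < Num.sqrt (delta * theta) * Num.sqrt n%:R by rewrite mulr_gt0 // sqrtr_gt0.
  rewrite -ler_pdivlMr // in h5; apply: le_trans h5 _.
  rewrite le_eqVlt; apply/orP; left; apply/eqP; rewrite C6E /tau.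
  by field; rewrite !gt_eqF // ?sqrtr_gt0 // mulr_gt0.
have lam1 : 1 <= q%:R / C6 by rewrite ler_pdivlMr // mul1r.
have tauE : C4 ^+ 2 * n%:R <= (u%:R * tau ^+ 2) * q%:R ^+ 2.
  have -> : u%:R * tau ^+ 2 * q%:R ^+ 2 = u%:R * C5 ^+ 2.
    by rewrite /tau expr_div_n -mulrA divfK // expf_neq0 // gt_eqF.
  rewrite -(ler_pM2r nth0) -[leRHS]mulrA C5E.
  have -> : C4 ^+ 2 * n%:R * (nu * theta) = C4 ^+ 2 * (nu * theta * n%:R) by ring.
  have -> : u%:R * (16 * C4 ^+ 2) = C4 ^+ 2 * (16 * u%:R) by ring.
  apply: ler_wpM2l; first exact: sqr_ge0.
  move: u2 big; rewrite -[u.+1%:R]natr1; move: (u%:R : R) (nu * theta * n%:R); clear.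
  by move=> *; lra.
have hfew := fpr_few_large_rows wp u tau0 lam1 rowp.
set PP := fpr _ _ in hfew.
have PP0 : 0 <= PP by exact: fpr_ge0.
have hE : fpr (iidw p) (E k) <= PP.
  apply: (le_fpr wP) => g; rewrite /E -/x le_l2norm; last first.
    by rewrite mulr_ge0 ?sqrtr_ge0 // divr_ge0 // ltW.
  rewrite nrm2_mask exprMn (sqr_sqrtr (ltW nR)) => hg.
  apply: (@le_trans _ _ (\sum_(i in Q) nc ((model_mx cc A B (mix S f g) *m x) i 0) ^+ 2)).
    rewrite [leLHS]big_mkcond [leRHS]big_mkcond; apply: ler_sum => i _.
    rewrite /I in_setD in_setI; have [iS|iS] /= := boolP (i \in S).
      by case: ifP => // _; exact: sqr_ge0.
    rewrite (rowval_mix _ _ _ _ _ _ iS); case: (i \in Q); rewrite ?andbF ?andbT //.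
    by case: ifP => // _; exact: sqr_ge0.
  apply: le_trans hg _; rewrite expr_div_n mulrAC ler_pdivrMr ?exprn_gt0 //.
apply: le_trans hE _.
have q6 : 0 < C6 / q%:R by rewrite divr_gt0.
have q61 : C6 / q%:R <= 1 by rewrite ler_pdivrMr // mul1r.
have lamE : q%:R / C6 = (C6 / q%:R)^-1 by rewrite invf_div.
rewrite lamE in hfew.
have h6 : 1 + ((C6 / q%:R)^-1 - 1) * (C6 / q%:R) <= 2.
  by rewrite mulrBl mulVf ?gt_eqF // mul1r; move: q6; clear; lra.
have h7 : 0 <= 1 + ((C6 / q%:R)^-1 - 1) * (C6 / q%:R).
  by rewrite mulrBl mulVf ?gt_eqF // mul1r; move: q61; clear; lra.
have h8 : PP * (C6 / q%:R)^-1 ^+ (#|I| - u) <= 2 ^+ n.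
  apply: le_trans hfew _; apply: (@le_trans _ _ (2 ^+ #|I|)).
    by apply: lerXn2r; rewrite ?nnegrE.
  apply: ler_weXn2l; first by rewrite ler1n.
  by rewrite -[leqRHS]card_ord max_card.
rewrite exprVn -ler_pdivlMr ?invr_gt0 ?exprn_gt0 // invrK in h8.
apply: le_trans h8 _; apply: ler_wpM2l; first by rewrite exprn_ge0.
apply: ler_wiXn2l => //; first exact: ltW.
by move: cI; clear; move: #|I| => ?; lia.
Qed.

End Step.
Section Compressible.
Import boot.fintype boot.finset.
Variable R : realType.
Local Notation C := R[i].

Lemma card_sets (T : finType) : (#|{set T}|%:R : R) = 2 ^+ #|T|.
Proof. by rewrite -[RHS]mulr1 -sum_cst_sets sumr_const. Qed.

Definition expanding n (A : 'M[R]_n) (sigma delta nu : R) :=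
  forall N : {set 'I_n}, Num.min n%:R ((1 + nu) * #|N|%:R) <= #|dense_rows A sigma delta N|%:R.

(** The union bound over the triples [(S, J, D)] costs [8 ^ n]. With the net and
    the rejection by [4 u] rows, of which [u] may fail, the total is
    [G ^ n * (4 C6 ^ 3 / q ^ 2) ^ u]: each row gains a factor [1 / q] and the net
    loses only [q ^ u]. As [u] is at least a fixed proportion of [n], choosing
    [q] large makes this exponentially small. *)
Lemma sparsity_step (K delta sigma nu r p0 theta c : R) : 0 < K -> 0 < delta ->
  0 < sigma -> 0 < nu <= 1 -> 0 < r -> 0 < p0 <= 1 -> 0 < theta ->
  (1 + nu) * theta <= 1 -> 0 < c ->
  exists c' C0, [/\ 0 < c', 0 < C0 &
  forall n (V : finType) (p : V -> R) (cc : V -> C) (A : 'M[R]_n) B (Q : {set 'I_n}),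
  (0 < n)%N -> is_prob p -> nondegenerate p cc r p0 -> (#|~: Q| <= 1)%N ->
  expanding A sigma delta nu ->
  fpr (iidw p) (fun o => ~ sparse_null (model_mx cc A B o) Q K theta c /\
      sparse_null (model_mx cc A B o) Q K ((1 + nu / 32) * theta) c') <= C0 / Num.sqrt n%:R].
Proof.
move=> K0 d0 sg0 nu01 r0 p01 th0 thnu c0; have /andP[nu0 nu1] := nu01.
have [C1 C10 SB] := small_ball r0 p01.
pose rho := Num.min (1 / 2) (c / (4 * K)).
have rho0 : 0 < rho by rewrite lt_min divr_gt0 //= divr_gt0 // mulr_gt0.
have rho1 : rho <= 1 / 2 by rewrite ge_min lexx.
have Krho : K * rho <= c / 4.
  have : rho <= c / (4 * K) by rewrite ge_min lexx orbT.
  by rewrite ler_pdivlMr ?mulr_gt0 //; clear; lra.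
clearbody rho.
pose F := 8 / (nu * c ^+ 2).
have F0 : 0 <= F by rewrite divr_ge0 // mulr_ge0 ?sqr_ge0 // ltW.
have [kap kap0 hkap] := exists_nat_ge ((1 + 2 * K) ^+ 2 + 4).
pose C3 := 4 + 2 * Num.sqrt (2 * F); pose C4 := 1 + K * C3.
have C30 : 0 < C3 by rewrite /C3 ltr_wpDr // mulr_ge0 // sqrtr_ge0.
have C40 : 0 < C4 by rewrite /C4 addr_gt0 // mulr_gt0.
pose C5 := 4 * C4 / Num.sqrt (nu * theta).
have C50 : 0 < C5 by rewrite /C5 divr_gt0 ?sqrtr_gt0 ?mulr_gt0.
pose C6 := 2 * C1 / (sigma * rho * Num.sqrt (delta * theta)) * C5.
have C60 : 0 < C6 by rewrite /C6 !mulr_gt0 ?invr_gt0 ?mulr_gt0 ?sqrtr_gt0 ?mulr_gt0.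
pose G : R := 8 * 4 * (2 ^+ kap * 9) * 2.
have G1 : 1 <= G.
  have : 1 <= 2 ^+ kap :> R by rewrite exprn_ege1 // ler1n.
  by rewrite /G; clear; lra.
have [h1 h10 hh1] := exists_nat_ge (16 / (nu * theta)).
have [q q0 hq] := exists_nat_ge (4 / c + (2 * G) ^+ h1 + 4 * C6 ^+ 3 + C6).
have qR : (0 : R) < q%:R by rewrite ltr0n.
have g0 : 0 <= (2 * G) ^+ h1 by rewrite exprn_ge0 // mulr_ge0 // (le_trans _ G1).
have c60 : 0 <= 4 * C6 ^+ 3 by rewrite mulr_ge0 // exprn_ge0 // ltW.
have c40 : 0 <= 4 / c by rewrite divr_ge0 // ltW.
have [q1 q2 q3 q4] : [/\ 4 / c <= q%:R, (2 * G) ^+ h1 <= q%:R, 4 * C6 ^+ 3 <= q%:R & C6 <= q%:R].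
  by move: hq g0 c60 c40 (ltW C60); clear; move: (4 / c) (_ ^+ h1) (_ * _) => *; split; lra.
(* For [n] at most [n0] the bound on the probability exceeds one. *)
pose n0 := 48 / (nu * theta) + (sigma * rho * q%:R / C5) ^+ 2.
have nth0 : 0 < nu * theta by rewrite mulr_gt0.
have n00 : 0 <= n0 by rewrite addr_ge0 ?sqr_ge0 // divr_ge0 // ltW.
exists (q%:R^-1), (1 + n0); split; first by rewrite invr_gt0.
  by rewrite ltr_wpDr.
move=> n V p cc A B Q npos wp nd cQ hexp.
have nR : (0 : R) < n%:R by rewrite ltr0n.
have sn : 0 < Num.sqrt (n%:R : R) by rewrite sqrtr_gt0.
have wP := iidw_prob n wp.
have snn := sqrt_natr_le R npos.
have [nn0|nn0] := leP n%:R n0.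
  apply: le_trans (fpr_le1 wP _) _; rewrite ler_pdivlMr // mul1r.
  by apply: le_trans snn _; apply: le_trans nn0 _; rewrite lerDr.
have big : 48 <= nu * theta * n%:R.
  rewrite mulrC -ler_pdivrMr //; apply/ltW/(le_lt_trans _ nn0).
  by rewrite /n0 lerDl sqr_ge0.
have hs : sigma * rho / Num.sqrt n%:R <= C5 / q%:R.
  rewrite ler_pdivrMr // mulrAC ler_pdivlMr // -ler_pdivrMl // mulrC.
  rewrite -(ler_pXn2r (n := 2)) ?nnegrE ?(ltW sn) //; last first.
    by rewrite divr_ge0 ?mulr_ge0 // ltW.
  rewrite (sqr_sqrtr (ltW nR)); apply/ltW/(le_lt_trans _ nn0).
  by rewrite /n0 lerDr divr_ge0 // ltW.
pose m := Num.truncn (theta * n%:R); pose u := Num.truncn (nu * theta * n%:R / 8).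
pose T := ({set 'I_n} * {set 'I_n} * {set 'I_n})%type.
pose good : pred T := fun t => [&& [disjoint t.1.2 & t.2], #|t.1.1| == (m + 2 * u)%N,
  t.1.1 \subset Q & (2 * #|t.2| <= u)%N].
pose bd : R := 4 ^+ n * (4 * q%:R) ^+ u * (2 ^+ kap * 9) ^+ n * (2 ^+ n * (C6 / q%:R) ^+ (3 * u)).
apply: (@le_trans _ _ (fpr (iidw p) (fun o => exists2 t : T, good t &
    kernel_witness (model_mx cc A B o) Q t.1.1 t.1.2 t.2 K rho F q m))).
  apply: (le_fpr wP) => o [hno hsn].
  have rho01 : 0 < rho <= 1 / 2 by rewrite rho0.
  have [S [J [D [[dJ cJ cS SQ cD] hw]]]] :=
    exists_kernel_witness npos q0 K0 th0 nu01 thnu big c0 rho01 Krho q1 cQ hno hsn.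
  by exists (S, J, D) => //; rewrite /good /= dJ cS eqxx SQ cD.
apply: le_trans (fpr_exists_le wP (b := bd) _) _.
  move=> [[S J] D] /= /and4P[dJ /eqP cS SQ cD].
  exact: (@fpr_kernel_witness R K rho F C1 nu theta sigma delta q kap n V p cc A B Q S J D
    npos q0 K0 F0 hkap th0 nu01 thnu big rho0 sg0 d0 C10 q4 hs wp
    (SB _ p cc wp nd) cQ hexp dJ cS SQ cD).
have cT : (#|good|%:R : R) <= 8 ^+ n.
  apply: (@le_trans _ _ (#|{: T}|%:R)); first by rewrite ler_nat max_card.
  rewrite !card_prod !natrM card_sets card_ord -!exprMn.
  by rewrite le_eqVlt; apply/orP; left; apply/eqP; congr (_ ^+ _); ring.
have bd0 : 0 <= bd.
  have c6q : 0 <= C6 / q%:R by rewrite divr_ge0 // ltW.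
  apply: mulr_ge0; last by apply: mulr_ge0; apply: exprn_ge0.
  apply: mulr_ge0; last by apply: exprn_ge0; rewrite mulr_ge0 // exprn_ge0.
  by apply: mulr_ge0; apply: exprn_ge0 => //; rewrite mulr_ge0 // ltW.
apply: le_trans (ler_wpM2r bd0 cT) _.
have bdE : 8 ^+ n * bd = G ^+ n * (4 * C6 ^+ 3 / q%:R ^+ 2) ^+ u.
  have -> : (4 * C6 ^+ 3 / q%:R ^+ 2) ^+ u = (4 * q%:R) ^+ u * (C6 / q%:R) ^+ (3 * u).
    by rewrite exprM -exprMn; congr (_ ^+ _); field; rewrite gt_eqF.
  by rewrite /bd /G !exprMn; ring.
rewrite bdE; clear bdE; clearbody G.
have G0 : 0 < G by exact: lt_le_trans G1.
have uh : (n <= h1 * u)%N.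
  rewrite -(ler_nat R) natrM; rewrite ler_pdivrMr // in hh1.
  have /andP[_ u2] : u%:R <= nu * theta * n%:R / 8 < u.+1%:R.
    by apply: truncn_itv; rewrite divr_ge0 // mulr_ge0 // ltW.
  rewrite -[u.+1%:R]natr1 in u2.
  have u3 : nu * theta * n%:R <= 16 * u%:R.
    by move: u2 big; move: (u%:R : R) (nu * theta * n%:R); clear; move=> *; lra.
  rewrite -(ler_pM2l (_ : (0 : R) < 16)) //; apply: (@le_trans _ _ (h1%:R * (nu * theta) * n%:R)).
    by rewrite ler_pM2r.
  rewrite -mulrA [leRHS]mulrCA ler_pM2l ?ltr0n //.
have h5 : (4 * C6 ^+ 3 / q%:R ^+ 2) ^+ u <= (2 * G) ^- n.
  apply: (@le_trans _ _ (q%:R^-1 ^+ u)).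
    apply: lerXn2r; rewrite ?nnegrE ?invr_ge0 ?ler0n //.
      by rewrite divr_ge0 ?exprn_ge0 // ltW.
    rewrite ler_pdivrMr ?exprn_gt0 //.
    have -> // : q%:R^-1 * q%:R ^+ 2 = q%:R :> R by field; rewrite gt_eqF.
  rewrite exprVn lef_pV2 ?posrE ?exprn_gt0 ?mulr_gt0 //.
  apply: (@le_trans _ _ (((2 * G) ^+ h1) ^+ u)).
    rewrite -exprM; apply: ler_weXn2l uh.
    by move: G1; clear; lra.
  by apply: lerXn2r; rewrite ?nnegrE ?ler0n.
have Gn : 0 <= G ^+ n by rewrite exprn_ge0 // ltW.
apply: le_trans (ler_wpM2l Gn h5) _.
have -> : G ^+ n * (2 * G) ^- n = 2 ^- n.
  by rewrite exprMn; field; rewrite !expf_neq0 // gt_eqF.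
apply: (@le_trans _ _ (1 / Num.sqrt n%:R)).
  rewrite div1r lef_pV2 ?posrE ?exprn_gt0 //; apply: le_trans snn _.
  by rewrite -natrX ler_nat ltnW // ltn_expl.
by rewrite ler_pM2r ?invr_gt0 // lerDl.
Qed.

Lemma sparse_null_le n (M : 'M[C]_n) Q K theta theta' c : theta <= theta' ->
  sparse_null M Q K theta c -> sparse_null M Q K theta' c.
Proof.
move=> tt [MK [x [x1 sx hx]]]; split=> //; exists x; split=> //.
by apply: le_trans sx _; rewrite ler_wpM2r.
Qed.

Lemma expanding_le n (A : 'M[R]_n) sigma delta nu nu' : nu' <= nu ->
  expanding A sigma delta nu -> expanding A sigma delta nu'.
Proof.
move=> nn h N; apply: le_trans (h N); rewrite le_min !ge_min lexx /=.
by rewrite ler_wpM2r ?orbT // lerD2l.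
Qed.

(** Starting from a small proportion of nonzero coordinates, a number of steps
    that depends only on the parameters reaches the proportion [1 - delta / 2].
    Replacing [nu] by at most [delta / 2] keeps [(1 + nu) * theta <= 1] all
    along. *)
Lemma compressible_bound (K delta sigma nu r p0 : R) : 0 < K -> 0 < delta < 1 ->
  0 < sigma -> 0 < nu -> 0 < r -> 0 < p0 <= 1 ->
  exists c C0, [/\ 0 < c, 0 < C0 &
  forall n (V : finType) (p : V -> R) (cc : V -> C) (A : 'M[R]_n) B (Q : {set 'I_n}),
  (0 < n)%N -> is_prob p -> nondegenerate p cc r p0 ->
  (forall i j, 0 <= A i j <= 1) ->
  (forall j, delta * n%:R <= #|[set i | sigma <= A i j]|%:R) ->
  (#|~: Q| <= 1)%N -> expanding A sigma delta nu ->
  fpr (iidw p) (fun o => sparse_null (model_mx cc A B o) Q K (1 - delta / 2) c)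
  <= C0 / Num.sqrt n%:R].
Proof.
move=> K0 /andP[d0 d1] sg0 nu0 r0 p01.
pose nu' := Num.min nu (delta / 2).
have nu'0 : 0 < nu' by rewrite lt_min nu0 divr_gt0.
have nu'd : nu' <= delta / 2 by rewrite ge_min lexx orbT.
have nu'nu : nu' <= nu by rewrite ge_min lexx.
clearbody nu'.
have nu'1 : 0 < nu' <= 1 by rewrite nu'0 /=; move: nu'd d1; clear; lra.
pose ths := 1 - delta / 2.
have ths0 : 0 < ths by rewrite /ths; move: d1; clear; lra.
have thsnu : (1 + nu') * ths <= 1.
  apply: (@le_trans _ _ ((1 + delta / 2) * ths)); first by rewrite ler_pM2r // lerD2l.
  by rewrite /ths; have := sqr_ge0 delta; clear; lra.
have [th0 [c0 [C0 [th00 c00 C00 base]]]] := very_sparse_bound K0 d0 sg0 r0 p01.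
pose P theta := exists c C0, [/\ 0 < c, 0 < C0 &
  forall n (V : finType) (p : V -> R) (cc : V -> C) (A : 'M[R]_n) B (Q : {set 'I_n}),
  (0 < n)%N -> is_prob p -> nondegenerate p cc r p0 ->
  (forall i j, 0 <= A i j <= 1) ->
  (forall j, delta * n%:R <= #|[set i | sigma <= A i j]|%:R) ->
  (#|~: Q| <= 1)%N -> expanding A sigma delta nu ->
  fpr (iidw p) (fun o => sparse_null (model_mx cc A B o) Q K theta c) <= C0 / Num.sqrt n%:R].
have Ple theta theta' : theta <= theta' -> P theta' -> P theta.
  move=> tt [c [C1 [cp Cp h]]]; exists c, C1; split=> // n V p cc A B Q n0 wp nd A01 hd cQ hx.
  apply: le_trans (h n V p cc A B Q n0 wp nd A01 hd cQ hx).
  by apply: (le_fpr (iidw_prob n wp)) => o; exact: sparse_null_le.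
pose g := 1 + nu' / 32.
have step theta : 0 < theta -> theta <= ths -> P theta -> P (g * theta).
  move=> t0 tt [c [C1 [cp Cp h]]].
  have tnu : (1 + nu') * theta <= 1.
    by apply: le_trans thsnu; rewrite ler_pM2l // addr_gt0.
  have [c' [C2 [c'0 C20 h']]] := sparsity_step K0 d0 sg0 nu'1 r0 p01 t0 tnu cp.
  exists c', (C1 + C2); split; rewrite ?addr_gt0 // => n V p cc A B Q n0 wp nd A01 hd cQ hx.
  have wP := iidw_prob n wp.
  rewrite [leRHS]mulrDl; apply: le_trans _ (lerD (h n V p cc A B Q n0 wp nd A01 hd cQ hx)
    (h' n V p cc A B Q n0 wp nd cQ (expanding_le nu'nu hx))).
  apply: le_trans _ (fprU wP _ _); apply: (le_fpr wP) => o ho.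
  by case: (pselect (sparse_null (model_mx cc A B o) Q K theta c)); [left|right].
have Pk k : P (Num.min ths (g ^+ k * th0)).
  elim: k => [|k IH].
    apply: (Ple _ th0); first by rewrite expr0 mul1r ge_min lexx orbT.
    exists c0, C0; split=> // n V p cc A B Q n0 wp nd A01 hd cQ _.
    exact: base.
  have g0 : 0 < g by rewrite addr_gt0 // divr_gt0.
  have g1 : 1 <= g by rewrite lerDl divr_ge0 // ltW.
  case: (leP ths (g ^+ k * th0)) IH => hk IH.
    suff -> : Num.min ths (g ^+ k.+1 * th0) = ths by [].
    apply/min_idPl; apply: le_trans hk _; rewrite exprS -mulrA ler_peMl //.
    by rewrite mulr_ge0 ?exprn_ge0 // ltW.
  apply: (Ple _ (g * (g ^+ k * th0))); first by rewrite exprS mulrA ge_min lexx orbT.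
  apply: step => //; last exact: ltW.
  by rewrite mulr_gt0 // exprn_gt0.
have [k k0 hk] := exists_nat_ge (ths / th0 * 32 / nu').
have := Pk k; suff -> : Num.min ths (g ^+ k * th0) = ths by [].
apply/min_idPl; rewrite -ler_pdivrMr //.
have bern j : 1 + j%:R * (nu' / 32) <= g ^+ j.
  elim: j => [|j IH]; first by rewrite mul0r addr0 expr0.
  have x0 : 0 <= nu' / 32 by rewrite divr_ge0 // ltW.
  rewrite exprS; apply: (@le_trans _ _ (g * (1 + j%:R * (nu' / 32)))); last first.
    by rewrite ler_wpM2l // addr_ge0.
  rewrite -natr1 /g; have : 0 <= j%:R * (nu' / 32) * (nu' / 32).
    by apply: mulr_ge0 => //; apply: mulr_ge0.
  by move: (nu' / 32) (j%:R : R); clear; move=> x y; lra.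
apply: le_trans (bern k); apply: le_trans (_ : k%:R * (nu' / 32) <= _); last by rewrite lerDr.
by rewrite mulrA ler_pdivlMr // -ler_pdivrMr.
Qed.

End Compressible.

(** * The smallest singular value in the finite model *)

Section FiniteModel.
Import boot.fintype boot.finset.
Variable R : realType.
Local Notation C := R[i].

Lemma conj_l2norm n (x : 'cV[C]_n) : l2norm (map_mx Num.conj x) = l2norm x.
Proof. by congr Num.sqrt; apply: eq_bigr => i _; rewrite mxE nc_conj. Qed.

Lemma dot_conj n (x : 'cV[C]_n) : \sum_i (map_mx Num.conj x) i 0 * x i 0 = ((nrm2 x)%:C)%C.
Proof. by rewrite rmorph_sum; apply: eq_bigr => i _; rewrite mxE mulrC mul_conj. Qed.

Lemma dot_tr n (M : 'M[C]_n) (u x : 'cV[C]_n) :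
  \sum_i (M^T *m u) i 0 * x i 0 = \sum_i u i 0 * (M *m x) i 0.
Proof.
transitivity ((u^T *m M *m x) 0 0).
  by rewrite -[u^T *m M]trmxK trmx_mul trmxK !mxE; apply: eq_bigr => i _; rewrite !mxE.
by rewrite -mulmxA mxE; apply: eq_bigr => i _; rewrite mxE.
Qed.

(** When [M] is invertible, the image of the conjugate of [x] by the inverse of
    [M^T] has norm at least [1 / a], since its product with [M x] is one. *)
Lemma small_transpose n (M : 'M[C]_n) x a : 0 <= a -> l2norm x = 1 ->
  l2norm (M *m x) <= a -> exists2 u, l2norm u = 1 & l2norm (M^T *m u) <= a.
Proof.
move=> a0 x1 hx.
suff [u u0 hu] : exists2 u, u != 0 & l2norm (M^T *m u) <= a * l2norm u.
  have ul : 0 < l2norm u by rewrite l2norm_gt0.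
  exists ((((l2norm u)^-1)%:C)%C *: u); first by rewrite l2normZ nc_inv_l2norm mulVf // gt_eqF.
  by rewrite -scalemxAr l2normZ nc_inv_l2norm ler_pdivrMl // mulrC.
have [Mu|Mu] := boolP (M \in unitmx); last first.
  have : kermx M != 0 by rewrite kermx_eq0 row_free_unit.
  move=> /rowV0Pn[v /sub_kermxP vM v0]; exists v^T; first by rewrite trmx_eq0.
  by rewrite -trmx_mul vM trmx0 l2norm0 mulr_ge0 // l2norm_ge0.
have MuT : M^T \in unitmx by rewrite unitmx_tr.
pose u := invmx M^T *m map_mx Num.conj x.
have Mue : M^T *m u = map_mx Num.conj x by rewrite /u mulKVmx.
have lu : 1 <= a * l2norm u.
  have := dot_tr M u x; rewrite Mue dot_conj -sqr_l2norm x1 expr1n => e.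
  have : 1 = nc (\sum_i u i 0 * (M *m x) i 0) by rewrite -e nc_real normr1.
  move=> ->; apply: le_trans (nc_dot_le _ _) _; rewrite mulrC.
  by rewrite ler_wpM2r // l2norm_ge0.
exists u; last by rewrite Mue conj_l2norm x1.
by apply/negP => /eqP u0; move: lu; rewrite u0 l2norm0 mulr0 ler10.
Qed.

Lemma opbound_tr n (M : 'M[C]_n) b : 0 <= b -> opbound M b -> opbound M^T b.
Proof.
move=> b0 Mb u; set y := M^T *m u.
have [y0|y0] := eqVneq (l2norm y) 0; first by rewrite y0 mulr_ge0 // l2norm_ge0.
have yp : 0 < l2norm y by rewrite lt0r y0 l2norm_ge0.
rewrite -(ler_pM2r yp) -expr2 sqr_l2norm.
have := dot_tr M u (map_mx Num.conj y); rewrite -/y.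
have -> : \sum_i y i 0 * (map_mx Num.conj y) i 0 = ((nrm2 y)%:C)%C.
  by rewrite -dot_conj; apply: eq_bigr => i _; rewrite mulrC.
move=> e; have e2 : nrm2 y = nc (((nrm2 y)%:C)%C) by rewrite nc_real ger0_norm // nrm2_ge0.
rewrite e2 e; apply: le_trans (nc_dot_le _ _) _.
rewrite (mulrC b) -mulrA; apply: ler_wpM2l; first exact: l2norm_ge0.
by apply: le_trans (Mb _) _; rewrite conj_l2norm.
Qed.

Definition tr_outcome n (V : finType) (o : outcome n V) : outcome n V :=
  [ffun i => [ffun j => o j i]].

Lemma model_mx_tr n (V : finType) (cc : V -> C) (A : 'M[R]_n) B (o : outcome n V) :
  (model_mx cc A B o)^T = model_mx cc A^T B^T (tr_outcome o).
Proof. by apply/matrixP => i j; rewrite !mxE !ffunE. Qed.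

Lemma fpr_tr n (V : finType) (p : V -> R) (E : outcome n V -> Prop) :
  fpr (iidw p) (fun o => E (tr_outcome o)) = fpr (iidw p) E.
Proof.
have trK : involutive (@tr_outcome n V).
  by move=> o; apply/ffunP => i; apply/ffunP => j; rewrite !ffunE.
rewrite /fpr /fex [RHS](reindex_inj (inv_inj trK)) /=; apply: eq_bigr => o _.
congr (_ * _); rewrite /iidw /prodw exchange_big /=.
by apply: eq_bigr => i _; apply: eq_bigr => j _; rewrite !ffunE.
Qed.

Lemma le_fpr_tr n (V : finType) (p : V -> R) (E F : outcome n V -> Prop) : is_prob p ->
  (forall o, E o -> F (tr_outcome o)) -> fpr (iidw p) E <= fpr (iidw p) F.
Proof. by move=> wp EF; rewrite -[leRHS]fpr_tr; apply: (le_fpr (iidw_prob n wp)). Qed.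

(** The other rows leave a nonzero orthogonal direction. *)
Lemma exists_normal n (M : 'M[C]_n) (i : 'I_n) :
  exists2 x, l2norm x = 1 & mask [set~ i] (M *m x) = 0.
Proof.
pose N := selmx R [set~ i] *m M.
have : N \notin unitmx.
  apply/negP => Nu; have : row i (N *m invmx N) = 0.
    by rewrite row_mul; apply/rowP => j; rewrite mxE big1 ?mxE // => k _;
      rewrite mxE mul_selmx !inE eqxx mul0r mul0r.
  rewrite mulmxV // row1 => /rowP /(_ i); rewrite !mxE !eqxx => /eqP.
  by rewrite oner_eq0.
rewrite -unitmx_tr -row_free_unit -kermx_eq0 => /rowV0Pn[v /sub_kermxP vN v0].
have vl : 0 < l2norm v^T by rewrite l2norm_gt0 trmx_eq0.
exists ((((l2norm v^T)^-1)%:C)%C *: v^T); first by rewrite l2normZ nc_inv_l2norm mulVf // gt_eqF.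
rewrite -scalemxAr maskZ -selmx_mask mulmxA -/N -[N]trmxK -trmx_mul vN trmx0 scaler0 //.
Qed.

End FiniteModel.

Section FiniteMain.
Import boot.fintype boot.finset.
Variable R : realType.
Local Notation C := R[i].

(** By duality the second condition says that the [i]-th row of [M] is at distance
    at most [tau] from the span of the others. *)
Definition close_row n (M : 'M[C]_n) (K tau : R) (i : 'I_n) :=
  opbound M (K * Num.sqrt n%:R) /\
  forall x, l2norm x = 1 -> mask [set~ i] (M *m x) = 0 -> nc ((M *m x) i 0) <= tau.

(** An approximate left null vector [u] expresses the [i]-th row, up to a small
    error, through the others as soon as its [i]-th coordinate is not small. *)
Lemma close_row_of_left_null n (M : 'M[C]_n) K rho t u i : (0 < n)%N -> 0 < rho ->
  opbound M (K * Num.sqrt n%:R) -> l2norm (M^T *m u) <= t / Num.sqrt n%:R ->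
  i \in spread_set rho u -> close_row M K (t / rho) i.
Proof.
move=> n0 rho0 MK hu; rewrite inE => hi; split=> // x x1 Mx.
have sn : 0 < Num.sqrt (n%:R : R) by rewrite sqrtr_gt0 ltr0n.
have := dot_tr M u x; rewrite [RHS](bigD1 i) //= [X in _ + X]big1 ?addr0 => [e|k ki]; last first.
  have kQ : k \in [set~ i] by rewrite in_setC1.
  by have /colP /(_ k) := Mx; rewrite maskE kQ => ->; rewrite mxE mulr0.
have h1 : nc (u i 0) * nc ((M *m x) i 0) <= t / Num.sqrt n%:R.
  rewrite -ncM -e; apply: le_trans (nc_dot_le _ _) _.
  by rewrite x1 mulr1.
have h2 : rho / Num.sqrt n%:R * nc ((M *m x) i 0) <= t / Num.sqrt n%:R.
  by apply: le_trans h1; rewrite ler_wpM2r // nc_ge0.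
rewrite mulrAC ler_pM2r ?invr_gt0 // in h2.
by rewrite ler_pdivlMr // mulrC.
Qed.

(** The unit normal [x] to the rows other than the [i]-th is determined by these
    rows. By the bound on compressible vectors it has more than
    [(1 - delta / 2) n] coordinates of order [1 / sqrt n], and the [i]-th row has
    at least [delta n] large standard deviations, so at least [delta n / 2]
    terms of the product of this independent row with [x] are of order
    [1 / sqrt n]. *)
Lemma fpr_close_row (K delta sigma nu r p0 : R) : 0 < K -> 0 < delta < 1 ->
  0 < sigma -> 0 < nu -> 0 < r -> 0 < p0 <= 1 ->
  exists2 C0, 0 < C0 &
  forall n (V : finType) (p : V -> R) (cc : V -> C) (A : 'M[R]_n) B,
  (0 < n)%N -> is_prob p -> nondegenerate p cc r p0 ->
  (forall i j, 0 <= A i j <= 1) ->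
  (forall i, delta * n%:R <= #|[set j | sigma <= A i j]|%:R) ->
  (forall j, delta * n%:R <= #|[set i | sigma <= A i j]|%:R) ->
  expanding A sigma delta nu ->
  forall i tau, 0 <= tau ->
  fpr (iidw p) (fun o => close_row (model_mx cc A B o) K tau i) <= C0 * (tau + 1 / Num.sqrt n%:R).
Proof.
move=> K0 d01 sg0 nu0 r0 p01; have /andP[d0 d1] := d01.
have [c [C1 [c0 C10 hcomp]]] := compressible_bound K0 d01 sg0 nu0 r0 p01.
have [C2 C20 SB] := small_ball r0 p01.
pose rho := Num.min (1 / 2) (c / (2 * K)).
have rho0 : 0 < rho by rewrite lt_min divr_gt0 //= divr_gt0 // mulr_gt0.
have rho1 : rho <= 1 / 2 by rewrite ge_min lexx.
have Krho : K * rho <= c / 2.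
  have : rho <= c / (2 * K) by rewrite ge_min lexx orbT.
  by rewrite ler_pdivlMr ?mulr_gt0 //; clear; lra.
clearbody rho.
pose D := C2 / Num.sqrt (delta / 2) * ((sigma * rho)^-1 + 1).
have sd : 0 < Num.sqrt (delta / 2) by rewrite sqrtr_gt0 divr_gt0.
have D0 : 0 < D by rewrite !mulr_gt0 ?invr_gt0 ?addr_gt0 ?invr_gt0 ?mulr_gt0.
exists (C1 + D); first by rewrite addr_gt0.
move=> n V p cc A B n0 wp nd A01 hrow hcol hexp i tau tau0.
have nR : (0 : R) < n%:R by rewrite ltr0n.
have sn : 0 < Num.sqrt (n%:R : R) by rewrite sqrtr_gt0.
have wP := iidw_prob n wp.
pose Q : {set 'I_n} := [set~ i].
have cQ : (#|~: Q| <= 1)%N by rewrite /Q setCK cards1.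
pose E1 o := sparse_null (model_mx cc A B o) Q K (1 - delta / 2) c.
apply: (@le_trans _ _ (fpr (iidw p) E1 + fpr (iidw p) (fun o => close_row (model_mx cc A B o) K tau i /\ ~ E1 o))).
  apply: le_trans _ (fprU wP _ _); apply: (le_fpr wP) => o ho.
  by case: (pselect (E1 o)); [left|right].
have i0 : 0 <= 1 / Num.sqrt n%:R :> R by rewrite divr_ge0 // ltW.
rewrite [leRHS]mulrDl; apply: lerD.
  apply: le_trans (hcomp n V p cc A B Q n0 wp nd A01 hcol cQ hexp) _.
  by rewrite ler_pM2l // div1r lerDr.
apply: (fpr_conditional (prodw_prob _ wp) (S := Q)) => f.
have [x x1 xf] := exists_normal (model_mx cc A B f) i.
have Qf g : mask Q (model_mx cc A B (mix Q f g) *m x) = 0.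
  rewrite -xf; apply/colP => j; rewrite !maskE; case: ifP => // jQ.
  by rewrite !rowvalE ffunE jQ.
have iQ : i \notin Q by rewrite !inE eqxx.
pose k := Num.truncn ((1 - delta / 2) * n%:R).
have kn0 : 0 <= (1 - delta / 2) * n%:R.
  by rewrite mulr_ge0 ?(ltW nR) //; move: d1; clear; lra.
have /andP[k1 k2] : k%:R <= (1 - delta / 2) * n%:R < k.+1%:R by exact: truncn_itv.
have Dpos : 0 <= D * (tau + 1 / Num.sqrt n%:R) by rewrite mulr_ge0 ?addr_ge0 // ltW.
have [hk|hk] := leqP #|spread_set rho x| k.
  apply: le_trans Dpos; rewrite -[leRHS](fex_cst wP); apply: (le_fex wP) => g.
  rewrite indF // => -[[MK _]]; apply.
  apply: contrapT => hno.
  have lb y : (#|supp y| <= k)%N -> y != 0 ->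
      c * Num.sqrt n%:R * l2norm y < l2norm (mask Q (model_mx cc A B (mix Q f g) *m y)).
    move=> sy y0; rewrite ltNge; apply/negP => hy; apply: hno.
    by apply: (sparse_null_scale MK y0) hy; apply: le_trans k1; rewrite ler_nat.
  have : (k < #|spread_set rho x|)%N.
    apply: (spread_of_lower_bound (eps := 0) n0 MK (ltW K0) _ lb x1) => //.
    - by rewrite (ltW rho0) /=; move: rho1; clear; lra.
    - by rewrite Qf l2norm0 mul0r.
    - have : c * rho <= c * (1 / 2) by rewrite ler_pM2l.
      by move: Krho; rewrite mulrBr; clear; lra.
  by rewrite ltnNge hk.
apply: (@le_trans _ _ (fpr (iidw p) (fun g : outcome n V => nc (rowval cc A B x i (g i)) <= tau))).
  apply: (le_fpr wP) => g [[_ h] _]; rewrite -(rowval_mix cc A B f g x iQ).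
  exact: h x1 (Qf g).
rewrite (fpr_marginal (prodw_prob _ wp) (fun v => nc (rowval cc A B x i v) <= tau) i).
have h := row_small_ball A B x i (SB _ p cc wp nd) n0 sg0 rho0 tau0.
set N := [set j in _ | _] in h; set PP := fpr _ _ in h *.
have PP0 : 0 <= PP by apply: (fpr_ge0 (prodw_prob _ wp)).
have cN : delta / 2 * n%:R <= #|N|%:R.
  have hu : (#|[set j | (sigma <= A i j)%R]| + #|spread_set rho x| <= #|N| + n)%N.
    have -> : N = [set j | sigma <= A i j] :&: spread_set rho x.
      by apply/setP => j; rewrite !inE andbC.
    by rewrite -cardsUI addnC leq_add2l -[leqRHS]card_ord max_card.
  rewrite -(ler_nat R) !natrD in hu.
  have hk' : (1 - delta / 2) * n%:R <= #|spread_set rho x|%:R.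
    by apply/ltW/(lt_le_trans k2); rewrite ler_nat.
  by move: (hrow i) hu hk'; rewrite mulrBl mul1r; clear; lra.
have sN : Num.sqrt (delta / 2) * Num.sqrt n%:R <= Num.sqrt (#|N|%:R : R).
  by rewrite -sqrtrM ?divr_ge0 ?(ltW d0) // ler_sqrt ?ler0n.
have := le_trans (ler_wpM2l PP0 sN) h.
rewrite -ler_pdivlMr ?mulr_gt0 // => h5; apply: le_trans h5 _.
have -> : C2 * (tau / (sigma * rho / Num.sqrt n%:R) + 1) / (Num.sqrt (delta / 2) * Num.sqrt n%:R)
  = C2 / Num.sqrt (delta / 2) * ((sigma * rho)^-1 * tau + 1 / Num.sqrt n%:R).
  by field; rewrite !gt_eqF.
rewrite /D -[leRHS]mulrA; apply: ler_wpM2l; first by rewrite divr_ge0 // ltW.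
have : 0 <= (sigma * rho)^-1 by rewrite invr_ge0 mulr_ge0 // ltW.
by move: i0 tau0; move: (_^-1) (1 / _); clear; move=> *; nra.
Qed.

(** The smallest singular value of [M] is that of its transpose, so there is a unit
    [u] with [M^T u] small. The bound on very sparse vectors, applied to the
    transpose, gives [u] at least [th n] coordinates of order [1 / sqrt n], hence
    at least [th n] rows of [M] are close to the span of the others. By Markov's
    inequality this loses only the factor [1 / th]. *)
Lemma finite_model_bound (K delta sigma nu r p0 : R) : 0 < K -> 0 < delta < 1 ->
  0 < sigma -> 0 < nu -> 0 < r -> 0 < p0 <= 1 ->
  exists2 C0, 0 < C0 &
  forall n (V : finType) (p : V -> R) (cc : V -> C) (A : 'M[R]_n) B,
  (0 < n)%N -> is_prob p -> nondegenerate p cc r p0 ->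
  (forall i j, 0 <= A i j <= 1) ->
  (forall i, delta * n%:R <= #|[set j | sigma <= A i j]|%:R) ->
  (forall j, delta * n%:R <= #|[set i | sigma <= A i j]|%:R) ->
  expanding A sigma delta nu ->
  forall t, 0 <= t ->
  fpr (iidw p) (fun o => opbound (model_mx cc A B o) (K * Num.sqrt n%:R) /\
    exists2 x, l2norm x = 1 & l2norm (model_mx cc A B o *m x) <= t / Num.sqrt n%:R)
  <= C0 * (t + 1 / Num.sqrt n%:R).
Proof.
move=> K0 d01 sg0 nu0 r0 p01; have /andP[d0 d1] := d01.
have [th [c [C1 [th0 c0 C10 base]]]] := very_sparse_bound K0 d0 sg0 r0 p01.
have [C2 C20 hrowc] := fpr_close_row K0 d01 sg0 nu0 r0 p01.
pose rho := Num.min (1 / 2) (c / (4 * K)).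
have rho0 : 0 < rho by rewrite lt_min divr_gt0 //= divr_gt0 // mulr_gt0.
have rho1 : rho <= 1 / 2 by rewrite ge_min lexx.
have Krho : K * rho <= c / 4.
  have : rho <= c / (4 * K) by rewrite ge_min lexx orbT.
  by rewrite ler_pdivlMr ?mulr_gt0 //; clear; lra.
clearbody rho.
have c40 : 0 <= 4 / c by rewrite divr_ge0 // ltW.
pose C3 := C1 + C2 / th * (rho^-1 + 1) + 1 + 4 / c.
have D0 : 0 < C2 / th * (rho^-1 + 1) by rewrite !mulr_gt0 ?invr_gt0 ?addr_gt0 ?invr_gt0.
have C30 : 0 < C3 by rewrite /C3; move: D0 C10 c40; clear; lra.
exists C3 => //.
move=> n V p cc A B n0 wp nd A01 hrow hcol hexp t t0.
have nR : (0 : R) < n%:R by rewrite ltr0n.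
have sn : 0 < Num.sqrt (n%:R : R) by rewrite sqrtr_gt0.
have wP := iidw_prob n wp.
have i0 : 0 < 1 / Num.sqrt n%:R :> R by rewrite divr_gt0.
have C3t : 1 + 4 / c <= C3 by rewrite /C3; move: D0 C10; clear; lra.
have [t1|t1] := leP 1 t.
  apply: le_trans (fpr_le1 wP _) _; apply: (@le_trans _ _ (1 * 1)); first by rewrite mulr1.
  apply: ler_pM => //; first by move: C3t c40; clear; lra.
  by move: t1 i0; clear; lra.
have [nc4|nc4] := ltP n%:R (4 / c).
  apply: le_trans (fpr_le1 wP _) _.
  apply: (@le_trans _ _ (4 / c * (1 / Num.sqrt n%:R))).
    rewrite mul1r ler_pdivlMr // mul1r; apply: le_trans (sqrt_natr_le R n0) _; exact: ltW.
  have i0' := ltW i0; apply: ler_pM => //; last by rewrite lerDr.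
  by move: C3t; clear; lra.
pose QT : {set 'I_n} := [set: 'I_n].
pose E1 o := sparse_null (model_mx cc A B o)^T QT K th c.
have hE1 : fpr (iidw p) E1 <= C1 / Num.sqrt n%:R.
  pose E2 o := sparse_null (model_mx cc A^T B^T o) QT K th c.
  apply: (@le_trans _ _ (fpr (iidw p) E2)).
    by apply: (le_fpr_tr wp) => o; rewrite /E1 /E2 model_mx_tr.
  apply: base => //.
  - by move=> i j; rewrite mxE.
  - by move=> j; under [X in #|pred_of_set X|]eq_finset => k do rewrite mxE.
  - by rewrite /QT setCT cards0.
pose F o i := close_row (model_mx cc A B o) K (t / rho) i.
pose cnt o : R := \sum_i ind R (F o i).
apply: (@le_trans _ _ (fpr (iidw p) E1 + fpr (iidw p) (fun o => th * n%:R <= cnt o))).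
  apply: le_trans _ (fprU wP _ _); apply: (le_fpr wP) => o [MK [x x1 hx]].
  case: (pselect (E1 o)) => hno; [by left|right].
  have tn0 : 0 <= t / Num.sqrt n%:R by rewrite divr_ge0 // ltW.
  have [u u1 hu] := small_transpose tn0 x1 hx.
  have Kn : 0 <= K * Num.sqrt n%:R by rewrite mulr_ge0 // ltW.
  have MT := opbound_tr Kn MK.
  pose k := Num.truncn (th * n%:R).
  have kn0 : 0 <= th * n%:R by rewrite mulr_ge0 // ltW.
  have /andP[k1 k2] : k%:R <= th * n%:R < k.+1%:R by exact: truncn_itv.
  have maskT (y : 'cV[C]_n) : mask QT y = y by apply: mask_id => i; rewrite inE.
  have lb y : (#|supp y| <= k)%N -> y != 0 ->
      c * Num.sqrt n%:R * l2norm y < l2norm (mask QT ((model_mx cc A B o)^T *m y)).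
    move=> sy y0; rewrite ltNge; apply/negP => hy; apply: hno.
    by apply: (sparse_null_scale MT y0) hy; apply: le_trans k1; rewrite ler_nat.
  have spr : (k < #|spread_set rho u|)%N.
    apply: (spread_of_lower_bound (eps := c / 4) n0 MT (ltW K0) _ lb u1) => //.
    - by rewrite (ltW rho0) /=; move: rho1; clear; lra.
    - rewrite maskT; apply: le_trans hu _; rewrite ler_pdivrMr // -mulrA -expr2.
      rewrite (sqr_sqrtr (ltW nR)); apply: le_trans (ltW t1) _.
      rewrite ler_pdivrMr // in nc4.
      by move: nc4; clear; lra.
    - have : c * rho <= c * (1 / 2) by rewrite ler_pM2l.
      by move: Krho; rewrite mulrBr; clear; lra.
  apply/ltW/(lt_le_trans k2); apply: (@le_trans _ _ (#|spread_set rho u|%:R)).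
    by rewrite ler_nat.
  rewrite -sum1_card natr_sum big_mkcond; apply: ler_sum => i _.
  case: ifPn => [hi|_]; last exact: ind_ge0.
  have hF : F o i by exact: (close_row_of_left_null n0 rho0 MK hu hi).
  by rewrite (indT R hF).
have cnt0 o : 0 <= cnt o by apply: sumr_ge0 => i _; exact: ind_ge0.
have hm : th * n%:R * fpr (iidw p) (fun o => th * n%:R <= cnt o) <= n%:R * (C2 * (t / rho + 1 / Num.sqrt n%:R)).
  apply: le_trans (fpr_markov wP _ cnt0) _; rewrite /cnt fex_sum.
  apply: (@le_trans _ _ (\sum_(i < n) C2 * (t / rho + 1 / Num.sqrt n%:R))); last first.
    by rewrite sumr_const card_ord mulr_natl.
  apply: ler_sum => i _; apply: hrowc => //.
  by rewrite divr_ge0 // ltW.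
have h2 : fpr (iidw p) (fun o => th * n%:R <= cnt o) <= C2 / th * (t / rho + 1 / Num.sqrt n%:R).
  have thn : 0 < th * n%:R by rewrite mulr_gt0.
  rewrite -(ler_pM2l thn); apply: le_trans hm _.
  by rewrite le_eqVlt; apply/orP; left; apply/eqP; field; rewrite !gt_eqF.
apply: le_trans (lerD hE1 h2) _.
have h3 : C2 / th * (t / rho + 1 / Num.sqrt n%:R) <=
    C2 / th * (rho^-1 + 1) * (t + 1 / Num.sqrt n%:R).
  rewrite -[leRHS]mulrA; apply: ler_wpM2l; first by rewrite divr_ge0 // ltW.
  have : 0 <= rho^-1 by rewrite invr_ge0 ltW.
  by move: i0 t0; move: (rho^-1) (1 / _); clear; move=> *; nra.
have h4 : C1 / Num.sqrt n%:R <= C1 * (t + 1 / Num.sqrt n%:R).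
  by rewrite ler_pM2l // div1r lerDr.
apply: le_trans (lerD h4 h3) _; rewrite -mulrDl; apply: ler_wpM2r.
  by rewrite addr_ge0 // ltW.
by rewrite /C3 -addrA lerDl addr_ge0.
Qed.

End FiniteMain.

(** * Singular values and the operator norm *)

Section SingularValues.
Local Open Scope classical_set_scope.
Local Open Scope ring_scope.
Local Open Scope sesquilinear_scope.
Variable R : realType.
Local Notation C := R[i].

(** In an orthonormal eigenbasis of [M^* M] the form [l2norm (M x) ^ 2] is
    diagonal: this is the only spectral fact that is used. *)
Lemma diagonal_form n (M : 'M[C]_n) : exists (U : 'M[C]_n) (s : 'I_n -> R),
  [/\ U \in unitmx,
      forall i, s i = complex.Re (spectral_diag (M ^t* *m M) 0 i),
      forall x : 'cV[C]_n, nrm2 (U *m x) = nrm2 x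
    & forall x : 'cV[C]_n, nrm2 (M *m x) = \sum_i s i * nc ((U *m x) i 0) ^+ 2].
Proof.
set A := M ^t* *m M; pose U := spectralmx A; pose sp := spectral_diag A.
have Uu : U \in unitmx := unitarymx_unit (spectral_unitarymx A).
have UU : U ^t* *m U = 1%:M.
  by rewrite -invmx_unitary ?spectral_unitarymx // mulVmx // unitarymx_unit // spectral_unitarymx.
have An : A \is normalmx by apply/normalmxP; rewrite /A adjM trmxCK.
have AE : A = U ^t* *m diag_mx sp *m U.
  by rewrite -invmx_unitary ?spectral_unitarymx //; exact/orthomx_spectralP.
exists U, (fun i => complex.Re (sp 0 i)); split => // x.
- apply: complexI; rewrite -!adj_col_mulE adjM mulmxA -(mulmxA _ _ U) UU mulmx1 //.
- have : ((nrm2 (M *m x))%:C)%C = ((U *m x) ^t* *m (diag_mx sp *m (U *m x))) 0 0.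
    rewrite -adj_col_mulE !adjM !mulmxA -(mulmxA (x ^t*) _ M) -/A AE.
    by rewrite !mulmxA.
  move=> /(congr1 (@complex.Re R)) /= ->; rewrite mxE Re_sum.
  apply: eq_bigr => i _; rewrite mul_diag_mx !mxE.
  rewrite mulrCA (mulrC (_^*)%C) mul_conj.
  by case: (sp 0 i) => a b /=; rewrite mulr0 subr0.
Qed.

Lemma nc_delta_sqr n (i j : 'I_n) : nc ((delta_mx i 0 : 'cV[C]_n) j 0) ^+ 2 = (j == i)%:R.
Proof.
by rewrite mxE eqxx andbT; case: eqVneq => _; rewrite ?nc0 ?expr0n // nc_real normr1 expr1n.
Qed.

Lemma diagonal_form_eigenvalue n (M U : 'M[C]_n) (s : 'I_n -> R) : U \in unitmx ->
  (forall x : 'cV[C]_n, nrm2 (M *m x) = \sum_i s i * nc ((U *m x) i 0) ^+ 2) ->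
  forall i, nrm2 (M *m (invmx U *m delta_mx i 0)) = s i.
Proof.
move=> Uu h i; rewrite h mulKVmx // (bigD1 i) //= big1 => [|j ji].
  by rewrite nc_delta_sqr eqxx mulr1 addr0.
by rewrite nc_delta_sqr (negbTE ji) mulr0.
Qed.

Lemma smallest_singular_value n (M : 'M[C]_n) : (0 < n)%N ->
  [/\ 0 <= singular_value M n,
      forall x : 'cV[C]_n, singular_value M n * l2norm x <= l2norm (M *m x)
    & exists2 x : 'cV[C]_n, l2norm x = 1 & l2norm (M *m x) = singular_value M n].
Proof.
move=> n0; have [U [s [Uu sE Ux Mx]]] := diagonal_form M.
pose xi i : 'cV[C]_n := invmx U *m delta_mx i 0.
have xiE i : nrm2 (M *m xi i) = s i := diagonal_form_eigenvalue Uu Mx i.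
have s0 i : 0 <= s i by rewrite -xiE nrm2_ge0.
set l := singular_values M.
have sl : size l = n by rewrite size_sort size_map size_enum_ord.
have ls i : Num.sqrt (s i) \in l.
  by rewrite sE mem_sort; apply/map_f/mem_enum.
have nl : (n.-1 < size l)%N by rewrite sl prednK.
have : singular_value M n \in l by exact: mem_nth.
rewrite mem_sort => /mapP[i0 _]; rewrite -sE => e0.
have srt : sorted >=%R l by apply: sort_sorted => x y; exact: le_total.
have smin i : s i0 <= s i.
  rewrite -ler_sqrt // -e0 -(nth_index 0 (ls i)).
  have geT : transitive (>=%R : rel R) by move=> a b c ab bc; exact: le_trans bc ab.
  have geR : reflexive (>=%R : rel R) by move=> a; exact: lexx.
  apply: (sorted_leq_nth geT geR 0 srt); rewrite ?inE ?index_mem //.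
  by rewrite -ltnS prednK // -[in X in (_ < X)%N]sl index_mem.
split; first by rewrite e0 sqrtr_ge0.
  move=> x; rewrite -(ler_pXn2r (n := 2)) ?nnegrE ?mulr_ge0 ?l2norm_ge0 //; last first.
    by rewrite e0 sqrtr_ge0.
  rewrite exprMn !sqr_l2norm e0 sqr_sqrtr // -Ux Mx /nrm2 mulr_sumr.
  by apply: ler_sum => i _; rewrite ler_wpM2r // sqr_ge0.
exists (xi i0); last by rewrite e0 -(xiE i0).
have : nrm2 (xi i0) = 1.
  rewrite -Ux mulKVmx // /nrm2 (bigD1 i0) //= big1 => [|j ji].
    by rewrite nc_delta_sqr eqxx addr0.
  by rewrite nc_delta_sqr (negbTE ji).
by rewrite /l2norm -/(nrm2 _) => ->; rewrite sqrtr1.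
Qed.

Lemma opbound_entrywise n (M : 'M[C]_n) eta : 0 <= eta ->
  (forall i j, nc (M i j) <= eta) -> opbound M (n%:R * eta).
Proof.
move=> eta0 Meta x; rewrite le_l2norm ?mulr_ge0 ?l2norm_ge0 //.
rewrite exprMn sqr_l2norm.
have h i : nc ((M *m x) i 0) ^+ 2 <= n%:R * eta ^+ 2 * nrm2 x.
  have -> : (M *m x) i 0 = \sum_j (row i M)^T j 0 * x j 0.
    by rewrite mxE; apply: eq_bigr => j _; rewrite !mxE.
  apply: le_trans (_ : (l2norm (row i M)^T * l2norm x) ^+ 2 <= _).
    by rewrite lerXn2r ?nnegrE ?mulr_ge0 ?l2norm_ge0 ?nc_ge0 // nc_dot_le.
  rewrite exprMn !sqr_l2norm; apply: ler_wpM2r; first exact: nrm2_ge0.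
  apply: le_trans (_ : \sum_(j < n) eta ^+ 2 <= _).
    by apply: ler_sum => j _; rewrite !mxE lerXn2r ?nnegrE ?nc_ge0.
  by rewrite sumr_const card_ord mulr_natl.
apply: le_trans (_ : \sum_(i < n) n%:R * eta ^+ 2 * nrm2 x <= _).
  by apply: ler_sum => i _; exact: h.
by rewrite sumr_const card_ord -[leLHS]mulr_natl le_eqVlt; apply/orP; left; apply/eqP; ring.
Qed.

Lemma opnorm_has_sup n (M : 'M[C]_n) :
  has_sup [set l2norm (M *m x) | x in [set x : 'cV[C]_n | l2norm x <= 1]].
Proof.
split; first by exists 0, 0; rewrite /= ?mulmx0 l2norm0.
pose m := \sum_i \sum_j nc (M i j).
have m0 : 0 <= m by apply: sumr_ge0 => i _; apply: sumr_ge0 => j _; exact: nc_ge0.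
have Mm i j : nc (M i j) <= m.
  rewrite /m (bigD1 i) //= (bigD1 j) //= -addrA lerDl addr_ge0 //.
    by apply: sumr_ge0 => k _; exact: nc_ge0.
  by apply: sumr_ge0 => k _; apply: sumr_ge0 => l _; exact: nc_ge0.
exists (n%:R * m) => _ [y /= y1 <-]; apply: le_trans (opbound_entrywise m0 Mm y) _.
by rewrite ler_piMr // mulr_ge0.
Qed.

Lemma opnorm_ge0 n (M : 'M[C]_n) : 0 <= opnorm M.
Proof.
apply: sup_ubound; first by case: (opnorm_has_sup M).
by exists 0; rewrite /= ?mulmx0 l2norm0.
Qed.

Lemma opbound_opnorm n (M : 'M[C]_n) b : 0 <= b -> opnorm M <= b <-> opbound M b.
Proof.
move=> b0; split=> [hb x|hb]; last first.
  apply: ge_sup; first by case: (opnorm_has_sup M).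
  move=> _ [x /= x1 <-]; apply: le_trans (hb x) _.
  by rewrite ler_piMr.
have [->|x0] := eqVneq x 0; first by rewrite mulmx0 !l2norm0 mulr0.
have xl : 0 < l2norm x by rewrite l2norm_gt0.
rewrite -ler_pdivrMr // mulrC -nc_inv_l2norm -l2normZ scalemxAr; apply: le_trans hb.
apply: sup_ubound; first by case: (opnorm_has_sup M).
exists ((((l2norm x)^-1)%:C)%C *: x) => //=.
by rewrite l2normZ nc_inv_l2norm mulVf // gt_eqF.
Qed.

End SingularValues.

(** * Complex random variables: measurability and means *)

Section ComplexMeasurable.
Local Open Scope classical_set_scope.
Variable R : realType.

Lemma measurable_Re : measurable_fun [set: R[i]] (@complex.Re R).
Proof.
move=> _ S mS; rewrite setTI.
change (measurable (@complex_of_pair R @^-1` (@complex.Re R @^-1` S))).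
rewrite (_ : _ @^-1` _ = S `*` [set: R]); first exact: measurableX.
by apply/seteqP; split => -[x y] //= -[].
Qed.

Lemma measurable_Im : measurable_fun [set: R[i]] (@complex.Im R).
Proof.
move=> _ S mS; rewrite setTI.
change (measurable (@complex_of_pair R @^-1` (@complex.Im R @^-1` S))).
rewrite (_ : _ @^-1` _ = [set: R] `*` S); first exact: measurableX.
by apply/seteqP; split => -[x y] //= -[].
Qed.

Context d (T : measurableType d).

Lemma measurable_nc_sqr (f : T -> R[i]) (z : R[i]) : measurable_fun [set: T] f ->
  measurable_fun [set: T] (fun w => nc (f w - z) ^+ 2).
Proof.
move=> mf; under eq_fun => w do rewrite sqr_nc ReB ImB.
have mRe : measurable_fun [set: T] (fun w => complex.Re (f w)).
  by apply: measurableT_comp mf; exact: measurable_Re.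
have mIm : measurable_fun [set: T] (fun w => complex.Im (f w)).
  by apply: measurableT_comp mf; exact: measurable_Im.
by apply: measurable_funD; apply: measurable_funX; apply: measurable_funB.
Qed.

Lemma measurable_far (f : T -> R[i]) (z : R[i]) (r : R) : measurable_fun [set: T] f ->
  measurable [set w | r <= nc (f w - z)].
Proof.
move=> mf; have [r0|r0] := leP r 0.
  rewrite (_ : mkset _ = setT); first exact: measurableT.
  by apply/seteqP; split => // w _ /=; apply: le_trans r0 (nc_ge0 _).
have -> : [set w | r <= nc (f w - z)] =
    (fun w => nc (f w - z) ^+ 2) @^-1` `[r ^+ 2, +oo[%classic.
  apply/seteqP; split => w /=; rewrite in_itv /= andbT;
    by rewrite ler_pXn2r // nnegrE ?nc_ge0 // ltW.
by rewrite -[X in measurable X]setTI; exact: measurable_nc_sqr.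
Qed.

End ComplexMeasurable.

Section Mean.
Local Open Scope classical_set_scope.
Variable R : realType.
Context d (T : measurableType d) (P : probability T R).
Implicit Types f g : T -> R.

(** In this relational form, integrability and the value of a mean are propagated
    through sums together. *)
Definition has_mean f (m : R) :=
  P.-integrable [set: T] (EFin \o f) /\ Rintegral P [set: T] f = m.

Lemma has_meanE f m : has_mean f m -> 'E_P[f]%E = m%:E.
Proof.
move=> [fi <-]; rewrite unlock /Rintegral fineK //.
exact: integrable_fin_num.
Qed.

Lemma has_mean_uniq f m m' : has_mean f m -> has_mean f m' -> m = m'.
Proof. by move=> [_ <-] [_ <-]. Qed.

Lemma has_mean_dominated f g m : measurable_fun [set: T] f ->
  (forall w, `|f w| <= g w) -> has_mean g m -> exists m', has_mean f m'.
Proof.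
move=> mf fg [gi _]; exists (Rintegral P [set: T] f); split => //.
apply: (le_integrable _ _ _ gi) => //; first exact/measurable_EFinP.
by move=> w _ /=; rewrite lee_fin; apply: le_trans (fg w) _; exact: ler_norm.
Qed.

Lemma has_mean_cst a : has_mean (fun=> a) a.
Proof.
split; first exact: finite_measure_integrable_cst.
transitivity (a * fine (P [set: T])); first exact: Rintegral_cst.
by rewrite probability_setT mulr1.
Qed.

Lemma has_mean_indic (A : set T) : measurable A -> has_mean \1_A (fine (P A)).
Proof.
move=> mA; split; first exact: integrable_indic.
by rewrite /Rintegral integral_indic // setIT.
Qed.

Lemma has_meanD f g a b : has_mean f a -> has_mean g b -> has_mean (fun w => f w + g w) (a + b).
Proof.
move=> [fi <-] [gi <-]; split; last exact: RintegralD.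
exact: (integrableD _ fi gi).
Qed.

Lemma has_meanZ f a (k : R) : has_mean f a -> has_mean (fun w => k * f w) (k * a).
Proof.
move=> [fi <-]; split; last exact: RintegralZl.
exact: (integrableZl _ k fi).
Qed.

Lemma has_mean_le f g a b : has_mean f a -> has_mean g b -> (forall w, f w <= g w) -> a <= b.
Proof. by move=> [fi <-] [gi <-] fg; exact: le_Rintegral. Qed.

Lemma has_mean_moment2 (X : T -> R[i]) (a : R) : measurable_fun [set: T] X ->
  cmoment2 P X = a%:E -> has_mean (fun w => nc (X w) ^+ 2) a.
Proof.
move=> mX; rewrite /cmoment2 unlock => h.
have m2 : measurable_fun [set: T] (fun w => nc (X w) ^+ 2).
  by have := measurable_nc_sqr 0 mX; under eq_fun => w do rewrite subr0.
split; last by rewrite /Rintegral h.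
apply/integrableP; split; first exact/measurable_EFinP.
by under eq_integral => w _ do rewrite /= ger0_norm ?sqr_ge0 //; rewrite h ltry.
Qed.

End Mean.

(** * A spread variable is not concentrated near any point *)

Section Spread.
Local Open Scope classical_set_scope.
Variable R : realType.
Context d (T : measurableType d) (P : probability T R).

Lemma Re_dot_le (z u : R[i]) :
  - (complex.Re z * complex.Re u + complex.Im z * complex.Im u) <= nc z * nc u.
Proof.
rewrite -(nc_conj z) -ncM; apply: le_trans (normRe_le _).
case: z u => [a b] [p q] /=; rewrite mulNr opprK.
by rewrite -normrN ler_norm.
Qed.

Lemma nc_sqr_distE (w m z : R[i]) : nc (w - m) ^+ 2 = nc (w - z) ^+ 2 +
  (2 * (complex.Re z - complex.Re m) * complex.Re w +
   (2 * (complex.Im z - complex.Im m) * complex.Im w + (nc m ^+ 2 - nc z ^+ 2))).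
Proof. by rewrite !sqr_nc !ReB !ImB; ring. Qed.

Lemma has_mean_variance (X : T -> R[i]) (z : R[i]) v m1 m2 :
  has_mean P (fun w => complex.Re (X w)) m1 -> has_mean P (fun w => complex.Im (X w)) m2 ->
  has_mean P (fun w => nc (X w - z) ^+ 2) v -> (cvariance P X <= v%:E)%E.
Proof.
move=> h1 h2 hv; have mE : cexpectation P X = Complex m1 m2.
  by rewrite /cexpectation (has_meanE h1) (has_meanE h2).
set m := Complex m1 m2 in mE.
have := has_meanD hv (has_meanD (has_meanZ (2 * (complex.Re z - m1)) h1)
  (has_meanD (has_meanZ (2 * (complex.Im z - m2)) h2)
     (has_mean_cst P (nc m ^+ 2 - nc z ^+ 2)))).
under [X in has_mean _ X]eq_fun => w do rewrite -(nc_sqr_distE (X w) m z).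
rewrite /cvariance /cmoment2 mE => /has_meanE ->; rewrite lee_fin !sqr_nc /=.
case: z {hv} => a b /=.
have := sqr_ge0 (a - m1); have := sqr_ge0 (b - m2); clear; lra.
Qed.

Lemma measurable_truncation (X : T -> R[i]) kappa : measurable_fun [set: T] X ->
  measurable_fun [set: T] (truncation P kappa X).
Proof.
move=> mX _ S mS; rewrite setTI.
set N := [set w | nc (X w - cexpectation P X) <= kappa].
have mN : measurable N.
  have [k0|k0] := ltP kappa 0.
    rewrite (_ : N = set0) //; apply/seteqP; split => // w /= h.
    by have := le_lt_trans (le_trans (nc_ge0 _) h) k0; rewrite ltxx.
  have -> : N = (fun w => nc (X w - cexpectation P X) ^+ 2) @^-1` `]-oo, kappa ^+ 2]%classic.
    by apply/seteqP; split => w /=; rewrite in_itv /= ler_pXn2r // nnegrE ?nc_ge0.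
  by rewrite -[X in measurable X]setTI; exact: measurable_nc_sqr.
have -> : truncation P kappa X @^-1` S =
    (X @^-1` S `&` N) `|` ((fun=> 0) @^-1` S `&` ~` N).
  apply/seteqP; split => w; rewrite /truncation /=.
    by case: ifPn => [h hS|/negP h hS]; [left|right].
  by case=> -[hS h]; [rewrite h|case: ifPn].
apply: measurableU; apply: measurableI => //.
- by rewrite -[X in measurable X]setTI; exact: mX.
- by rewrite preimage_cst; case: ifP => _; [exact: measurableT|exact: measurable0].
- exact: measurableC.
Qed.

End Spread.

(** If [X] were within [r] of [z] outside of an event [D] of small probability,
    then [z] would be close to the mean, so that off [D] the truncation would
    be [X] itself and its variance would be at most
    [r ^ 2 + (kappa + 1) ^ 2 P(D)], less than [1 / kappa]. *)
Lemma spread_nondegenerate (R : realType) d (T : measurableType d) (P : probability T R)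
    (X : T -> R[i]) (kappa : R) (z : R[i]) :
  measurable_fun [set: T] X -> 1 <= kappa ->
  cexpectation P X = 0 -> cmoment2 P X = 1%E -> spread P kappa X ->
  kappa^-1 ^+ 3 / 64 <= fine (P [set w | kappa^-1 / 4 <= nc (X w - z)]%classic).
Proof.
move=> mX k1 X0 X2 Xs; set r := kappa^-1 / 4; set D := [set w | _]%classic.
have mD : measurable D by exact: measurable_far.
rewrite leNgt; apply/negP; set dl := fine (P D) => hd.
have hD : has_mean P \1_D dl by exact: has_mean_indic.
have indD w : \1_D w = (r <= nc (X w - z))%R%:R :> R.
  rewrite indicE; case: leP => h; first by rewrite mem_set.
  by rewrite memNset // => hw; move: h; rewrite ltNge hw.
have k0 : 0 < kappa by apply: lt_le_trans k1.
have q0 : 0 < kappa^-1 by rewrite invr_gt0.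
have q1 : kappa^-1 <= 1 by rewrite invf_le1.
have kq : kappa * kappa^-1 = 1 by rewrite mulfV // gt_eqF.
have r0 : 0 <= r by rewrite divr_ge0 // ltW.
have r1 : r <= 1 / 4 by rewrite /r; move: q1; clear; lra.
have d64 : dl <= 1 / 64.
  apply: le_trans (ltW hd) _; rewrite ler_pM2r ?invr_gt0 ?ltr0n //.
  by rewrite exprn_ile1 // ltW.
have dl0 : 0 <= dl by rewrite fine_ge0.
have h2 : has_mean P (fun w => nc (X w) ^+ 2) 1 by exact: has_mean_moment2.
have mRe (Y : T -> R[i]) : measurable_fun [set: T] Y -> measurable_fun [set: T] (fun w => complex.Re (Y w)).
  by move=> mY; apply: measurableT_comp mY; exact: measurable_Re.
have mIm (Y : T -> R[i]) : measurable_fun [set: T] Y -> measurable_fun [set: T] (fun w => complex.Im (Y w)).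
  by move=> mY; apply: measurableT_comp mY; exact: measurable_Im.
have h3 := has_meanD (has_mean_cst P 1) h2.
have le2 w : nc (X w) <= 1 + nc (X w) ^+ 2.
  by have := sqr_ge0 (nc (X w) - 1); have := nc_ge0 (X w); clear; nra.
have [a ha] := has_mean_dominated (mRe _ mX) (fun w => le_trans (normRe_le _) (le2 w)) h3.
have [b hb] := has_mean_dominated (mIm _ mX) (fun w => le_trans (normIm_le _) (le2 w)) h3.
have [a0 b0] : a = 0 /\ b = 0.
  by move: X0; rewrite /cexpectation (has_meanE ha) (has_meanE hb) /= => -[-> ->].
subst a b.
(* The mean of the real part of [conj z * (z - X)] is the square of [|z|]. Off [D]
   this real part is at most [|z| r], and on [D] the second moment controls it. *)
have zle : nc z <= 1 / 2.
  have g1 := has_meanD (has_mean_cst P (nc z ^+ 2))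
    (has_meanD (has_meanZ (- complex.Re z) ha) (has_meanZ (- complex.Im z) hb)).
  have g2 := has_meanZ (nc z) (has_meanD (has_mean_cst P r)
    (has_meanD (has_meanZ (nc z + 4) hD) (has_meanZ (16^-1) h2))).
  have := has_mean_le g1 g2; rewrite !mulr0 !addr0 mulr1 => h.
  have {h}h : nc z ^+ 2 <= nc z * (r + ((nc z + 4) * dl + 16^-1)).
    apply: h => w.
    apply: (@le_trans _ _ (nc z * nc (X w - z))).
      apply: le_trans (Re_dot_le _ _); rewrite sqr_nc ReB ImB; clear; lra.
    apply: ler_wpM2l; first exact: nc_ge0.
    rewrite indD; case: (leP r (nc (X w - z))) => hw /=.
      have := ncB (X w) z; have := sqr_ge0 (nc (X w) / 4 - 2); move: r0; clear; nra.
    rewrite mulr0 add0r; have := sqr_ge0 (nc (X w)); move: (nc (X w) ^+ 2) hw; clear.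
    by move=> *; lra.
  have := nc_ge0 z; rewrite le_eqVlt => /orP[/eqP <-|z0]; first by rewrite divr_ge0.
  rewrite expr2 ler_pM2l // in h.
  by move: h z0 r1 d64 dl0; clear; nra.
pose Y := truncation P kappa X.
have mY : measurable_fun [set: T] Y by exact: measurable_truncation.
have Yk w : nc (Y w) <= kappa.
  rewrite /Y /truncation X0 subr0; case: ifP => // _.
  by rewrite nc0 ltW.
have hk := has_mean_cst P kappa.
have [m1 hm1] := has_mean_dominated (mRe _ mY) (fun w => le_trans (normRe_le _) (Yk w)) hk.
have [m2 hm2] := has_mean_dominated (mIm _ mY) (fun w => le_trans (normIm_le _) (Yk w)) hk.
have hb2 := has_meanD (has_mean_cst P (r ^+ 2)) (has_meanZ ((kappa + 1) ^+ 2) hD).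
have Yz w : nc (Y w - z) ^+ 2 <= r ^+ 2 + (kappa + 1) ^+ 2 * \1_D w.
  rewrite indD; case: (leP r (nc (X w - z))) => hw /=.
    rewrite mulr1; apply: (@le_trans _ _ ((kappa + 1) ^+ 2)); last by rewrite lerDr sqr_ge0.
    rewrite lerXn2r ?nnegrE ?nc_ge0 ?addr_ge0 ?ltW //.
    by have := ncB (Y w) z; have := Yk w; move: zle; clear; lra.
  rewrite mulr0 addr0 lerXn2r ?nnegrE ?nc_ge0 // /Y /truncation X0 subr0.
  have := ncD (X w - z) z; rewrite subrK => hX.
  by rewrite ifT ?ltW //; move: hX hw zle r1 k1; clear; lra.
have [v hv] : exists v, has_mean P (fun w => nc (Y w - z) ^+ 2) v.
  apply: has_mean_dominated hb2; first exact: measurable_nc_sqr.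
  by move=> w; rewrite ger0_norm ?sqr_ge0.
have vle := has_mean_le hv hb2 Yz.
have := le_trans Xs (has_mean_variance hm1 hm2 hv); rewrite lee_fin => h.
have h4 : (kappa + 1) ^+ 2 * dl <= kappa^-1 / 16.
  have h5 : (kappa + 1) ^+ 2 * dl <= (kappa * 2) ^+ 2 * (kappa^-1 ^+ 3 / 64).
    apply: ler_pM; rewrite ?sqr_ge0 ?(ltW hd) //.
    by rewrite lerXn2r ?nnegrE ?addr_ge0 ?mulr_ge0 ?(ltW k0) //; move: k1; clear; lra.
  apply: le_trans h5 _; rewrite exprMn [_^-1 ^+ 3]exprS mulrACA.
  rewrite le_eqVlt; apply/orP; left; apply/eqP; field; by rewrite gt_eqF.
have : r ^+ 2 <= kappa^-1 / 16.
  by rewrite /r; move: q0 q1; move: (kappa^-1); clear; move=> *; nra.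
by move: h vle h4 q0; clear; lra.
Qed.

(** * Discretization of complex random variables *)

Section FiniteValued.
Local Open Scope classical_set_scope.
Variable R : realType.
Context d (T : measurableType d).

Lemma measurable_finite_valued (V : finType) (g : T -> V) (S : set V) :
  (forall v, measurable (g @^-1` [set v])) -> measurable (g @^-1` S).
Proof.
move=> mg; have -> : g @^-1` S = \bigcup_(v in S) (g @^-1` [set v]).
  by apply/seteqP; split => [w Sw|w [v Sv /= ->]] //; exists (g w).
apply: fin_bigcup_measurable => [|v _]; last exact: mg.
by apply: sub_finite_set (finite_finpred predT) => v _ /=.
Qed.

Lemma measurable_finite_family (I V : finType) (g : I -> T -> V) (S : set {ffun I -> V}) :
  (forall i v, measurable (g i @^-1` [set v])) ->
  measurable ((fun w => [ffun i => g i w]) @^-1` S).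
Proof.
move=> mg; apply: measurable_finite_valued => f.
have -> : (fun w => [ffun i => g i w]) @^-1` [set f] = \bigcap_(i in setT) (g i @^-1` [set f i]).
  apply/seteqP; split => w /= => [<- i _|h]; first by rewrite /= ffunE.
  by apply/ffunP => i; rewrite ffunE; exact: h.
apply: fin_bigcap_measurable => [|i _]; last exact: mg.
by apply: sub_finite_set (finite_finpred predT) => v _ /=.
Qed.

Variable P : probability T R.

Lemma has_mean_sum (I : Type) (s : seq I) (F : I -> T -> R) (m : I -> R) :
  (forall i, has_mean P (F i) (m i)) ->
  has_mean P (fun w => \sum_(i <- s) F i w) (\sum_(i <- s) m i).
Proof.
move=> h; elim: s => [|i s IH].
  under [X in has_mean _ X]eq_fun do rewrite big_nil.
  by rewrite big_nil; exact: has_mean_cst.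
under [X in has_mean _ X]eq_fun do rewrite big_cons.
by rewrite big_cons; exact: has_meanD.
Qed.

Lemma finite_valued_law (V : finType) (g : T -> V) (S : V -> Prop) :
  (forall v, measurable (g @^-1` [set v])) ->
  fine (P (g @^-1` [set v | S v])) = fpr (fun v => fine (P (g @^-1` [set v]))) S.
Proof.
move=> mg.
have h := has_mean_sum (index_enum V)
  (fun v => has_meanZ (ind R (S v)) (has_mean_indic P (mg v))).
have e : \1_(g @^-1` [set v | S v]) = (fun w => \sum_v ind R (S v) * \1_(g @^-1` [set v]) w) :> (T -> R).
  apply/funext => w; rewrite (bigD1 (g w)) //= big1 => [|v vw].
    rewrite !indicE (mem_set (_ : (g @^-1` [set g w]) w)) // mulr1 addr0 /ind.
    by congr (_%:R); congr nat_of_bool; apply/idP/asboolP; rewrite inE.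
  rewrite [X in _ * X]indicE memNset ?mulr0 // => /= gw.
  by rewrite gw eqxx in vw.
rewrite -e in h; rewrite (has_mean_uniq (has_mean_indic P (measurable_finite_valued _ mg)) h).
by apply: eq_bigr => v _; rewrite mulrC.
Qed.

Lemma finite_valued_prob (V : finType) (g : T -> V) :
  (forall v, measurable (g @^-1` [set v])) -> is_prob (fun v => fine (P (g @^-1` [set v]))).
Proof.
move=> mg; split=> [v|]; first by rewrite fine_ge0.
have := finite_valued_law (fun=> True) mg.
rewrite (_ : g @^-1` _ = setT) ?probability_setT; last by apply/seteqP; split.
move=> /= h; apply: (etrans _ (esym h)).
by apply: eq_bigr => v _; rewrite indT // mulr1.
Qed.

End FiniteValued.

Section Grid.
Local Open Scope classical_set_scope.
Variable R : realType.

Lemma real_grid (L eta : R) : 0 < L -> 0 < eta ->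
  exists m (q : R -> 'I_m.+1) (c : 'I_m.+1 -> R),
  (forall k, measurable (q @^-1` [set k])) /\
  forall x, `|x| <= L -> `|c (q x) - x| <= eta.
Proof.
move=> L0 eta0; pose m := Num.truncn ((L + L) / eta).
pose f x := minn m (Num.truncn ((x + L) / eta)).
have fm x : (f x < m.+1)%N by rewrite ltnS geq_minl.
exists m, (fun x => Ordinal (fm x)), (fun k => k%:R * eta - L); split=> [k|x].
  have mf : measurable_fun [set: R] (fun x => (f x)%:R : R).
    apply: nondecreasing_measurable => // x y xy; rewrite ler_nat /f leq_min geq_minl /=.
    apply: leq_trans (geq_minr _ _) _; apply: le_truncn.
    by rewrite ler_pM2r ?invr_gt0 // lerD2r.
  have -> : (fun x => Ordinal (fm x)) @^-1` [set k] = (fun x => (f x)%:R : R) @^-1` [set k%:R].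
    apply/seteqP; split => x /= => [<- //|/eqP].
    by rewrite eqr_nat => /eqP h; exact: val_inj.
  by rewrite -[X in measurable X]setTI; exact: mf.
rewrite ler_norml => /andP[x1 x2] /=.
have y0 : 0 <= (x + L) / eta by rewrite divr_ge0 ?(ltW eta0) //; move: x1; clear; lra.
have -> : f x = Num.truncn ((x + L) / eta).
  apply/minn_idPr; apply: le_truncn.
  by rewrite ler_pM2r ?invr_gt0 // lerD2r.
have /andP[] := truncn_itv y0; move: (Num.truncn _) => k.
rewrite ler_pdivlMr // ltr_pdivrMr // -[k.+1%:R]natr1 (mulrDl k%:R) mul1r.
move: (k%:R * eta) => u h1 h2; rewrite ler_norml; apply/andP; split; move: h1 h2; clear; lra.
Qed.

Lemma complex_grid (L eta : R) : 0 < L -> 0 < eta ->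
  exists (V : finType) (q : R[i] -> V) (c : V -> R[i]),
  (forall v, measurable (q @^-1` [set v])) /\
  forall z, nc z <= L -> nc (c (q z) - z) <= eta.
Proof.
move=> L0 eta0; have e2 : 0 < eta / 2 by rewrite divr_gt0.
have [m [q [c [mq hq]]]] := real_grid L0 e2.
exists ('I_m.+1 * 'I_m.+1)%type, (fun z => (q (complex.Re z), q (complex.Im z))).
exists (fun v => Complex (c v.1) (c v.2)); split => [[k l]|z zL].
  have -> : (fun z => (q (complex.Re z), q (complex.Im z))) @^-1` [set (k, l)] =
      (@complex.Re R @^-1` (q @^-1` [set k])) `&` (@complex.Im R @^-1` (q @^-1` [set l])).
    by apply/seteqP; split => z /= => [[-> ->]|[-> ->]].
  by apply: measurableI; rewrite -[X in measurable X]setTI;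
    [exact: measurable_Re|exact: measurable_Im].
apply: le_trans (nc_le_ReIm _) _; rewrite ReB ImB /=.
have h1 := hq _ (le_trans (normRe_le z) zL); have h2 := hq _ (le_trans (normIm_le z) zL).
by move: h1 h2; clear; lra.
Qed.

End Grid.

(** * From the finite model to random variables *)

Section Transfer.
Local Open Scope classical_set_scope.
Variable R : realType.
Local Notation C := R[i].

Lemma opbound_sym n (M N : 'M[C]_n) b : opbound (M - N) b -> opbound (N - M) b.
Proof. by move=> h x; rewrite -opprB mulNmx l2normN. Qed.

(** [F] is 1-Lipschitz for the operator norm. *)
Definition op_lipschitz n (F : 'M[C]_n -> R) :=
  forall M N b, 0 <= b -> opbound (M - N) b -> F M <= F N + b.

Lemma opbound_perturb n (M N : 'M[C]_n) a b :
  opbound (M - N) b -> opbound N a -> opbound M (a + b).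
Proof.
move=> h hN x; rewrite -[M](subrK N) addrC mulmxDl mulrDl.
by apply: le_trans (l2normD _ _) _; exact: lerD.
Qed.

Lemma smallest_singular_value_lipschitz n : (0 < n)%N ->
  op_lipschitz (fun M : 'M[C]_n => singular_value M n).
Proof.
move=> n0 M N b b0 h; have [_ hM _] := smallest_singular_value M n0.
have [_ _ [x x1 hx]] := smallest_singular_value N n0.
have := hM x; rewrite x1 mulr1 => hMx; apply: le_trans hMx _.
rewrite -hx -[M](subrK N) mulmxDl addrC; apply: le_trans (l2normD _ _) _.
by rewrite lerD2l; have := h x; rewrite x1 mulr1.
Qed.

Lemma opnorm_lipschitz n : op_lipschitz (@opnorm R n).
Proof.
move=> M N b b0 h; have a0 := opnorm_ge0 N.
apply/(opbound_opnorm M); first exact: addr_ge0.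
by apply: opbound_perturb h _; exact/(opbound_opnorm N a0).
Qed.

Lemma structured_mx_close n (A : 'M[R]_n) (X Y B : 'M[C]_n) eta : 0 <= eta ->
  (forall i j, 0 <= A i j <= 1) -> (forall i j, nc (X i j - Y i j) <= eta) ->
  opbound (structured_mx A X B - structured_mx A Y B) (n%:R * eta).
Proof.
move=> eta0 A01 XY; apply: opbound_entrywise => // i j; rewrite !mxE.
have -> (a x y b : C) : a * x + b - (a * y + b) = a * (x - y) by ring.
have /andP[a0 a1] := A01 i j.
rewrite ncM nc_real ger0_norm //; apply: le_trans (XY i j).
by rewrite ler_piMl // nc_ge0.
Qed.

Context d (T : measurableType d) n (X : 'I_n -> 'I_n -> T -> C).
Hypothesis mX : forall i j, measurable_fun [set: T] (X i j).
Variables (A : 'M[R]_n) (B : 'M[C]_n).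
Hypothesis A01 : forall i j, 0 <= A i j <= 1.

Let Mw w := structured_mx A (\matrix_(i, j) X i j w) B.

Definition rounded (V : finType) (q : C -> V) (w : T) : outcome n V :=
  [ffun i => [ffun j => q (X i j w)]].

Lemma measurable_rounded_entry (V : finType) (q : C -> V) i j v :
  (forall v, measurable (q @^-1` [set v])) -> measurable ((fun w => q (X i j w)) @^-1` [set v]).
Proof. by move=> mq; rewrite -[Z in measurable Z]setTI; exact: (mX i j measurableT (mq v)). Qed.

Lemma measurable_rounded (V : finType) (q : C -> V) (S : set (outcome n V)) :
  (forall v, measurable (q @^-1` [set v])) -> measurable (rounded q @^-1` S).
Proof.
move=> mq; apply: (@measurable_finite_family _ _ _ _
  (fun i w => [ffun j => q (X i j w)])) => i v.
exact: (@measurable_finite_family _ _ _ _ (fun j w => q (X i j w)) [set v])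
  (fun j v' => measurable_rounded_entry i j v' mq).
Qed.

Lemma rounded_close (V : finType) (q : C -> V) (c : V -> C) L eta w : 0 <= eta ->
  (forall z, nc z <= L -> nc (c (q z) - z) <= eta) -> (forall i j, nc (X i j w) <= L) ->
  opbound (model_mx c A B (rounded q w) - Mw w) (n%:R * eta).
Proof.
move=> eta0 hq XL; apply: structured_mx_close => // i j.
by rewrite !mxE !ffunE; exact: hq.
Qed.

(** A Lipschitz function of the matrix is a pointwise limit of functions of the
    rounded entries, hence is measurable. *)
Lemma measurable_op_lipschitz (F : 'M[C]_n -> R) : op_lipschitz F ->
  measurable_fun [set: T] (fun w => F (Mw w)).
Proof.
move=> lF.
have step k : exists h : T -> R, measurable_fun [set: T] h /\
    forall w, (forall i j, nc (X i j w) <= k.+1%:R) -> `|F (Mw w) - h w| <= n%:R * k.+1%:R^-1.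
  have L0 : 0 < k.+1%:R :> R by rewrite ltr0n.
  have e0 : 0 < k.+1%:R^-1 :> R by rewrite invr_gt0.
  have [V [q [c [mq hq]]]] := complex_grid L0 e0.
  exists (fun w => F (model_mx c A B (rounded q w))); split => [_ S mS|w hw].
    rewrite setTI.
    exact: (measurable_rounded [set o | S (F (model_mx c A B o))] mq).
  have hb := rounded_close (ltW e0) hq hw.
  have b0 : 0 <= n%:R * k.+1%:R^-1 :> R by rewrite mulr_ge0 // ltW.
  have h1 := lF _ _ _ b0 hb; have h2 := lF _ _ _ b0 (opbound_sym hb).
  by rewrite ler_norml lerNl opprB !lerBlDl h1 h2.
have [h hP] := choice step.
apply: (@measurable_fun_cvg _ _ _ _ h) => [k|w _]; first by case: (hP k).
apply/cvgrPdist_le => e e0.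
have [N N0 hN] := exists_nat_ge (\sum_i \sum_j nc (X i j w) + n%:R / e).
have s0 i : 0 <= \sum_j nc (X i j w) by apply: sumr_ge0 => j _; exact: nc_ge0.
exists N => // k /= Nk.
have Nk' : N%:R <= k.+1%:R :> R by rewrite ler_nat; exact: leqW.
have ne0 : 0 <= n%:R / e by rewrite divr_ge0 // ltW.
have S0 : 0 <= \sum_i \sum_j nc (X i j w) by apply: sumr_ge0 => i _; exact: s0.
have [_ hk] := hP k; apply: le_trans (hk w _) _ => [i j|].
  apply: (@le_trans _ _ (\sum_i \sum_j nc (X i j w))).
    rewrite (bigD1 i) //= (bigD1 j) //= -addrA lerDl addr_ge0 //.
      by apply: sumr_ge0 => l _; exact: nc_ge0.
    by apply: sumr_ge0 => l _; exact: s0.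
  by apply: le_trans Nk'; apply: le_trans hN; rewrite lerDl.
rewrite ler_pdivrMr ?ltr0n // mulrC -ler_pdivrMr //.
by apply: le_trans Nk'; apply: le_trans hN; rewrite lerDr.
Qed.

End Transfer.

Section Law.
Local Open Scope classical_set_scope.
Variable R : realType.
Local Notation C := R[i].
Context d (T : measurableType d) (P : probability T R).

(** Chebyshev's bound [L ^ -2], weakened to [L ^ -1]. *)
Lemma chebyshev_tail (X : T -> C) (L : R) : measurable_fun [set: T] X -> 1 <= L ->
  cmoment2 P X = 1%E -> fine (P [set w | L <= nc (X w - 0)]) <= L^-1.
Proof.
move=> mX L1 X2; have L0 : 0 < L by apply: lt_le_trans L1.
set D := [set w | _]; have mD : measurable D by exact: measurable_far.
have h2 : has_mean P (fun w => nc (X w) ^+ 2) 1 by exact: has_mean_moment2.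
have h : L * fine (P D) <= 1.
  apply: has_mean_le (has_meanZ L (has_mean_indic P mD)) h2 _ => w.
  rewrite indicE; have [hw|hw] := pselect (D w).
    rewrite mem_set // mulr1; rewrite /D /= subr0 in hw; apply: (le_trans hw).
    by rewrite expr2 ler_peMl ?nc_ge0 // (le_trans L1 hw).
  by rewrite memNset // mulr0 sqr_ge0.
by rewrite -(ler_pM2l L0) divff ?gt_eqF.
Qed.

Lemma rounded_nondegenerate (X : T -> C) (V : finType) (q : C -> V) (c : V -> C)
    (L eta r p0 : R) : measurable_fun [set: T] X -> cmoment2 P X = 1%E ->
  (forall v, measurable (q @^-1` [set v])) ->
  (forall z, nc z <= L -> nc (c (q z) - z) <= eta) ->
  1 <= L -> 2 / p0 <= L -> 0 < p0 -> eta <= r / 2 ->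
  (forall z, p0 <= fine (P [set w | r <= nc (X w - z)])) ->
  nondegenerate (fun v => fine (P (X @^-1` (q @^-1` [set v])))) c (r / 2) (p0 / 2).
Proof.
move=> mX X2 mq hq L1 L2 p00 er hX z.
have L0 : 0 < L by apply: lt_le_trans L1.
have mqX v : measurable ((q \o X) @^-1` [set v]).
  by have := mX measurableT _ (mq v); rewrite setTI.
pose S v := r / 2 <= nc (c v - z).
have <- := finite_valued_law P S mqX.
have mS : measurable ((q \o X) @^-1` [set v | S v]) by exact: measurable_finite_valued.
have mD := measurable_far z r mX; have mL := measurable_far 0 L mX.
have h := has_mean_le (has_mean_indic P mD)
  (has_meanD (has_mean_indic P mS) (has_mean_indic P mL)).
have {}h := h _; have tail := chebyshev_tail mX L1 X2.
have L3 : L^-1 <= p0 / 2.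
  by rewrite -[p0 / 2]invrK invf_div lef_pV2 ?posrE // divr_gt0.
have hh : fine (P [set w | r <= nc (X w - z)]) <=
    fine (P ((q \o X) @^-1` [set v | S v])) + fine (P [set w | L <= nc (X w - 0)]).
  apply: h => w; rewrite [leLHS]indicE.
  have [hw|hw] := pselect ([set w | r <= nc (X w - z)] w); last first.
    by rewrite memNset // addr_ge0 // indicE.
  rewrite mem_set //; have [XL|XL] := leP L (nc (X w)).
    rewrite [X in _ + X]indicE mem_set /= ?subr0 // lerDr indicE //.
  rewrite [X in X + _]indicE mem_set /= ?lerDl ?indicE // /S /=.
  have h1 := hq _ (ltW XL); have := ncD (X w - c (q (X w))) (c (q (X w)) - z).
  rewrite addrA subrK nc_distC => h2; rewrite /= in hw.
  by move: hw h1 h2 er; lra.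
by have := hX z; move: hh tail L3; lra.
Qed.

End Law.

Section Independence.
Local Open Scope classical_set_scope.
Variable R : realType.
Local Notation C := R[i].

Lemma rounded_law n d (T : measurableType d) (P : probability T R)
    (X : 'I_n -> 'I_n -> {RV P >-> C}) d' (T' : measurableType d') (P' : probability T' R)
    (xi : {RV P' >-> C}) (V : finType) (q : C -> V) (S : outcome n V -> Prop) :
  mutually_independent P (fun ij : 'I_n * 'I_n => X ij.1 ij.2) ->
  (forall i j, identically_distributed P P' (X i j) xi) ->
  (forall v, measurable (q @^-1` [set v])) ->
  fine (P (rounded (fun i j => X i j : T -> C) q @^-1` [set o | S o])) =
  fpr (iidw (fun v => fine (P' (xi @^-1` (q @^-1` [set v]))))) S.
Proof.
move=> indX idX mq; pose Y i j : T -> C := X i j.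
have mY i j : measurable_fun [set: T] (Y i j) by exact: measurable_funPT.
have mo o : measurable (rounded Y q @^-1` [set o]) by exact: measurable_rounded.
rewrite -/Y (finite_valued_law P S mo); apply: eq_bigr => o _; congr (_ * _).
have -> : rounded Y q @^-1` [set o] =
    \bigcap_(ij in [set` (boot.finset.setTfor ('I_n * 'I_n)%type)]) (X ij.1 ij.2 @^-1` (q @^-1` [set o ij.1 ij.2])).
  apply/seteqP; split => w /= => [<- [i j] _|h]; first by rewrite /= !ffunE.
  by apply/ffunP => i; apply/ffunP => j; rewrite !ffunE; apply: (h (i, j)); rewrite /= boot.finset.inE.
rewrite (indX _ (fun ij => q @^-1` [set o ij.1 ij.2])) => [|ij]; last exact: mq.
have e ij : P (X ij.1 ij.2 @^-1` (q @^-1` [set o ij.1 ij.2])) =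
    (fine (P' (xi @^-1` (q @^-1` [set o ij.1 ij.2]))))%:E.
  have := idX ij.1 ij.2 _ (mq (o ij.1 ij.2)); rewrite /distribution /pushforward => ->.
  by rewrite fineK // fin_num_measure // -[Z in measurable Z]setTI;
     exact: (@measurable_funPT _ _ _ _ xi).
under eq_bigr => ij _ do rewrite e.
rewrite prodEFin /= /iidw /prodw pair_bigA /=.
by apply: eq_bigl => ij; rewrite boot.finset.inE.
Qed.

End Independence.

Section Connectivity.
Import boot.fintype boot.finset.
Variable R : realType.

Lemma nbhd_threshold n (A : 'M[R]_n) (sigma : R) i : 0 < sigma ->
  nbhd (threshold sigma A) i = [set j | sigma <= A i j].
Proof.
move=> s0; apply/setP => j; rewrite !inE mxE; case: ifP => [h|_]; last by rewrite ltxx.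
exact: lt_le_trans h.
Qed.

Lemma broadly_connected_degrees n (A : 'M[R]_n) (delta nu sigma : R) : 0 < sigma ->
  broadly_connected delta nu (threshold sigma A) ->
  [/\ forall i, delta * n%:R <= #|[set j | sigma <= A i j]|%:R,
      forall j, delta * n%:R <= #|[set i | sigma <= A i j]|%:R
    & expanding A sigma delta nu].
Proof.
move=> s0 [h1 h2 h3]; split => [i|j|N].
- by rewrite -nbhd_threshold.
- have -> : [set i | sigma <= A i j] = nbhd (threshold sigma A)^T j; last exact: h2.
  apply/setP => i; rewrite !inE !mxE; case: ifP => [h|_]; last by rewrite ltxx.
  by rewrite (lt_le_trans s0).
- have -> : dense_rows A sigma delta N = dense_nbhd delta (threshold sigma A) N; last exact: h3.
  apply/setP => i; rewrite !inE nbhd_threshold //; congr (_ <= _%:R).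
  by apply: eq_card => j; rewrite !inE andbC.
Qed.

End Connectivity.

Section FinalBound.
Local Open Scope classical_set_scope.
Local Open Scope ring_scope.

(** The event is contained in the union of its rounded version, with slightly
    worse constants, and of the event that some entry leaves the grid. *)
Lemma prob_le_finite_model (R : realType) n d (T : measurableType d) (P : probability T R)
    (X : 'I_n -> 'I_n -> {RV P >-> R[i]}) d' (T' : measurableType d') (P' : probability T' R)
    (xi : {RV P' >-> R[i]}) (V : finType) (q : R[i] -> V) (c : V -> R[i])
    (A : 'M[R]_n) (B : 'M[R[i]]_n) (L eta a b : R) :
  (0 < n)%N -> 0 <= eta -> 1 <= L -> 0 <= b ->
  (forall i j, 0 <= A i j <= 1) -> cmoment2 P' xi = 1%E ->
  mutually_independent P (fun ij : 'I_n * 'I_n => X ij.1 ij.2) ->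
  (forall i j, identically_distributed P P' (X i j) xi) ->
  (forall v, measurable (q @^-1` [set v])) ->
  (forall z, nc z <= L -> nc (c (q z) - z) <= eta) ->
  let E := [set w | let M := structured_mx A (\matrix_(i, j) X i j w) B in
              singular_value M n <= a /\ opnorm M <= b] in
  measurable E /\
  fine (P E) <= fpr (iidw (fun v => fine (P' (xi @^-1` (q @^-1` [set v])))))
      (fun o => opbound (model_mx c A B o) (b + n%:R * eta) /\
         exists2 x, l2norm x = 1 & l2norm (model_mx c A B o *m x) <= a + n%:R * eta)
    + n%:R * (n%:R * L^-1).
Proof.
move=> n0 eta0 L1 b0 A01 xi2 indX idX mq hq E.
pose Y i j : T -> R[i] := X i j.
have mY i j : measurable_fun [set: T] (Y i j) by exact: measurable_funPT.
have mE : measurable E.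
  have m1 := measurable_op_lipschitz mY B A01 (smallest_singular_value_lipschitz n0).
  have m2 := measurable_op_lipschitz mY B A01 (@opnorm_lipschitz R n).
  have -> : E = (fun w => singular_value (structured_mx A (\matrix_(i, j) Y i j w) B) n) @^-1` `]-oo, a]%classic
     `&` (fun w => opnorm (structured_mx A (\matrix_(i, j) Y i j w) B)) @^-1` `]-oo, b]%classic.
    by apply/seteqP; split => w /=; rewrite /E /= !in_itv /=.
  by apply: measurableI; rewrite -[Z in measurable Z]setTI; [exact: m1|exact: m2].
split=> //.
set F := (fun o => _ /\ _).
rewrite -(rounded_law F indX idX mq).
set G := (rounded _ q @^-1` _).
have mG : measurable G by exact: (measurable_rounded mY).
pose far i j := [set w | L <= nc (Y i j w - 0)].
have mfar i j : measurable (far i j) by exact: measurable_far.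
have farle i j : fine (P (far i j)) <= L^-1.
  have mS : measurable [set z : R[i] | L <= nc (z - 0)].
    exact: (measurable_far 0 L (@measurable_id _ _ _)).
  have := idX i j _ mS; rewrite /distribution /pushforward => e.
  have -> : P (far i j) = P' [set w | L <= nc (xi w - 0)] by exact: e.
  by apply: chebyshev_tail => //; exact: measurable_funPT.
have hfar := has_mean_sum (index_enum 'I_n) (fun i => has_mean_sum (index_enum 'I_n)
  (fun j => has_mean_indic P (mfar i j))).
have hle := has_mean_le (has_mean_indic P mE) (has_meanD (has_mean_indic P mG) hfar).
apply: (@le_trans _ _ (fine (P G) + \sum_(i < n) \sum_(j < n) fine (P (far i j)))); last first.
  have sumn (F' : 'I_n -> R) u : (forall i, F' i <= u) -> \sum_i F' i <= n%:R * u.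
    move=> Fu; apply: (le_trans (ler_sum _ (fun i _ => Fu i))).
    by rewrite sumr_const card_ord mulr_natl.
  by rewrite lerD2l; do 2 apply: (sumn) => ?.
apply: hle => w; rewrite [leLHS]indicE.
have ind0 (S : set T) v : 0 <= \1_S v :> R by rewrite indicE.
have sum0 i : 0 <= \sum_(j < n) \1_(far i j) w :> R by apply: sumr_ge0.
have [Ew|Ew] := pselect (E w); last by rewrite memNset // addr_ge0 // sumr_ge0.
rewrite mem_set //.
have [/existsP[i /existsP[j hij]]|hw] := boolP [exists i, [exists j, L <= nc (Y i j w)]].
  apply: (@le_trans _ _ (\1_(far i j) w)).
    by rewrite indicE mem_set // /far /= subr0.
  rewrite -[leLHS]add0r; apply: lerD => //.
  rewrite (bigD1 i) //= (bigD1 j) //= -addrA lerDl addr_ge0 //; apply: sumr_ge0 => //.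
have YL i j : nc (Y i j w) <= L.
  by apply/ltW; rewrite ltNge; apply: contra hw => h; apply/existsP; exists i; apply/existsP; exists j.
rewrite indicE mem_set ?lerDl ?sumr_ge0 // /G /= /F.
have close := rounded_close B A01 eta0 hq YL.
case: Ew => s1 s2; split.
  by apply: opbound_perturb close _; exact/(opbound_opnorm _ b0).
have [_ _ [x x1 hx]] := smallest_singular_value (structured_mx A (\matrix_(i, j) Y i j w) B) n0.
exists x => //; rewrite -[model_mx _ _ _ _](subrK (structured_mx A (\matrix_(i, j) Y i j w) B)).
rewrite mulmxDl addrC; apply: le_trans (l2normD _ _) _; apply: lerD; first by rewrite hx.
by have := close x; rewrite x1 mulr1.
Qed.

End FinalBound.

Unset Implicit Arguments.

Local Open Scope classical_set_scope.
Local Open Scope ring_scope.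

Theorem theorem1p12 (R : realType) (K delta nu sigma0 kappa0 : R)
    (hK : 1 <= K) (hdelta : 0 < delta < 1) (hnu : 0 < nu < 1)
    (hsigma0 : 0 < sigma0 < 1) (hkappa0 : 1 <= kappa0) :
  exists C : R,
  forall (n : nat) (A : 'M[R]_n) (B : 'M[R[i]]_n)
    (d : measure_display) (T : measurableType d) (P : probability T R)
    (X : 'I_n -> 'I_n -> {RV P >-> R[i]})
    (d' : measure_display) (T' : measurableType d') (P' : probability T' R)
    (xi : {RV P' >-> R[i]}),
  (1 <= n)%N ->
  (forall i j, 0 <= A i j <= 1) ->
  cexpectation P' xi = 0 ->
  cmoment2 P' xi = 1%E ->
  spread P' kappa0 xi ->
  mutually_independent P (fun ij : 'I_n * 'I_n => X ij.1 ij.2) ->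
  (forall i j, identically_distributed P P' (X i j) xi) ->
  broadly_connected delta nu (threshold sigma0 A) ->
  forall t : R, 0 <= t ->
  (P [set w | let M := structured_mx A (\matrix_(i, j) X i j w)%R B in
              (singular_value M n <= t / Num.sqrt n%:R)%R /\
              (opnorm M <= K * Num.sqrt n%:R)%R]
   <= (C * (t + 1 / Num.sqrt n%:R))%:E)%E.
Proof.
have /andP[sg0 sg1] := hsigma0; have /andP[nu0 nu1] := hnu.
have k0 : 0 < kappa0 by apply: lt_le_trans hkappa0.
have q0 : 0 < kappa0^-1 by rewrite invr_gt0.
have q1 : kappa0^-1 <= 1 by rewrite invf_le1.
set r := kappa0^-1 / 4; set p0 := kappa0^-1 ^+ 3 / 64.
have r0 : 0 < r by rewrite divr_gt0 // ltr0n.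
have p00 : 0 < p0 by rewrite divr_gt0 ?exprn_gt0 // ltr0n.
have p01 : p0 <= 1.
  rewrite ler_pdivrMr ?ltr0n // mul1r; apply: (@le_trans _ _ 1); last by rewrite ler1n.
  by rewrite exprn_ile1 // ltW.
have hp0 : 0 < p0 / 2 <= 1.
  by rewrite divr_gt0 //= ler_pdivrMr // mul1r (le_trans p01) // ler1n.
have r20 : 0 < r / 2 by rewrite divr_gt0.
have K0 : 0 < 2 * K by rewrite mulr_gt0 // (lt_le_trans _ hK).
have [C0 C00 hC] := finite_model_bound K0 hdelta sg0 nu0 r20 hp0.
exists (2 * C0 + 1).
move=> n A B d T P X d' T' P' xi n0 A01 xi1 xi2 xis indX idX hbc t t0.
have [hrow hcol hexp] := broadly_connected_degrees sg0 hbc.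
have nR : 1 <= n%:R :> R by rewrite ler1n.
have nR0 : 0 < n%:R :> R by rewrite ltr0n.
have sn : 1 <= Num.sqrt n%:R :> R by rewrite -[leLHS]sqrtr1 ler_sqrt.
have sn0 : 0 < Num.sqrt n%:R :> R by apply: lt_le_trans sn.
have snn : Num.sqrt n%:R * Num.sqrt n%:R = n%:R :> R by rewrite -expr2 sqr_sqrtr // ltW.
(* The mesh is so fine that rounding moves the matrix by at most [1 / n]. *)
pose eta : R := Num.min (n%:R ^- 2) (r / 2).
have eta0 : 0 < eta by rewrite lt_min r20 andbT invr_gt0 exprn_gt0.
have eta1 : eta <= r / 2 by rewrite ge_min lexx orbT.
have eta2 : n%:R * eta <= n%:R^-1.
  have : eta <= n%:R ^- 2 by rewrite ge_min lexx.
  by rewrite -(ler_pM2l nR0) expr2 invfM mulrA divff ?gt_eqF // mul1r.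
(* The grid is so large that the entries leave it with probability at most
   [1 / sqrt n], and that truncation costs at most half of [p0]. *)
have [m _ hm] := exists_nat_ge (n%:R ^+ 3 + 2 / p0).
set L : R := m%:R in hm.
have n3 : 1 <= n%:R ^+ 3 :> R by rewrite exprn_ege1.
have p20 : 0 < 2 / p0 by rewrite divr_gt0.
have L3 : n%:R ^+ 3 <= L by apply: le_trans hm; rewrite lerDl ltW.
have Lp : 2 / p0 <= L.
  by apply: le_trans hm; rewrite lerDr (le_trans _ n3).
have L1 : 1 <= L := le_trans n3 L3.
have L0 : 0 < L by apply: lt_le_trans L1.
have [V [q [c [mq hq]]]] := complex_grid L0 eta0.
have b0 : 0 <= K * Num.sqrt n%:R by rewrite mulr_ge0 ?(ltW sn0) // (le_trans _ hK).
have [mE hE] := prob_le_finite_model B (t / Num.sqrt n%:R) n0 (ltW eta0) L1 b0 A01 xi2 indX idX mq hq.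
have mxi : measurable_fun [set: T'] xi by exact: measurable_funPT.
pose p v := fine (P' (xi @^-1` (q @^-1` [set v]))).
have wp : is_prob p.
  apply: (finite_valued_prob P' (g := fun w => q (xi w))) => v.
  by have := mxi measurableT _ (mq v); rewrite setTI.
have nd : nondegenerate p c (r / 2) (p0 / 2).
  apply: (rounded_nondegenerate mxi xi2 mq hq L1 Lp p00 eta1) => z.
  exact: spread_nondegenerate.
have s10 : 0 <= 1 / Num.sqrt n%:R :> R by rewrite divr_ge0 // ltW.
have t'0 : 0 <= t + 1 / Num.sqrt n%:R by rewrite addr_ge0.
have := hC n V p c A B n0 wp nd A01 hrow hcol hexp _ t'0.
set F' := (F' in fpr _ F'); move: hE; set E := (E in fine (P E)); set F := (F in fpr _ F).
move=> hE hF'.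
have FF' : fpr (iidw p) F <= fpr (iidw p) F'.
  apply: (le_fpr (iidw_prob n wp)) => o [oK [x x1 hx]]; split.
    move=> y; apply: le_trans (oK y) _; rewrite ler_wpM2r ?l2norm_ge0 //.
    have : n%:R^-1 <= 1 :> R by rewrite invf_le1.
    have : 1 <= K * Num.sqrt n%:R by rewrite -[leLHS]mulr1 ler_pM.
    rewrite -[2 * K * _]mulrA; move: eta2; clear; lra.
  exists x => //; apply: le_trans hx _; rewrite mulrDl lerD2l.
  by rewrite div1r -invfM snn.
have junk : n%:R * (n%:R * L^-1) <= 1 / Num.sqrt n%:R.
  apply: (@le_trans _ _ n%:R^-1).
    rewrite mulrA ler_pdivrMr // [leRHS]mulrC ler_pdivlMr //.
    by apply: le_trans L3; rewrite exprSr expr2.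
  by rewrite div1r lef_pV2 ?posrE // -[leRHS]snn ler_peMl // ltW.
rewrite -[X in (X <= _)%E]fineK ?fin_num_measure // lee_fin.
have h := le_trans hE (lerD (le_trans FF' hF') junk); apply: le_trans h _.
have h1 := mulr_ge0 (ltW C00) t0.
by move: s10 t0 h1; rewrite !mulrDr !mulrDl; lra.
Qed.
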